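(* Let $\Omega\subseteq\mathbb R^d$ be open, $m\in\mathbb N$, $l\in\{0,\dots,m\}$, and let $u_n\rightharpoonup 0$ weakly in $L^2_{\rm loc}(\Omega;\mathbb C^r)$ satisfy $$\sum_{l\le|\alpha|\le m}\varepsilon_n^{|\alpha|-l}\,\partial_\alpha(A_n^\alpha u_n)=f_n\quad\text{in }\Omega,$$ where $0<\varepsilon_0\le\varepsilon_n\le\varepsilon_\infty<\infty$ for all $n$ (with constants $\varepsilon_0,\varepsilon_\infty$), $A_n^\alpha\in C(\Omega;\mathrm M_{q\times r}(\mathbb C))$, $A_n^\alpha\to A^\alpha$ locally uniformly on $\Omega$ for every multi-index $\alpha$ with $l\le|\alpha|\le m$, and $(f_n)$ is a sequence in $H^{-m}_{\rm loc}(\Omega;\mathbb C^q)$ such that for every $\varphi\in C_c^\infty(\Omega)$ $$\frac{\widehat{\varphi f_n}}{1+\sum_{s=l}^m\varepsilon_n^{s-l}|\xi|^s}\longrightarrow 0\quad\text{strongly in }L^2(\mathbb R^d;\mathbb C^q).$$ Let $(\omega_n)$ be a sequence of positive numbers with $\omega_n\to0^+$ (so that $\lim_n\varepsilon_n/\omega_n=\infty$), and let $\mu$ be the one-scale H-measure with characteristic length $(\omega_n)$ associated to (a subsequence of) $(u_n)$. Then $$p_{pr}\,\mu^\top=0\quad\text{on }\Omega\times \mathrm K_{0,\infty}(\mathbb R^d),\qquad p_{pr}(x,\xi)=\sum_{|\alpha|=m}(2\pi i)^m\Big(\frac{\xi}{|\xi|}\Big)^\alpha A^\alpha(x).$$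
   Context: Conventions: functions on $\Omega$ are extended by zero to $\mathbb R^d$; $\hat u(\xi)=\int_{\mathbb R^d}e^{-2\pi i x\cdot\xi}u(x)\,dx$; $(a\otimes b)_{ij}=a_i\overline{b_j}$. $f\in H^{-m}_{\rm loc}(\Omega)$ means $\varphi f\in H^{-m}(\mathbb R^d)$ for all $\varphi\in C_c^\infty(\Omega)$. Compactification: $\mathrm K_{0,\infty}(\mathbb R^d)$ is the compactification of $\mathbb R^d\setminus\{0\}$ obtained by adjoining a unit sphere $\Sigma_0=\{0^e:e\in S^{d-1}\}$ at the origin and a unit sphere $\Sigma_\infty=\{\infty^e:e\in S^{d-1}\}$ at infinity, with the topology of $S^{d-1}\times[0,\infty]$ (the point $re$ corresponds to $(e,r)$, $0^e$ to $(e,0)$, $\infty^e$ to $(e,\infty)$). Thus $C(\mathrm K_{0,\infty}(\mathbb R^d))$ is identified with the space of continuous $\psi$ on $\mathbb R^d\setminus\{0\}$ for which there are $\psi_0,\psi_\infty\in C(S^{d-1})$ with $\psi(\xi)-\psi_0(\xi/|\xi|)\to0$ as $|\xi|\to0$ and $\psi(\xi)-\psi_\infty(\xi/|\xi|)\to0$ as $|\xi|\to\infty$; then $\psi(0^e)=\psi_0(e)$, $\psi(\infty^e)=\psi_\infty(e)$. Functions of $\xi/|\xi|$ are extended by continuity to $\Sigma_0\cup\Sigma_\infty$ ($\xi/|\xi|=e$ at $0^e$ and $\infty^e$). One-scale H-measure: if $u_n\rightharpoonup0$ in $L^2_{\rm loc}(\Omega;\mathbb C^r)$ and $\omega_n\to0^+$,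 then, after passing to a subsequence, there is a (unique) $r\times r$ hermitian non-negative matrix Radon measure $\mu$ on $\Omega\times\mathrm K_{0,\infty}(\mathbb R^d)$ such that for all $\varphi_1,\varphi_2\in C_c(\Omega)$, $\psi\in C(\mathrm K_{0,\infty}(\mathbb R^d))$, $$\lim_n\int_{\mathbb R^d}\big(\widehat{\varphi_1u_n}(\xi)\otimes\widehat{\varphi_2u_n}(\xi)\big)\psi(\omega_n\xi)\,d\xi=\int_{\Omega\times\mathrm K_{0,\infty}(\mathbb R^d)}\varphi_1(x)\overline{\varphi_2(x)}\psi(\xi)\,d\bar\mu(x,\xi),$$ where $\bar\mu$ is the entrywise complex conjugate. $\mu$ is called the one-scale H-measure with characteristic length $(\omega_n)$ associated to the (sub)sequence. *)

(* Defs.v *)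
From HB Require Import structures.
From mathcomp Require Import all_boot all_order all_algebra.
From mathcomp Require Import complex.
From mathcomp Require Import all_classical all_reals all_analysis.

Set Implicit Arguments.
Unset Strict Implicit.
Unset Printing Implicit Defensive.

Import Order.TTheory GRing.Theory Num.Theory.
Import numFieldNormedType.Exports.

Local Open Scope classical_set_scope.
Local Open Scope ring_scope.
Local Open Scope complex_scope.

(* R^d is 'rV[R]_d.  Its sigma-algebra is generated by the coordinates (hence
   is the Borel one). *)
Fact rV_display : measure_display. Proof. exact: default_measure_display. Qed.

Section rV_measurable.
Variables (R : realType) (d : nat).

Definition rV_coord (i : 'I_d) (x : 'rV[R]_d) : measurableTypeR R := x ord0 i.

Let rV_set0 : g_sigma_preimage rV_coord set0.
Proof. exact: sigma_algebra0. Qed.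

Let rV_setC A : g_sigma_preimage rV_coord A -> g_sigma_preimage rV_coord (~` A).
Proof. exact: sigma_algebraC. Qed.

Let rV_bigcup (F : _^nat) : (forall i, g_sigma_preimage rV_coord (F i)) ->
  g_sigma_preimage rV_coord (\bigcup_i (F i)).
Proof. exact: sigma_algebra_bigcup. Qed.

HB.instance Definition _ := @isMeasurable.Build
  rV_display 'rV[R]_d
  (g_sigma_preimage rV_coord) rV_set0 rV_setC rV_bigcup.
End rV_measurable.

Section lebesgue_rV.
Variable R : realType.

Definition rV_cons d (p : measurableTypeR R * 'rV[R]_d) : 'rV[R]_d.+1 :=
  row_mx (const_mx (p.1 : R) : 'rV[R]_1) p.2 : 'rV[R]_(1 + d).

Definition rV_uncons d (x : 'rV[R]_d.+1) : measurableTypeR R * 'rV[R]_d :=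
  (lsubmx (x : 'rV[R]_(1 + d)) ord0 ord0, rsubmx (x : 'rV[R]_(1 + d))).

Lemma measurable_rV_coord d i : measurable_fun setT (@rV_coord R d i).
Proof.
move=> _ Y mY; rewrite setTI; apply: sub_sigma_algebra => /=.
rewrite -bigcup_seq/=; exists i => /=; first by rewrite mem_index_enum.
by exists Y => //; rewrite setTI.
Qed.

Lemma measurable_fun_rV d' (T : measurableType d') d (f : T -> 'rV[R]_d) :
  (forall i, measurable_fun setT (@rV_coord R d i \o f)) ->
  measurable_fun setT f.
Proof.
move=> mf.
suff : g_sigma_preimage (fun i => @rV_coord R d i \o f) `<=` measurable.
  rewrite g_sigma_preimage_comp => prefS _ A mA.
  by apply: prefS; exists A.
apply: smallest_sub; first exact: sigma_algebra_measurable.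
case: d => [|d] in f mf *; first by rewrite big_ord0.
rewrite -bigcup_mkord_ord; apply: bigcup_sub => i Ii.
by move=> A [B mB <-]; exact: mf.
Qed.

Lemma measurable_rV_cons d : measurable_fun setT (@rV_cons d).
Proof.
apply: measurable_fun_rV => i.
have [j ->|j ->] := @fintype.split_ordP 1 d i.
- rewrite [X in measurable_fun _ X](_ : _ = fst); first exact: measurable_fst.
  by apply/funext => -[t y]; exact: (etrans (row_mxEl (const_mx t : 'rV[R]_1) y _ _) (mxE _ _ _ _)).
- rewrite [X in measurable_fun _ X](_ : _ = @rV_coord R d j \o snd).
    exact: (measurableT_comp (@measurable_rV_coord d j) measurable_snd).
  by apply/funext => -[t y]; exact: (row_mxEr (const_mx t : 'rV[R]_1) y).
Qed.

Lemma measurable_rV_uncons d : measurable_fun setT (@rV_uncons d).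
Proof.
apply/measurable_fun_pairP; split.
  rewrite [X in measurable_fun _ X](_ : _ = @rV_coord R (1 + d) (lshift d ord0)).
    exact: measurable_rV_coord.
  by apply/funext => x; rewrite /= /rV_coord mxE.
apply: measurable_fun_rV => i.
rewrite [X in measurable_fun _ X](_ : _ = @rV_coord R d.+1 (rshift 1 i)).
  exact: measurable_rV_coord.
by apply/funext => x; rewrite /= /rV_coord mxE.
Qed.

Lemma rV_consK d : cancel (@rV_cons d) (@rV_uncons d).
Proof.
move=> -[t y]; rewrite /rV_uncons /rV_cons; congr pair.
  exact: (etrans (congr1 (fun v : 'rV_1 => v ord0 ord0)
    (row_mxKl (const_mx t : 'rV[R]_1) y)) (mxE _ _ _ _)).
exact: (row_mxKr (const_mx t : 'rV[R]_1) y).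
Qed.

(* The library's sigma-finite instance for m1 \x m2 is not inferred. *)
Lemma sigma_finite_prod d1 d2 (T1 : measurableType d1) (T2 : measurableType d2)
    (m1 : {sigma_finite_measure set T1 -> \bar R})
    (m2 : {sigma_finite_measure set T2 -> \bar R}) :
  sigma_finite setT (m1 \x m2)%E.
Proof.
have /sigma_finiteP[F [TF ndF Foo]] := sigma_finiteT m1.
have /sigma_finiteP[G [TG ndG Goo]] := sigma_finiteT m2.
exists (fun n => F n `*` G n).
  rewrite -setXTT TF TG predeqE => -[x y]; split.
    move=> [/= [n _ Fnx] [k _ Gky]]; exists (maxn n k) => //; split.
    - by move: x Fnx; exact/subsetPset/ndF/leq_maxl.
    - by move: y Gky; exact/subsetPset/ndG/leq_maxr.
  by move=> [n _ []/= ? ?]; split; exists n.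
move=> k; have [? ?] := Foo k; have [? ?] := Goo k.
split; first exact: measurableX.
by rewrite product_measure1E// lte_mul_pinfty// ge0_fin_numE.
Qed.

Definition lebesgue_rV_step d (mu : {sigma_finite_measure set 'rV[R]_d -> \bar R})
  := pushforward (@lebesgue_measure R \x mu)%E (@rV_cons d).

Section lebesgue_rV_step.
Variables (d : nat) (mu : {sigma_finite_measure set 'rV[R]_d -> \bar R}).

Let step0 : lebesgue_rV_step mu set0 = 0%E.
Proof. by rewrite /lebesgue_rV_step /pushforward preimage_set0 measure0. Qed.

Let step_ge0 A : (0 <= lebesgue_rV_step mu A)%E.
Proof. by rewrite /lebesgue_rV_step /pushforward; apply: measure_ge0. Qed.

Let step_sigma_additive : semi_sigma_additive (lebesgue_rV_step mu).
Proof.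
move=> F mF tF mUF; rewrite /lebesgue_rV_step /pushforward preimage_bigcup.
apply: measure_semi_sigma_additive.
- by move=> n; rewrite -[X in measurable X]setTI; exact: measurable_rV_cons.
- apply/trivIsetP => /= i j _ _ ij; rewrite -preimage_setI.
  by move/trivIsetP : tF => /(_ _ _ _ _ ij) ->//; rewrite preimage_set0.
- rewrite -preimage_bigcup -[X in measurable X]setTI.
  exact: measurable_rV_cons.
Qed.

HB.instance Definition _ := isMeasure.Build _ _ _ (lebesgue_rV_step mu)
  step0 step_ge0 step_sigma_additive.

Let step_sigma_finite : sigma_finite setT (lebesgue_rV_step mu).
Proof.
have [F UF Foo] := sigma_finite_prod (@lebesgue_measure R) mu.
exists (fun i => @rV_uncons d @^-1` F i) => [|i].
  by rewrite -preimage_bigcup -UF preimage_setT.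
have [mF Fi] := Foo i; split.
  by rewrite -[X in measurable X]setTI; exact: measurable_rV_uncons.
rewrite /lebesgue_rV_step /pushforward -comp_preimage.
by rewrite (_ : _ \o _ = id)//; apply/funext => p /=; rewrite rV_consK.
Qed.

HB.instance Definition _ := Measure_isSigmaFinite.Build _ _ _
  (lebesgue_rV_step mu) step_sigma_finite.

End lebesgue_rV_step.

(* d-dimensional Lebesgue measure: a unit mass on the one-point space R^0, and
   the product of the one-dimensional measure by the (d-1)-dimensional one. *)
Fixpoint lebesgue_rV d : {sigma_finite_measure set 'rV[R]_d -> \bar R} :=
  if d is d'.+1 then lebesgue_rV_step (lebesgue_rV d')
  else \d_(0 : 'rV[R]_0).

End lebesgue_rV.

(* Complex-valued functions are integrated, differentiated, ... through their
   real and imaginary parts. *)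
Section complex_functions.
Variable R : realType.
Local Notation Re := (@complex.Re R).
Local Notation Im := (@complex.Im R).
Local Notation normc := (@ComplexField.Normc.normc R).

Definition ccvg (z : nat -> R[i]) (l : R[i]) : Prop :=
  (fun n => Re (z n)) @ \oo --> Re l /\ (fun n => Im (z n)) @ \oo --> Im l.

Definition ccontinuous (T : topologicalType) (A : set T) (f : T -> R[i]) : Prop :=
  {within A, continuous (fun x => Re (f x))} /\
  {within A, continuous (fun x => Im (f x))}.

Variable d : nat.
Local Notation E := 'rV[R]_d.
Local Notation leb := (lebesgue_rV R d).

Definition edot (x y : E) : R := \sum_(i < d) x ord0 i * y ord0 i.
Definition enorm (x : E) : R := Num.sqrt (edot x x).

Definition cmeasurable (D : set E) (f : E -> R[i]) : Prop :=
  measurable_fun D (fun x => Re (f x)) /\ measurable_fun D (fun x => Im (f x)).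

(* Only meaningful when f is integrable. *)
Definition cintegral (f : E -> R[i]) : R[i] :=
  (\int[leb]_x Re (f x)) +i* (\int[leb]_x Im (f x)).

Definition fourier (f : E -> R[i]) (xi : E) : R[i] :=
  cintegral (fun x =>
    (cos (2 * pi * edot x xi) -i* sin (2 * pi * edot x xi)) * f x).

Definition cpartial (i : 'I_d) (f : E -> R[i]) (x : E) : R[i] :=
  ('D_(delta_mx ord0 i) (fun y => Re (f y)) x)
  +i* ('D_(delta_mx ord0 i) (fun y => Im (f y)) x).

Definition cpartials (s : seq 'I_d) (f : E -> R[i]) : E -> R[i] :=
  foldr cpartial f s.

Definition mi_abs (a : 'I_d -> nat) : nat := \sum_(i < d) a i.

Definition mi_partial (a : 'I_d -> nat) (f : E -> R[i]) : E -> R[i] :=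
  cpartials (flatten [seq nseq (a i) i | i <- enum 'I_d]) f.

(* C^oo : all iterated partial derivatives exist and are continuous. *)
Definition smooth (f : E -> R[i]) : Prop :=
  forall s : seq 'I_d,
    [/\ ccontinuous setT (cpartials s f),
        forall i x, derivable (fun y => Re (cpartials s f y)) x (delta_mx ord0 i)
      & forall i x, derivable (fun y => Im (cpartials s f y)) x (delta_mx ord0 i)].

Definition schwartz (f : E -> R[i]) : Prop :=
  smooth f /\
  forall (j : nat) (s : seq 'I_d), exists M : R,
    forall x, enorm x ^+ j * normc (cpartials s f x) <= M.

Variable Om : set E.

(* Functions on Om are total functions on R^d, of which only the values on Om
   matter; those with compact support in Om are extended by zero. *)
Definition csupported (f : E -> R[i]) : Prop :=
  exists2 K : set E, compact K /\ K `<=` Om & forall x, ~ K x -> f x = 0.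

Definition Cc (f : E -> R[i]) : Prop := ccontinuous setT f /\ csupported f.

Definition test_fun (f : E -> R[i]) : Prop := smooth f /\ csupported f.

Definition L2loc (f : E -> R[i]) : Prop :=
  cmeasurable Om f /\
  forall K : set E, compact K -> K `<=` Om ->
    (\int[leb]_(x in K) (normc (f x) ^+ 2)%:E < +oo)%E.

Definition L2comp (f : E -> R[i]) : Prop :=
  [/\ cmeasurable setT f, (\int[leb]_x (normc (f x) ^+ 2)%:E < +oo)%E
    & csupported f].

(* u_n -> 0 weakly in L^2_loc(Om; C^r), whose dual is the space of compactly
   supported L^2 functions. *)
Definition weakly_null (r : nat) (u : nat -> E -> 'cV[R[i]]_r) : Prop :=
  (forall n i, L2loc (fun x => u n x i ord0)) /\
  forall g : E -> 'cV[R[i]]_r, (forall i, L2comp (fun x => g x i ord0)) ->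
    ccvg (fun n => cintegral (fun x =>
            \sum_(i < r) u n x i ord0 * conjc (g x i ord0))) 0.

Definition cvg_loc_unif (q r : nat) (A_ : nat -> E -> 'M[R[i]]_(q, r))
    (A : E -> 'M[R[i]]_(q, r)) : Prop :=
  forall K : set E, compact K -> K `<=` Om -> forall e : R, 0 < e ->
    \forall n \near \oo, forall x, K x ->
      forall k i, normc (A_ n x k i - A x k i) < e.

(* Distributions on Om: functionals T, of which only the values on test
   functions matter. *)
Definition distribution (T : (E -> R[i]) -> R[i]) : Prop :=
  (forall (a : R[i]) (f g : E -> R[i]), test_fun f -> test_fun g ->
     T (fun x => a * f x + g x) = a * T f + T g) /\
  (forall K : set E, compact K -> K `<=` Om ->
     exists (N : nat) (c : R), forall f, test_fun f ->
       (forall x, ~ K x -> f x = 0) ->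
       forall M : R,
         (forall s : seq 'I_d, (size s <= N)%N ->
            forall x, normc (cpartials s f x) <= M) ->
         normc (T f) <= c * M).

Definition distr_mul (phi : E -> R[i]) (T : (E -> R[i]) -> R[i]) :
    (E -> R[i]) -> R[i] := fun f => T (fun x => phi x * f x).

(* The tempered distribution S belongs to H^{-m}(R^d) and the function g is its
   Fourier transform, i.e. <g, theta> = <S, hat theta> for every Schwartz
   function theta. *)
Definition Hneg_fourier (m : nat) (S : (E -> R[i]) -> R[i]) (g : E -> R[i]) :
    Prop :=
  [/\ cmeasurable setT g,
      (\int[leb]_xi (normc (g xi) ^+ 2 / (1 + enorm xi ^+ 2) ^+ m)%:E < +oo)%E
    & forall theta, schwartz theta ->
        cintegral (fun xi => g xi * theta xi) = S (fourier theta)].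

Definition Hneg_loc (m : nat) (T : (E -> R[i]) -> R[i]) : Prop :=
  distribution T /\
  forall phi, test_fun phi -> exists g, Hneg_fourier m (distr_mul phi T) g.

Definition hweight (l m : nat) (e : R) (xi : E) : R :=
  1 + \sum_(l <= s < m.+1) e ^+ (s - l) * enorm xi ^+ s.

(* g n k is the Fourier transform of phi f_n^k, unique almost everywhere and
   existing when f_n is in H^{-m}_loc:
   hat(phi f_n) / (1 + sum_s eps_n^(s-l) |xi|^s) -> 0 in L^2(R^d; C^q). *)
Definition hweight_null (l m q : nat) (eps : nat -> R)
    (f : nat -> 'I_q -> (E -> R[i]) -> R[i]) : Prop :=
  forall phi, test_fun phi ->
  forall g : nat -> 'I_q -> E -> R[i],
    (forall n k, Hneg_fourier m (distr_mul phi (f n k)) (g n k)) ->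
    (fun n => \int[leb]_xi
       ((\sum_(k < q) normc (g n k xi) ^+ 2) / hweight l m (eps n) xi ^+ 2)%:E)%E
      @ \oo --> 0%E.

(* A multi-index of length at most m has entries at most m. *)
Definition mi_le (m : nat) := {ffun 'I_d -> 'I_m.+1}.
Definition mi_val (m : nat) (a : mi_le m) : 'I_d -> nat := fun i => a i.
Definition mi_len (m : nat) (a : mi_le m) : nat := mi_abs (mi_val a).

(* sum_{l <= |a| <= m} e^(|a|-l) d_a (A^a u) = f  in D'(Om; C^q). *)
Definition pde_solution (l m q r : nat) (e : R)
    (A : mi_le m -> E -> 'M[R[i]]_(q, r)) (u : E -> 'cV[R[i]]_r)
    (f : 'I_q -> (E -> R[i]) -> R[i]) : Prop :=
  forall (k : 'I_q) phi, test_fun phi ->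
    \sum_(a : mi_le m | (l <= mi_len a <= m)%N)
      (e ^+ (mi_len a - l))%:C * (-1) ^+ mi_len a *
      cintegral (fun x => (A a x *m u x) k ord0 * mi_partial (mi_val a) phi x)
    = f k phi.

(* K_{0,oo}(R^d) is S^{d-1} x [0, oo]; the pair (e, t) is the point t e of
   R^d \ {0} if 0 < t < oo, 0^e if t = 0, and oo^e if t = oo. *)
Definition K0oo : set (E * \bar R) :=
  [set z | enorm z.1 = 1 /\ (0 <= z.2)%E].

(* At xi = 0 the value is outside K0oo, but {0} is negligible. *)
Definition K0oo_embed (xi : E) : E * \bar R :=
  ((enorm xi)^-1 *: xi, (enorm xi)%:E).

Local Notation X := (Om `*` K0oo).

Definition CcX (F : E * (E * \bar R) -> R[i]) : Prop :=
  ccontinuous X F /\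
  exists2 L : set (E * (E * \bar R)), compact L /\ L `<=` X
    & forall z, X z -> ~ L z -> F z = 0.

(* Complex Radon measures on Om x K_{0,oo}(R^d), as continuous linear
   functionals on C_c.  The bound makes mu F depend on F only through its
   values on Om x K_{0,oo}(R^d). *)
Definition radon (mu : (E * (E * \bar R) -> R[i]) -> R[i]) : Prop :=
  (forall (a : R[i]) F G, CcX F -> CcX G ->
     mu (fun z => a * F z + G z) = a * mu F + mu G) /\
  (forall L : set (E * (E * \bar R)), compact L -> L `<=` X ->
     exists c : R, forall F, CcX F -> (forall z, X z -> ~ L z -> F z = 0) ->
       forall M : R, (forall z, X z -> normc (F z) <= M) ->
         normc (mu F) <= c * M).

Definition radon_conj (mu : (E * (E * \bar R) -> R[i]) -> R[i]) :
    (E * (E * \bar R) -> R[i]) -> R[i] :=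
  fun F => conjc (mu (fun z => conjc (F z))).

Section matrix_radon.
Variable r : nat.
Variable mu : 'I_r -> 'I_r -> (E * (E * \bar R) -> R[i]) -> R[i].

Definition radon_hermitian : Prop :=
  forall i j F, CcX F -> mu i j F = radon_conj (mu j i) F.

(* 0 <= z in R[i] means that z is real and non-negative. *)
Definition radon_nonneg : Prop :=
  forall F, CcX F -> (forall z, X z -> 0 <= F z) ->
    forall a : 'I_r -> R[i],
      0 <= \sum_(i < r) \sum_(j < r) mu i j F * a j * conjc (a i).

Definition one_scale_Hmeasure (u : nat -> E -> 'cV[R[i]]_r) (omega : nat -> R) :
    Prop :=
  [/\ forall i j, radon (mu i j), radon_hermitian, radon_nonneg
    & forall phi1 phi2 psi, Cc phi1 -> Cc phi2 -> ccontinuous K0oo psi ->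
      forall i j,
        ccvg (fun n => cintegral (fun xi =>
                fourier (fun x => phi1 x * u n x i ord0) xi *
                conjc (fourier (fun x => phi2 x * u n x j ord0) xi) *
                psi (K0oo_embed (omega n *: xi))))
             (radon_conj (mu i j)
                (fun z => phi1 z.1 * conjc (phi2 z.1) * psi z.2))].

(* The matrix measure p mu^T vanishes on Om x K_{0,oo}(R^d). *)
Definition mul_trmx_null (q : nat) (p : E -> E * \bar R -> 'M[R[i]]_(q, r)) :
    Prop :=
  forall (k : 'I_q) (j : 'I_r) F, CcX F ->
    \sum_(i < r) mu j i (fun z => p z.1 z.2 k i * F z) = 0.

End matrix_radon.

(* xi/|xi| is z.1, also on the two spheres at 0 and at oo. *)
Definition principal_symbol (m q r : nat) (A : mi_le m -> E -> 'M[R[i]]_(q, r))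
    (x : E) (z : E * \bar R) : 'M[R[i]]_(q, r) :=
  \sum_(a : mi_le m | mi_len a == m)
    ((0 +i* (2 * pi)) ^+ m * (\prod_(i < d) z.1 ord0 i ^+ mi_val a i)%:C)
      *: A a x.

End complex_functions.

(* Main.v *)
(** Let [phi] be a test function and [p] the principal symbol.  Since
    [d_a (phi . hat theta)] expands by Leibniz into terms
    [d_b phi . hat (monomial . theta)], the multiplication formula for the
    Fourier transform shows that [phi f_n] has the Fourier transform
      [g_n = sum_a eps_n^(|a|-l) (-1)^|a| sum_(b+c=a) monomial_c . F(d_b phi . A_n^a u_n)],
    so the hypothesis on [f_n] says that [g_n / weight_n] tends to 0 in L^2.
    As [eps_n] is bounded away from 0, the weight dominates [1 + |xi|^m]; the
    terms with a factor of degree less than [m] therefore carry a multiplier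
    O(1/(1+|xi|)), and tend to 0 in L^2: [u_n] is bounded in L^2_loc and the
    Fourier transforms of [chi u_n] are bounded and tend to 0 pointwise.  As
    [eps_n] is also bounded above, the remaining terms of order [m] can be
    normalised for [|xi| > 1], while for [|xi| <= 1] they tend to 0 anyway.  Hence
      [sum_i sum_(|a|=m) (2 pi i)^m (xi/|xi|)^a F(phi A^a_ki u_n^i) -> 0] in L^2,
    whatever [omega_n] is.  Pairing with [F(phi2 u_n^j)] and a bounded multiplier
    [psi (omega_n xi)] gives [sum_i <mu_ji, p_ki (phi conj(phi2) psi)> = 0], and
    such tensor products are dense.

    Plancherel's theorem is not needed: the bound
    [int |F g|^2 <= 34^d int |g|^2] suffices. *)

Require Import Defs.
From mathcomp Require Import all_boot all_order all_algebra.
From mathcomp Require Import complex.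
From mathcomp Require Import finmap.
From mathcomp Require Import all_classical all_reals all_analysis.
From mathcomp Require Import measurable_realfun ring lra.

Set Implicit Arguments.
Unset Strict Implicit.
Unset Printing Implicit Defensive.

Import Order.TTheory GRing.Theory Num.Theory.
Import numFieldNormedType.Exports.

Local Open Scope classical_set_scope.
Local Open Scope ring_scope.
Local Open Scope complex_scope.

(** * Complex numbers and complex integrals *)

(** The damping of lower-order terms rests on two facts about [u_n] alone: boundedness in L^2 on
    compact sets, which weak nullity gives through a gliding hump, and pointwise convergence to 0 of
    the transforms of chi u_n, which are pairings with compactly supported L^2 functions. The
    constant 34^d is 2^d 17^d. The transform is first bounded under the window (1 - t^2/N^2)^2 in
    each coordinate; the transform of this window decays like 1/x^2, so it has a majorant whose
    integral is 17 for every N. The 2 appears because the window is at least 1/2 on half of its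
    support. Leibniz differentiates phi only, so phi2 and psi may be merely continuous. Density can
    thus be proved by freezing the x variable of F at finitely many points: bumps serve as phi, and
    F(x, .) as psi. The direction xi/|xi| ignores the scaling by omega_n; the monomials in it are
    absorbed into psi, as functions on the compactification. Hermitian symmetry turns the conjugate
    of mu_ij in the defining limit into mu_ji, whence the transpose. *)

Notation normc := (@ComplexField.Normc.normc _).
Notation Re := (@complex.Re _).
Notation Im := (@complex.Im _).

Section complex_numbers.
Variable R : realType.
Implicit Types (z w : R[i]) (a b : R).

Lemma complexP z w : Re z = Re w -> Im z = Im w -> z = w.
Proof. by case: z w => [? ?] [? ?] /= -> ->. Qed.

Lemma ReD z w : Re (z + w) = Re z + Re w. Proof. by case: z w => [? ?] []. Qed.
Lemma ImD z w : Im (z + w) = Im z + Im w. Proof. by case: z w => [? ?] []. Qed.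
Lemma ReN z : Re (- z) = - Re z. Proof. by case: z. Qed.
Lemma ImN z : Im (- z) = - Im z. Proof. by case: z. Qed.
Lemma ReM z w : Re (z * w) = Re z * Re w - Im z * Im w.
Proof. by case: z w => [? ?] []. Qed.
Lemma ImM z w : Im (z * w) = Re z * Im w + Im z * Re w.
Proof. by case: z w => [? ?] []. Qed.
Lemma ReJ z : Re (conjc z) = Re z. Proof. by case: z. Qed.
Lemma ImJ z : Im (conjc z) = - Im z. Proof. by case: z. Qed.

Lemma conjcM z w : conjc (z * w) = conjc z * conjc w.
Proof. by apply: complexP; rewrite !(ReM, ImM, ReJ, ImJ); ring. Qed.

Lemma conjcR a : conjc a%:C = a%:C :> R[i].
Proof. by apply: complexP; rewrite /= ?oppr0. Qed.

Lemma normc_ge0 z : 0 <= normc z.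
Proof. by case: z => a b; exact: sqrtr_ge0. Qed.

Lemma normc_sqr z : normc z ^+ 2 = Re z ^+ 2 + Im z ^+ 2.
Proof. by case: z => a b /=; rewrite sqr_sqrtr// addr_ge0// sqr_ge0. Qed.

Lemma normcM z w : normc (z * w) = normc z * normc w.
Proof. exact: ComplexField.Normc.normcM. Qed.

Lemma normcX z n : normc (z ^+ n) = normc z ^+ n.
Proof.
elim: n => [|n IH]; first by rewrite !expr0 ComplexField.Normc.normc1.
by rewrite !exprS normcM IH.
Qed.

Lemma normcJ z : normc (conjc z) = normc z.
Proof. by case: z => a b /=; rewrite sqrrN. Qed.

Lemma normcR a : normc a%:C = `|a|.
Proof. by rewrite /= expr0n/= addr0 sqrtr_sqr. Qed.

Lemma normc0 : normc (0 : R[i]) = 0. Proof. exact: ComplexField.Normc.normc0. Qed.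

Lemma normc_eq0 z : normc z = 0 -> z = 0.
Proof. exact: ComplexField.Normc.eq0_normc. Qed.

Lemma normcN z : normc (- z) = normc z.
Proof. by case: z => a b /=; rewrite !sqrrN. Qed.

Lemma ler_normcD z w : normc (z + w) <= normc z + normc w.
Proof.
rewrite -lecR; have := ler_normD z w.
by rewrite !normc_def rmorphD; case: z w => [? ?] [? ?].
Qed.

Lemma ler_normcB z w : normc (z - w) <= normc z + normc w.
Proof. by rewrite -(normcN w) ler_normcD. Qed.

Lemma ler_normc_sum (I : Type) (s : seq I) (P : pred I) (F : I -> R[i]) :
  normc (\sum_(i <- s | P i) F i) <= \sum_(i <- s | P i) normc (F i).
Proof.
elim/big_ind2 : _ => //; first by rewrite normc0.
by move=> x a y b xa yb; rewrite (le_trans (ler_normcD _ _))// lerD.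
Qed.

Lemma ler_Re_normc z : `|Re z| <= normc z.
Proof.
case: z => a b /=; rewrite -sqrtr_sqr ler_sqrt ?lerDl ?sqr_ge0//.
by rewrite addr_ge0 ?sqr_ge0.
Qed.

Lemma ler_Im_normc z : `|Im z| <= normc z.
Proof.
case: z => a b /=; rewrite -sqrtr_sqr ler_sqrt ?lerDr ?sqr_ge0//.
by rewrite addr_ge0 ?sqr_ge0.
Qed.

Lemma ler_normc_ReIm z : normc z <= `|Re z| + `|Im z|.
Proof.
rewrite -(@ler_pXn2r _ 2) ?nnegrE ?normc_ge0 ?addr_ge0//.
rewrite normc_sqr sqrrD !real_normK ?num_real// lerD2r lerDl.
by rewrite mulrn_wge0// mulr_ge0.
Qed.

Lemma mul_conjc z : z * conjc z = (normc z ^+ 2)%:C.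
Proof. by apply: complexP; rewrite normc_sqr; case: z => a b /=; ring. Qed.

Lemma Re_sum (I : Type) (s : seq I) (P : pred I) (F : I -> R[i]) :
  Re (\sum_(i <- s | P i) F i) = \sum_(i <- s | P i) Re (F i).
Proof. by elim/big_rec2 : _ => // i x y _ <-; rewrite ReD. Qed.

Lemma real_complexM a b : (a * b)%:C = a%:C * b%:C :> R[i].
Proof. exact: rmorphM. Qed.

Lemma real_complexX a n : (a ^+ n)%:C = a%:C ^+ n :> R[i].
Proof. exact: rmorphXn. Qed.

(** This is e^(-ia), with the sign of the Fourier kernel: [fourier] integrates against
    [ce (2 * pi * edot x xi)]. *)
Definition ce a : R[i] := cos a -i* sin a.

Lemma ce0 : ce 0 = 1.
Proof. by rewrite /ce cos0 sin0 oppr0. Qed.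

Lemma ceD a b : ce (a + b) = ce a * ce b.
Proof. by apply: complexP; rewrite /ce/= ?cosD ?sinD; ring. Qed.

Lemma ceN a : ce (- a) = conjc (ce a).
Proof. by rewrite /ce cosN sinN. Qed.

Lemma normc_ce a : normc (ce a) = 1.
Proof. by rewrite /= sqrrN cos2Dsin2 sqrtr1. Qed.

(** Mean value theorem with a derivative bounded by 1; evenness handles negative arguments. *)
Lemma cos_sub1 a : `|cos a - 1| <= `|a|.
Proof.
have [->|a0] := eqVneq a 0; first by rewrite cos0 subrr.
have H (b : R) : 0 < b -> `|cos b - 1| <= `|b|.
  move=> b0; rewrite -cos0.
  have [|c _ ->] := @MVT _ (@cos R) (fun x => - sin x) 0 b b0.
    exact/continuous_subspaceT/continuous_cos.
  by rewrite subr0 normrM normrN ler_piMl// ler_norml sin_geN1 sin_le1.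
have [a_gt0|a_le0] := ltP 0 a; first exact: H.
have := H (- a); rewrite cosN normrN; apply.
by rewrite oppr_gt0 lt_neqAle a0.
Qed.

Lemma sin_le_norm a : `|sin a| <= `|a|.
Proof.
have H (b : R) : 0 < b -> `|sin b| <= `|b|.
  move=> b0; have [|c _] := @MVT _ (@sin R) (@cos R) 0 b b0.
    exact/continuous_subspaceT/continuous_sin.
  rewrite sin0 !subr0 => ->.
  by rewrite normrM ler_piMl// ler_norml cos_geN1 cos_le1.
have [a_gt0|a_le0] := ltP 0 a; first exact: H.
have [->|a0] := eqVneq a 0; first by rewrite sin0.
by have := H (- a); rewrite sinN !normrN; apply; rewrite oppr_gt0 lt_neqAle a0.
Qed.

(** By the mean value theorem the difference is b (cos c - 1) with 0 < c < b, and [cos_sub1]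
    supplies the second factor b. *)
Lemma sin_sub_id a : `|sin a - a| <= a ^+ 2.
Proof.
have H (b : R) : 0 < b -> `|sin b - b| <= b ^+ 2.
  move=> b0; have [|c cb] := @MVT _ (fun x => @sin R x - x) (fun x => cos x - 1) 0 b b0.
    apply: continuous_subspaceT => x; apply: cvgB => //; exact: continuous_sin.
  rewrite sin0 !subr0 => ->.
  rewrite normrM (gtr0_norm b0) expr2 ler_pM2r//.
  move: cb; rewrite in_itv/= => /andP[c0 cb].
  by rewrite (le_trans (cos_sub1 c))// gtr0_norm// ltW.
have [a_gt0|a_le0] := ltP 0 a; first exact: H.
have [->|a0] := eqVneq a 0; first by rewrite sin0 subr0 normr0 expr0n.
have := H (- a); rewrite sinN -opprD normrN sqrrN; apply.
by rewrite oppr_gt0 lt_neqAle a0.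
Qed.

Lemma normc_ce_sub1 a : normc (ce a - 1) <= 2 * `|a|.
Proof.
rewrite (le_trans (ler_normc_ReIm _))//= subr0 normrN.
by have := cos_sub1 a; have := sin_le_norm a; lra.
Qed.

(** The expansion e^(-ia) = 1 - ia + O(a^2), in the form that differentiates the Fourier kernel
    through [quadratic_is_derive]. *)
Lemma normc_ce_taylor a : normc (ce a - 1 + 0 +i* a) <= 2 * a ^+ 2.
Proof.
rewrite (le_trans (ler_normc_ReIm _))//= subr0 addr0.
have -> : - sin a + a = - (sin a - a) by ring.
rewrite normrN; have := sin_sub_id a.
suff : `|cos a - 1| <= a ^+ 2 by lra.
(* Half angle: 1 - cos a = 2 sin^2(a/2) is quadratic by the bound on the sine. *)
have -> : a = a / 2 + a / 2 by field.
rewrite cosD; set b := a / 2.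
have h := sin_le_norm b; have := cos2Dsin2 b => e.
have -> : cos b * cos b - sin b * sin b - 1 = - (2 * sin b ^+ 2) by lra.
rewrite normrN ger0_norm; last by rewrite pmulr_rge0// sqr_ge0.
have : sin b ^+ 2 <= b ^+ 2.
  by rewrite -[leLHS]real_normK ?num_real// -[leRHS]real_normK ?num_real// ler_pXn2r ?nnegrE.
have := sqr_ge0 b; nra.
Qed.

End complex_numbers.

(** [cmeasurable] speaks of functions on R^d only; Fubini's theorem needs the same notion on product
    spaces. *)
Definition cmeas d (T : measurableType d) (R : realType) (f : T -> R[i]) : Prop :=
  measurable_fun setT (fun x => Re (f x)) /\
  measurable_fun setT (fun x => Im (f x)).

Section cmeas.
Context d (T : measurableType d) (R : realType).
Implicit Types f g : T -> R[i].

Lemma cmeas_cst (c : R[i]) : cmeas (fun=> c : R[i]) (T := T).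
Proof. by split; exact: measurable_cst. Qed.

Lemma cmeasD f g : cmeas f -> cmeas g -> cmeas (fun x => f x + g x).
Proof.
move=> [f1 f2] [g1 g2]; split.
  by under eq_fun do rewrite ReD; exact: measurable_funD.
by under eq_fun do rewrite ImD; exact: measurable_funD.
Qed.

Lemma cmeasM f g : cmeas f -> cmeas g -> cmeas (fun x => f x * g x).
Proof.
move=> [f1 f2] [g1 g2]; split.
  by under eq_fun do rewrite ReM; apply: measurable_funB; apply: measurable_funM.
by under eq_fun do rewrite ImM; apply: measurable_funD; apply: measurable_funM.
Qed.

Lemma cmeasN f : cmeas f -> cmeas (fun x => - f x).
Proof.
move=> mf; under eq_fun do rewrite -mulN1r.
by apply: cmeasM => //; exact: cmeas_cst.
Qed.

Lemma cmeasB f g : cmeas f -> cmeas g -> cmeas (fun x => f x - g x).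
Proof. by move=> mf mg; apply: cmeasD => //; exact: cmeasN. Qed.

Lemma cmeasJ f : cmeas f -> cmeas (fun x => conjc (f x)).
Proof.
move=> [f1 f2]; split; first by under eq_fun do rewrite ReJ.
by under eq_fun do rewrite ImJ; exact: measurableT_comp.
Qed.

Lemma cmeas_real (f : T -> R) : measurable_fun setT f -> cmeas (fun x => (f x)%:C).
Proof. by move=> mf; split => //=; exact: measurable_cst. Qed.

Lemma cmeas_sum (I : Type) (s : seq I) (P : pred I) (F : I -> T -> R[i]) :
  (forall i, P i -> cmeas (F i)) -> cmeas (fun x => \sum_(i <- s | P i) F i x).
Proof.
move=> mF; elim: s => [|i s IH].
  by under eq_fun do rewrite big_nil; exact: cmeas_cst.
under eq_fun do rewrite big_cons.
by case: (boolP (P i)) => Pi //; apply: cmeasD => //; exact: mF.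
Qed.

Lemma cmeas_prod (I : Type) (s : seq I) (P : pred I) (F : I -> T -> R[i]) :
  (forall i, P i -> cmeas (F i)) -> cmeas (fun x => \prod_(i <- s | P i) F i x).
Proof.
move=> mF; elim: s => [|i s IH].
  by under eq_fun do rewrite big_nil; exact: cmeas_cst.
under eq_fun do rewrite big_cons.
by case: (boolP (P i)) => Pi //; apply: cmeasM => //; exact: mF.
Qed.

Lemma measurable_normc2 f : cmeas f -> measurable_fun setT (fun x => normc (f x) ^+ 2).
Proof.
move=> [f1 f2]; under eq_fun do rewrite normc_sqr.
by apply: measurable_funD; apply: measurable_funX.
Qed.

Lemma measurable_normc f : cmeas f -> measurable_fun setT (fun x => normc (f x)).
Proof.
move=> mf; rewrite (_ : (fun _ => _) = @Num.sqrt R \o (fun x => normc (f x) ^+ 2)).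
  apply: measurableT_comp; last exact: measurable_normc2.
  apply: continuous_measurable_fun; exact: sqrt_continuous.
by apply/funext => x /=; rewrite sqrtr_sqr ger0_norm// normc_ge0.
Qed.

Lemma cmeas_comp d' (T' : measurableType d') f (g : T' -> T) :
  cmeas f -> measurable_fun setT g -> cmeas (fun x => f (g x)).
Proof. by move=> [f1 f2] mg; split; [exact: (measurableT_comp f1 mg)|exact: (measurableT_comp f2 mg)]. Qed.

End cmeas.

Section cint.
Context d (T : measurableType d) (R : realType) (mu : {measure set T -> \bar R}).
Implicit Types f g : T -> R[i].

(** For Lebesgue measure on R^d this is [cintegral] by conversion. *)
Definition cint f : R[i] := (\int[mu]_x Re (f x)) +i* (\int[mu]_x Im (f x)).

Definition cintegrable f : Prop :=
  cmeas f /\ mu.-integrable setT (fun x => (normc (f x))%:E).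

Lemma cintegrable_le f (g : T -> R) : cmeas f ->
  mu.-integrable setT (fun x => (g x)%:E) -> (forall x, normc (f x) <= g x) ->
  cintegrable f.
Proof.
move=> mf ig fg; split => //; apply: (le_integrable _ _ _ ig) => //.
  by apply/measurable_EFinP; exact: measurable_normc.
move=> x _ /=; rewrite lee_fin ger0_norm ?normc_ge0//.
by rewrite (le_trans (fg x))// ler_norm.
Qed.

Lemma cintegrable_Re f : cintegrable f -> mu.-integrable setT (fun x => (Re (f x))%:E).
Proof.
move=> [[mf _] intf]; apply: (le_integrable _ _ _ intf) => //.
  exact/measurable_EFinP.
by move=> x _ /=; rewrite lee_fin (ger0_norm (normc_ge0 _)) ler_Re_normc.
Qed.

Lemma cintegrable_Im f : cintegrable f -> mu.-integrable setT (fun x => (Im (f x))%:E).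
Proof.
move=> [[_ mf] intf]; apply: (le_integrable _ _ _ intf) => //.
  exact/measurable_EFinP.
by move=> x _ /=; rewrite lee_fin (ger0_norm (normc_ge0 _)) ler_Im_normc.
Qed.

Lemma cintegrableD f g : cintegrable f -> cintegrable g ->
  cintegrable (fun x => f x + g x).
Proof.
move=> [mf intf] [mg intg].
apply: (@cintegrable_le _ (fun x => normc (f x) + normc (g x))).
- exact: cmeasD.
- exact: (integrableD measurableT intf intg).
- by move=> x; exact: ler_normcD.
Qed.

Lemma cintegrableMl (h f : T -> R[i]) (M : R) : cmeas h ->
  (forall x, normc (h x) <= M) -> cintegrable f -> cintegrable (fun x => h x * f x).
Proof.
move=> mh hM [mf intf].
apply: (@cintegrable_le _ (fun x => M * normc (f x))).
- exact: cmeasM.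
- exact: (integrableZl measurableT _ intf).
- by move=> x; rewrite normcM ler_wpM2r// normc_ge0.
Qed.

Lemma cintegrableZ c f : cintegrable f -> cintegrable (fun x => c * f x).
Proof.
by apply: (@cintegrableMl _ _ (normc c)) => //; exact: cmeas_cst.
Qed.

Lemma cintegrable0 : cintegrable (fun=> 0).
Proof.
by split; [exact: cmeas_cst|rewrite normc0; exact: integrable0].
Qed.

Lemma cintegrable_sum (I : Type) (s : seq I) (P : pred I) (F : I -> T -> R[i]) :
  (forall i, P i -> cintegrable (F i)) ->
  cintegrable (fun x => \sum_(i <- s | P i) F i x).
Proof.
move=> mF; elim: s => [|i s IH].
  by under eq_fun do rewrite big_nil; exact: cintegrable0.
under eq_fun do rewrite big_cons.
by case: (boolP (P i)) => Pi //; apply: cintegrableD => //; exact: mF.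
Qed.

Lemma eq_cint f g : f =1 g -> cint f = cint g.
Proof. by move=> /funext ->. Qed.

Lemma cint0 : cint (fun=> 0) = 0.
Proof. by apply: complexP; rewrite /= /Rintegral integral0. Qed.

Lemma cintD f g : cintegrable f -> cintegrable g ->
  cint (fun x => f x + g x) = cint f + cint g.
Proof.
move=> intf intg; apply: complexP => /=.
  under eq_Rintegral do rewrite ReD.
  by rewrite RintegralD//; exact: cintegrable_Re.
under eq_Rintegral do rewrite ImD.
by rewrite RintegralD//; exact: cintegrable_Im.
Qed.

Lemma cintZ c f : cintegrable f -> cint (fun x => c * f x) = c * cint f.
Proof.
move=> intf; have iR := cintegrable_Re intf; have iI := cintegrable_Im intf.
have iZ (k : R) (h : T -> R) : mu.-integrable setT (fun x => (h x)%:E) ->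
    mu.-integrable setT (fun x => (k * h x)%:E).
  by move=> ih; exact: (integrableZl measurableT _ ih).
apply: complexP; rewrite ?ReM ?ImM /=.
  under eq_Rintegral do rewrite ReM.
  by rewrite RintegralB ?RintegralZl//; exact: iZ.
under eq_Rintegral do rewrite ImM.
by rewrite RintegralD ?RintegralZl//; exact: iZ.
Qed.

Lemma cintB f g : cintegrable f -> cintegrable g ->
  cint (fun x => f x - g x) = cint f - cint g.
Proof.
move=> intf intg; under eq_cint do rewrite -mulN1r.
by rewrite cintD ?cintZ ?mulN1r//; exact: cintegrableZ.
Qed.

Lemma cintJ f : cintegrable f -> cint (fun x => conjc (f x)) = conjc (cint f).
Proof.
move=> intf; have iI := cintegrable_Im intf.
apply: complexP; rewrite /=.
  by under eq_Rintegral do rewrite ReJ.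
under eq_Rintegral do rewrite ImJ -mulN1r.
by rewrite RintegralZl// mulN1r.
Qed.

Lemma cint_sum (I : Type) (s : seq I) (P : pred I) (F : I -> T -> R[i]) :
  (forall i, P i -> cintegrable (F i)) ->
  cint (fun x => \sum_(i <- s | P i) F i x) = \sum_(i <- s | P i) cint (F i).
Proof.
move=> mF; elim: s => [|i s IH].
  by under eq_cint do rewrite big_nil; rewrite big_nil cint0.
under eq_cint do rewrite big_cons.
rewrite big_cons; case: (boolP (P i)) => Pi //.
by rewrite cintD ?IH//; [exact: mF|exact: cintegrable_sum].
Qed.

(** Multiplying the integrand by the conjugate of the integral turns the squared modulus into the
    real part of an integral, to which monotonicity applies. *)
Lemma normc_cint f : cintegrable f -> normc (cint f) <= \int[mu]_x normc (f x).
Proof.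
move=> intf; set c := cint f.
have [c0|c0] := eqVneq (normc c) 0.
  by rewrite c0; apply: Rintegral_ge0 => x _; exact: normc_ge0.
have ngt0 : 0 < normc c by rewrite lt_neqAle eq_sym c0 normc_ge0.
rewrite -(@ler_pM2l _ (normc c))// -expr2.
have -> : normc c ^+ 2 = Re (cint (fun x => conjc c * f x)).
  by rewrite cintZ// mulrC mul_conjc.
rewrite -RintegralZl//; last by case: intf.
apply: le_Rintegral => //.
- by apply: cintegrable_Re; exact: cintegrableZ.
- by case: intf => _ ih; exact: (integrableZl measurableT _ ih).
by move=> x _; rewrite (le_trans (ler_norm _))// (le_trans (ler_Re_normc _))//
  normcM normcJ.
Qed.

End cint.

(** * Fubini's theorem for complex integrands *)

Section cint_swap.
Context d1 d2 (T1 : measurableType d1) (T2 : measurableType d2) (R : realType).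
Variables (m1 : {sigma_finite_measure set T1 -> \bar R}).
Variables (m2 : {sigma_finite_measure set T2 -> \bar R}).

Lemma integrable_tensor (a : T1 -> R) (b : T2 -> R) :
  (forall x, 0 <= a x) -> (forall y, 0 <= b y) ->
  m1.-integrable setT (fun x => (a x)%:E) -> m2.-integrable setT (fun y => (b y)%:E) ->
  (m1 \x m2)%E.-integrable setT (fun z => (a z.1 * b z.2)%:E).
Proof.
move=> a0 b0 ia ib.
have ma : measurable_fun setT a by apply/measurable_EFinP; exact: measurable_int ia.
have mb : measurable_fun setT b by apply/measurable_EFinP; exact: measurable_int ib.
have mab : measurable_fun setT (fun z : T1 * T2 => (a z.1 * b z.2)%:E).
  apply/measurable_EFinP; apply: measurable_funM.
    exact: (measurableT_comp ma measurable_fst).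
  exact: (measurableT_comp mb measurable_snd).
apply/integrable12ltyP => //=.
have fb := integrable_fin_num measurableT ib.
have fa := integrable_fin_num measurableT ia.
under eq_integral do under eq_integral do rewrite ger0_norm ?mulr_ge0// EFinM.
under eq_integral.
  move=> x _; rewrite ge0_integralZl//; first over.
  - exact/measurable_EFinP.
  - by move=> y _; rewrite lee_fin.
  - by rewrite lee_fin.
rewrite ge0_integralZr//; last 3 first.
- exact/measurable_EFinP.
- by move=> y _; rewrite lee_fin.
- by apply: integral_ge0 => y _; rewrite lee_fin.
by rewrite -(fineK fa) -(fineK fb) -EFinM ltry.
Qed.

Variables (F : T1 * T2 -> R[i]) (a : T1 -> R) (b : T2 -> R).
Hypotheses (mF : cmeas F)
  (ia : m1.-integrable setT (fun x => (a x)%:E))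
  (ib : m2.-integrable setT (fun y => (b y)%:E))
  (Fab : forall x y, normc (F (x, y)) <= a x * b y)
  (a0 : forall x, 0 <= a x) (b0 : forall y, 0 <= b y).

Lemma cintegrable_dominated : cintegrable (m1 \x m2)%E F.
Proof.
apply: (@cintegrable_le _ _ _ _ _ (fun z => a z.1 * b z.2)) => //.
  exact: integrable_tensor.
by move=> [x y] /=.
Qed.

(** Domination by a tensor product makes every slice integrable, not just almost every one, so that
    [fine] never meets an infinite inner integral. *)
Lemma cintegrable_pair1 x : cintegrable m2 (fun y => F (x, y)).
Proof.
apply: (@cintegrable_le _ _ _ _ _ (fun y => a x * b y)) => //.
- by apply: cmeas_comp => //; exact: measurable_pair1.
- exact: (integrableZl measurableT _ ib).
Qed.

Lemma cintegrable_pair2 y : cintegrable m1 (fun x => F (x, y)).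
Proof.
apply: (@cintegrable_le _ _ _ _ _ (fun x => a x * b y)) => //.
- by apply: cmeas_comp => //; exact: measurable_pair2.
- exact: (integrableZr measurableT _ ia).
Qed.

Lemma cint12_prod_meas1 :
  cint m1 (fun x => cint m2 (fun y => F (x, y))) = cint (m1 \x m2)%E F.
Proof.
have H (G : T1 * T2 -> R) : (m1 \x m2)%E.-integrable setT (fun z => (G z)%:E) ->
    (forall x, m2.-integrable setT (fun y => (G (x, y))%:E)) ->
    \int[m1]_x \int[m2]_y G (x, y) = \int[(m1 \x m2)%E]_z G z.
  move=> iG iG1; rewrite /Rintegral; congr fine.
  under eq_integral.
    move=> x _; rewrite fineK; first over.
    by apply: integrable_fin_num.
  exact: (integral12_prod_meas1 iG).
have intF := cintegrable_dominated; have i1 := cintegrable_pair1.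
apply: complexP => /=.
  by apply: (H (fun z => Re (F z))) => [|x]; exact: cintegrable_Re.
by apply: (H (fun z => Im (F z))) => [|x]; exact: cintegrable_Im.
Qed.

Lemma cint21_prod_meas1 :
  cint m2 (fun y => cint m1 (fun x => F (x, y))) = cint (m1 \x m2)%E F.
Proof.
have H (G : T1 * T2 -> R) : (m1 \x m2)%E.-integrable setT (fun z => (G z)%:E) ->
    (forall y, m1.-integrable setT (fun x => (G (x, y))%:E)) ->
    \int[m2]_y \int[m1]_x G (x, y) = \int[(m1 \x m2)%E]_z G z.
  move=> iG iG1; rewrite /Rintegral; congr fine.
  under eq_integral.
    move=> x _; rewrite fineK; first over.
    by apply: integrable_fin_num.
  exact: (integral21_prod_meas1 iG).
have intF := cintegrable_dominated; have i1 := cintegrable_pair2.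
apply: complexP => /=.
  by apply: (H (fun z => Re (F z))) => [|x]; exact: cintegrable_Re.
by apply: (H (fun z => Im (F z))) => [|x]; exact: cintegrable_Im.
Qed.

Lemma cint_swap :
  cint m1 (fun x => cint m2 (fun y => F (x, y))) =
  cint m2 (fun y => cint m1 (fun x => F (x, y))).
Proof. by rewrite cint12_prod_meas1 cint21_prod_meas1. Qed.

End cint_swap.

(** * Measure and integration on R^d *)

Section rV_topology.
Variables (R : realType) (d : nat).
Local Notation E := 'rV[R]_d.

Lemma norm_coord_le (v : E) i : `|v ord0 i| <= `|v|.
Proof. by rewrite [leRHS]/Num.Def.normr /= mx_normrE; apply/bigmax_geP; right; exists (ord0, i). Qed.

Lemma rV_norm_lt (v : E) e : 0 < e -> (forall i, `|v ord0 i| < e) -> `|v| < e.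
Proof.
move=> e0 ve; have [->//|v0] := eqVneq `|v| 0.
by have [[j i] /= vE] := mx_norm_neq0 v0; rewrite [ltLHS]vE ord1.
Qed.

Lemma rV_norm_le (v : E) e : 0 <= e -> (forall i, `|v ord0 i| <= e) -> `|v| <= e.
Proof.
move=> e0 ve; have [->//|v0] := eqVneq `|v| 0.
by have [[j i] /= vE] := mx_norm_neq0 v0; rewrite [leLHS]vE ord1.
Qed.

Lemma measurable_rV_ball (x : E) e : measurable (ball x e).
Proof.
have [e0|e0] := ltP 0 e; last first.
  rewrite (_ : ball x e = set0)// -subset0 => y [].
  by rewrite ltNge e0.
rewrite (_ : ball x e = \bigcap_i (@rV_coord R d i @^-1` ball (x ord0 i) e)).
  apply: fin_bigcap_measurable; first exact: finite_finset.
  move=> i _; rewrite -[X in measurable X]setTI.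
  by apply: measurable_rV_coord => //; exact: measurable_ball.
apply/seteqP; split => y.
  by move=> [_ xy] i _; exact: xy.
by move=> xy; split => // i j; rewrite (ord1 i); exact: xy.
Qed.

(** The sigma-algebra is generated by coordinates, so an open set is written as a countable union of
    balls of the sup norm, which are boxes, with rational centres and radii 1/(k+1). *)
Lemma open_measurable_rV (U : set E) : open U -> measurable U.
Proof.
move=> oU.
pose F (p : 'rV[rat]_d * nat) : set E :=
  [set y | ball (map_mx ratr p.1 : E) p.2.+1%:R^-1 y /\
    ball (map_mx ratr p.1 : E) p.2.+1%:R^-1 `<=` U].
rewrite (_ : U = \bigcup_p F p).
  apply: countable_bigcupT_measurable => // p.
  have [pU|pU] := pselect (ball (map_mx ratr p.1 : E) p.2.+1%:R^-1 `<=` U).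
    rewrite (_ : F p = ball (map_mx ratr p.1 : E) p.2.+1%:R^-1).
      exact: measurable_rV_ball.
    by apply/seteqP; split => y //; case.
  by rewrite (_ : F p = set0)// -subset0 => y [].
apply/seteqP; split => [x Ux|x [p _ [+ pU]]]; last exact: pU.
have /nbhs_ballP[e /= e0 eU] : nbhs x U by exact: open_nbhs_nbhs.
(* Radius below e/2: a ball of this radius that contains x lies in the ball of radius e about x. *)
have [k ke] : exists k : nat, k.+1%:R^-1 < e / 2.
  have : 0 < e / 2 by rewrite divr_gt0.
  by move/ltr_add_invr => [k]; rewrite add0r => ?; exists k.
have k0 : 0 < k.+1%:R^-1 :> R by rewrite invr_gt0.
have H (i : 'I_d) : {q : rat | `|x ord0 i - ratr q| < k.+1%:R^-1}.
  apply: cid; have := @rat_in_itvoo R (x ord0 i) (x ord0 i + k.+1%:R^-1).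
  rewrite ltrDl => /(_ k0)[q]; rewrite in_itv/= => /andP[q1 q2]; exists q.
  by rewrite ler0_norm ?subr_le0 ?(ltW q1)// opprB ltrBlDl.
pose q : 'rV[rat]_d := \row_i sval (H i).
have bq : ball (map_mx ratr q : E) k.+1%:R^-1 x.
  split => // i j; rewrite ord1 /ball/= !mxE distrC; exact: svalP (H j).
exists (q, k) => //; split => //= y [_ qy]; apply: eU.
split => // i j; move: bq => [_ /(_ i j)]; move: (qy i j); rewrite /ball/= => h1 h2.
rewrite (_ : x i j - y i j = - (map_mx ratr q i j - x i j) + (map_mx ratr q i j - y i j)); last by ring.
rewrite (le_lt_trans (ler_normD _ _))// normrN (lt_trans (ltrD h2 h1))//.
by rewrite [ltRHS](splitr e) ltrD.
Qed.

Lemma closed_measurable_rV (A : set E) : closed A -> measurable A.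
Proof. by move/closed_openC/open_measurable_rV/measurableC; rewrite setCK. Qed.

Lemma compact_measurable_rV (K : set E) : compact K -> measurable K.
Proof.
by move=> cK; apply: closed_measurable_rV; exact: compact_closed.
Qed.

Lemma within_measurable_rV (U : set E) (f : E -> R) : open U ->
  {within U, continuous f} -> measurable_fun U f.
Proof.
move=> oU /continuousP cf; apply: (measurability _ (RGenOpens.measurableE R)).
move=> _ [_ [a [b ->] <-]].
have oI : open `]a, b[%classic by exact: interval_open.
have [V oV VE] := (iffLR (open_subspaceP U _) (cf _ oI)).
by rewrite setIC -VE; apply: measurableI; exact: open_measurable_rV.
Qed.

Lemma continuous_measurable_rV (f : E -> R) : continuous f -> measurable_fun setT f.
Proof.
move=> cf; apply: within_measurable_rV; first exact: openT.
exact: continuous_subspaceT.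
Qed.

End rV_topology.

Section rV_integral.
Variable R : realType.
Local Notation leb d := (lebesgue_rV R d).
Local Notation leb1 := (@lebesgue_measure R).

Lemma rV_cons0 d (p : measurableTypeR R * 'rV[R]_d) : rV_cons p ord0 ord0 = p.1.
Proof.
by have := congr1 fst (rV_consK p); rewrite /rV_uncons/= mxE => <-; congr (rV_cons p _ _); apply/val_inj.
Qed.

Lemma rV_consS d (p : measurableTypeR R * 'rV[R]_d) (i : 'I_d) :
  rV_cons p ord0 (lift ord0 i) = p.2 ord0 i.
Proof.
have := congr1 snd (rV_consK p); rewrite /rV_uncons/= => <-.
rewrite [RHS]mxE; have -> // : lift ord0 i = rshift 1 i; exact/val_inj.
Qed.

Lemma ge0_integral_rVS d (f : 'rV[R]_d.+1 -> \bar R) : measurable_fun setT f ->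
  (forall x, (0 <= f x)%E) ->
  (\int[leb d.+1]_x f x = \int[leb1]_t \int[leb d]_y f (rV_cons (t, y)))%E.
Proof.
move=> mf f0.
rewrite [LHS](@ge0_integral_pushforward _ _ _ _ _ _ (@measurable_rV_cons R d))//=.
rewrite preimage_setT.
rewrite (@fubini_tonelli1 _ _ _ _ _ leb1 (leb d) (f \o @rV_cons R d))//.
  by apply: measurableT_comp => //; exact: measurable_rV_cons.
by move=> x; exact: f0.
Qed.

(** Tonelli by induction on the dimension. Upper bounds on the one-dimensional integrals are all
    that is propagated. *)
Lemma integral_prod_le d (h : 'I_d -> R -> R) (C : 'I_d -> R) :
  (forall i t, 0 <= h i t) -> (forall i, measurable_fun setT (h i)) ->
  (forall i, (\int[leb1]_t (h i t)%:E <= (C i)%:E)%E) ->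
  (\int[leb d]_x (\prod_(i < d) h i (x ord0 i))%:E <= (\prod_(i < d) C i)%:E)%E.
Proof.
elim: d h C => [|d IH] h C h0 mh hC.
  under eq_integral do rewrite big_ord0.
  by rewrite /= integral_dirac// diracT mul1e big_ord0.
have mp n (g : 'I_n -> R -> R) : (forall i, measurable_fun setT (g i)) ->
    measurable_fun setT (fun x : 'rV[R]_n => (\prod_(i < n) g i (x ord0 i))%:E).
  move=> mg; apply/measurable_EFinP; apply: measurable_prod => i _.
  exact: (measurableT_comp (mg i) (@measurable_rV_coord R n i)).
have C0 i : 0 <= C i.
  by rewrite -lee_fin (le_trans _ (hC i))// integral_ge0// => t _; rewrite lee_fin.
rewrite ge0_integral_rVS//; last 2 first.
- exact: mp.
- by move=> x; rewrite lee_fin prodr_ge0.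
rewrite big_ord_recl EFinM.
apply: (@le_trans _ _ (\int[leb1]_t ((h ord0 t)%:E * (\prod_(i < d) C (lift ord0 i))%:E))%E).
  apply: ge0_le_integral => //.
  - by move=> t _; apply: integral_ge0 => y _; rewrite lee_fin prodr_ge0.
  - apply: (@measurable_fun_fubini_tonelli_F _ _ _ _ _ (leb d)
      (fun z => (\prod_(i < d.+1) h i (rV_cons z ord0 i))%:E)) => /=.
      apply: (measurableT_comp (mp _ _ mh)); exact: measurable_rV_cons.
    by move=> z; rewrite lee_fin prodr_ge0.
  - by apply: emeasurable_funM => //; apply/measurable_EFinP; apply: mh.
  move=> t _; under eq_integral.
    move=> y _; rewrite big_ord_recl rV_cons0/=.
    under eq_bigr do rewrite rV_consS/=.
    rewrite EFinM; over.
  rewrite ge0_integralZl//; last 3 first.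
  - exact: (mp _ (fun i => h (lift ord0 i)) (fun i => mh _)).
  - by move=> y _; rewrite lee_fin prodr_ge0.
  - by rewrite lee_fin.
  apply: lee_wpmul2l; first by rewrite lee_fin.
  by apply: (IH (fun i => h (lift ord0 i)) (fun i => C (lift ord0 i))) => i.
rewrite ge0_integralZr//; last 3 first.
- by apply/measurable_EFinP; apply: mh.
- by move=> t _; rewrite lee_fin.
- by rewrite lee_fin prodr_ge0.
by rewrite lee_wpmul2r// lee_fin prodr_ge0.
Qed.

Lemma cint_rVS d (F : 'rV[R]_d.+1 -> R[i]) (a : R -> R) (b : 'rV[R]_d -> R) :
  cmeas F -> leb1.-integrable setT (fun x => (a x)%:E) ->
  (leb d).-integrable setT (fun x => (b x)%:E) ->
  (forall t y, normc (F (rV_cons (t, y))) <= a t * b y) ->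
  (forall t, 0 <= a t) -> (forall y, 0 <= b y) ->
  cintegrable (leb d.+1) F /\
  cint (leb d.+1) F =
    cint leb1 (fun t => cint (leb d) (fun y => F (rV_cons (t, y)))).
Proof.
move=> mF ia ib Fab a0 b0.
have mc := @measurable_rV_cons R d.
have mFc : cmeas (F \o @rV_cons R d) by exact: cmeas_comp mF mc.
have intF := @cintegrable_dominated _ _ _ _ _ leb1 (leb d) _ _ _ mFc ia ib Fab a0 b0.
split.
  split => //; apply: (integrable_pushforward mc) => //.
    by apply/measurable_EFinP; exact: measurable_normc.
  by rewrite preimage_setT; exact: intF.2.
rewrite (@cint12_prod_meas1 _ _ _ _ _ leb1 (leb d) _ _ _ mFc ia ib Fab a0 b0).
have H (G : 'rV[R]_d.+1 -> R) : measurable_fun setT G ->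
    (leb1 \x leb d)%E.-integrable setT (EFin \o (G \o @rV_cons R d)) ->
    \int[leb d.+1]_x G x = \int[(leb1 \x leb d)%E]_z (G (rV_cons z)).
  move=> mG iG; rewrite /Rintegral; congr fine.
  have mGE : measurable_fun setT (EFin \o G) by exact/measurable_EFinP.
  by rewrite [LHS](@integral_pushforward _ _ _ _ _ _ mc _ _ _ mGE)// preimage_setT.
apply: complexP => /=.
  by apply: (H (fun z => Re (F z))) => [|]; [case: mF|exact: (cintegrable_Re intF)].
by apply: (H (fun z => Im (F z))) => [|]; [case: mF|exact: (cintegrable_Im intF)].
Qed.

Lemma cint_prod d (c : 'I_d -> R -> R[i]) : (forall i, cintegrable leb1 (c i)) ->
  cintegrable (leb d) (fun x => \prod_(i < d) c i (x ord0 i)) /\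
  cint (leb d) (fun x => \prod_(i < d) c i (x ord0 i)) = \prod_(i < d) cint leb1 (c i).
Proof.
elim: d c => [|d IH] c ic.
  rewrite big_ord0.
  rewrite (_ : (fun _ => _) = (fun=> 1)); last first.
    by apply/funext => x; rewrite big_ord0.
  split.
    split; first exact: cmeas_cst.
    have -> : (fun x : 'rV[R]_0 => (normc (1 : R[i]))%:E) = cst 1%E.
      by apply/funext => x; rewrite ComplexField.Normc.normc1.
    apply/integrableP; split => //=; under eq_integral do rewrite normr1.
    by rewrite integral_dirac// diracT mul1e ltry.
  by apply: complexP; rewrite /= /Rintegral integral_dirac// diracT mul1e.
have [iy Ey] := IH (fun i => c (lift ord0 i)) (fun i => ic _).
have [||||||] := @cint_rVS d (fun x => \prod_(i < d.+1) c i (x ord0 i))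
  (fun t => normc (c ord0 t)) (fun y => normc (\prod_(i < d) c (lift ord0 i) (y ord0 i))).
- apply: cmeas_prod => i _.
  by apply: (cmeas_comp (ic i).1); exact: measurable_rV_coord.
- exact: (ic ord0).2.
- exact: iy.2.
- move=> t y; rewrite big_ord_recl rV_cons0 normcM.
  by under eq_bigr do rewrite rV_consS.
- by move=> t; exact: normc_ge0.
- by move=> t; exact: normc_ge0.
move=> iF EF; split => //; rewrite EF big_ord_recl -Ey.
rewrite mulrC -cintZ//; apply: eq_cint => t.
rewrite mulrC -cintZ//; apply: eq_cint => y.
by rewrite big_ord_recl rV_cons0/=; under eq_bigr do rewrite rV_consS.
Qed.

End rV_integral.

(** * The L^2 bound for the Fourier transform *)

Section one_dimensional.
Variable R : realType.
Local Notation leb1 := (@lebesgue_measure R).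

(** Monotone convergence: a bound on bounded sets that is uniform passes to the whole space. *)
Lemma ge0_integral_exhaust d (T : measurableType d) (mu : {measure set T -> \bar R})
    (A : nat -> set T) (f : T -> \bar R) (C : \bar R) :
  nondecreasing_seq A -> (forall n, measurable (A n)) -> \bigcup_n A n = setT ->
  measurable_fun setT f -> (forall x, (0 <= f x)%E) ->
  (forall n, (\int[mu]_(x in A n) f x <= C)%E) -> (\int[mu]_x f x <= C)%E.
Proof.
move=> ndA mA UA mf f0 fC; rewrite -UA.
have := @ge0_nondecreasing_set_cvg_integral _ _ _ A f mu ndA mA.
move=> /(_ (fun i => measurable_funS measurableT (@subsetT _ _) mf) (fun i x _ => f0 x)) cv.
rewrite -(cvg_lim (@ereal_hausdorff R) cv).
apply: lime_le; first by apply/cvg_ex; eexists; exact: cv.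
by apply: nearW.
Qed.

Lemma derive_add (f g : R -> R) (x a b : R) : is_derive x (1 : R) f a ->
  is_derive x (1 : R) g b -> is_derive x (1 : R) (fun t => f t + g t) (a + b).
Proof. by move=> df dg; exact: is_deriveD. Qed.

Lemma derive_sub (f g : R -> R) (x a b : R) : is_derive x (1 : R) f a ->
  is_derive x (1 : R) g b -> is_derive x (1 : R) (fun t => f t - g t) (a - b).
Proof. by move=> df dg; exact: is_deriveB. Qed.

Lemma derive_mul (f g : R -> R) (x a b : R) : is_derive x (1 : R) f a ->
  is_derive x (1 : R) g b ->
  is_derive x (1 : R) (fun t => f t * g t) (a * g x + f x * b).
Proof.
move=> df dg; have := is_deriveM df dg.
rewrite (_ : f * g = (fun t => f t * g t))// => H.
apply: (is_derive_eq H); by rewrite /GRing.scale/=; ring.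
Qed.

Lemma is_derive1_cst (c x : R) : is_derive x (1 : R) (fun=> c) 0.
Proof. exact: is_derive_cst. Qed.

Lemma is_derive1_id (x : R) : is_derive x (1 : R) (fun t => t) 1.
Proof. exact: is_derive_id. Qed.

Lemma derive_comp (f g : R -> R) (x a b : R) : is_derive x (1 : R) g b ->
  is_derive (g x) (1 : R) f a -> is_derive x (1 : R) (fun t => f (g t)) (b * a).
Proof.
move=> dg df; apply: (is_derive_eq (is_derive1_comp df dg)); by rewrite mulrC.
Qed.

Lemma Rintegral_derive (f F : R -> R) (a b : R) : a < b -> continuous f ->
  (forall x : R, is_derive x (1 : R) F (f x)) ->
  \int[leb1]_(x in `[a, b]) f x = F b - F a.
Proof.
move=> ab cf dF.
have cF : continuous F.
  by move=> x; apply/differentiable_continuous/derivable1_diffP; exact: ex_derive.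
rewrite /Rintegral (@continuous_FTC2 _ f F)//.
- exact: continuous_subspaceT.
- split; first by move=> x _; exact: ex_derive.
    by apply: cvg_at_right_filter; exact: cF.
  by apply: cvg_at_left_filter; exact: cF.
- by move=> x _; rewrite derive1E; exact: derive_val.
Qed.

Lemma continuous_cauchy (c s : R) : continuous (fun t : R => (1 + (c * (t - s)) ^+ 2)^-1 : R).
Proof.
move=> t; apply: (@continuous_comp _ _ _ (fun t : R => c * (t - s)) (fun x : R => (1 + x ^+ 2)^-1)).
  by apply: cvgM; [exact: cvg_cst|apply: cvgB => //; exact: cvg_cst].
exact: continuous_oneDsqrV.
Qed.

Lemma measurable_cauchy (c s : R) :
  measurable_fun setT (fun t : R => (1 + (c * (t - s)) ^+ 2)^-1 : R).
Proof. by apply: continuous_measurable_fun; exact: continuous_cauchy. Qed.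

(** The primitive atan(c(t - s))/c stays between -pi/(2c) and pi/(2c), which bounds the integral
    over every symmetric interval about s. *)
Lemma integral_atan_kernel (c s : R) : 0 < c ->
  (\int[leb1]_t (1 + (c * (t - s)) ^+ 2)^-1%:E <= (pi / c)%:E)%E.
Proof.
move=> c0.
pose f t := (1 + (c * (t - s)) ^+ 2)^-1 : R.
have f0 t : 0 <= f t by rewrite invr_ge0 addr_ge0 ?sqr_ge0.
have cf : continuous f by exact: continuous_cauchy.
have mf : measurable_fun setT f by exact: measurable_cauchy.
apply: (@ge0_integral_exhaust _ (measurableTypeR R) leb1
  (fun n => `[s - n.+1%:R, s + n.+1%:R]%classic) (EFin \o f)).
- move=> m n mn; apply/subsetPset => t /=; rewrite !in_itv/= => /andP[h1 h2].
  have : m.+1%:R <= n.+1%:R :> R by rewrite ler_nat.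
  by move=> ?; apply/andP; split; lra.
- by move=> n; exact: measurable_itv.
- rewrite -subTset => t _; exists (Num.bound `|t - s|) => //=.
  have := archi_boundP (normr_ge0 (t - s)); rewrite in_itv/= ltr_norml -natr1.
  by move=> /andP[? ?]; apply/andP; split; lra.
- exact/measurable_EFinP.
- by move=> t; rewrite lee_fin.
move=> n.
have intf : leb1.-integrable `[s - n.+1%:R, s + n.+1%:R] (EFin \o f).
  apply: continuous_compact_integrable; first exact: segment_compact.
  exact: continuous_subspaceT.
rewrite -(fineK (integrable_fin_num _ intf))// lee_fin.
have dF (t : R) : is_derive t (1 : R) (fun t => atan (c * (t - s)) / c) (f t).
  apply: (is_derive_eq (derive_mul (derive_comp (derive_mul (is_derive1_cst c t)
    (derive_sub (is_derive1_id t) (is_derive1_cst s t))) (is_derive1_atan _)) (is_derive1_cst c^-1 t))).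
  rewrite /cst /f; field; apply/andP; split; last by rewrite gt_eqF.
  by apply: lt0r_neq0; rewrite ltr_pwDl// sqr_ge0.

have ab : s - n.+1%:R < s + n.+1%:R by rewrite ltrBlDr -addrA ltrDl -mulr2n pmulrn_lgt0.
rewrite -[leLHS]/(\int[leb1]_(t in _) f t) (Rintegral_derive ab cf dF).
rewrite -mulrBl ler_pM2r ?invr_gt0//.
have := atan_ltpi2 (c * (s + n.+1%:R - s)); have := atan_gtNpi2 (c * (s - n.+1%:R - s)).
lra.
Qed.

Lemma derive_continuous (f F : R -> R) :
  (forall x : R, is_derive x (1 : R) F (f x)) -> continuous F.
Proof.
by move=> dF x; apply/differentiable_continuous/derivable1_diffP; exact: ex_derive.
Qed.

Lemma continuous_integrable_itv (a b : R) (f : R -> R) : continuous f ->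
  leb1.-integrable `[a, b] (fun x => (f x)%:E).
Proof.
move=> cf; apply: continuous_compact_integrable; first exact: segment_compact.
exact: continuous_subspaceT.
Qed.

Lemma Rintegral_bound_itv (a b M : R) (f : R -> R) : a <= b -> continuous f ->
  (forall x, x \in `[a, b] -> `|f x| <= M) ->
  `|\int[leb1]_(x in `[a, b]) f x| <= M * (b - a).
Proof.
move=> ab cf fM.
rewrite (le_trans (le_normr_Rintegral _ (continuous_integrable_itv _ _ cf)))//.
have -> : M * (b - a) = \int[leb1]_(x in `[a, b]) (cst M x).
  by rewrite Rintegral_cst//= lebesgue_measure_itv/= lte_fin; case: ltP => //= ba; rewrite (@le_anti _ _ a b) ?ab ?ba// subrr.
apply: le_Rintegral => //.
- by apply: continuous_integrable_itv => x; apply: (cvg_comp _ _ (cf x)); exact: norm_continuous.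
- by apply: continuous_integrable_itv => x; exact: cvg_cst.
Qed.

(** * A window whose Fourier transform has an integrable majorant *)

Section kernel.
Variables (N : R) (N0 : 0 < N).
Let p := (N ^+ 2)^-1.

(** With p = N^-2 this is (1 - t^2/N^2)^2. It vanishes at -N and N together with its first
    derivative, so two integrations by parts leave no boundary term and the transform decays
    quadratically. *)
Definition quartic (t : R) : R := (1 - p * (t * t)) * (1 - p * (t * t)).
Definition quartic' (t : R) : R := - 4 * p * (t * (1 - p * (t * t))).
Definition quartic'' (t : R) : R := - 4 * p * (1 - 3 * p * (t * t)).

Let derive_q (t : R) : is_derive t (1 : R) (fun t : R => 1 - p * (t * t) : R) (- 2 * p * t).

Proof.
have H := derive_sub (is_derive1_cst 1 t) (derive_mul (is_derive1_cst p t)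
  (derive_mul (is_derive1_id t) (is_derive1_id t))).
apply: (is_derive_eq H).
by rewrite /cst/=; ring.
Qed.

Lemma derive_quartic (t : R) : is_derive t (1 : R) quartic (quartic' t).
Proof.
apply: (is_derive_eq (derive_mul (derive_q t) (derive_q t))).
by rewrite /quartic'; ring.
Qed.

Lemma derive_quartic' (t : R) : is_derive t (1 : R) quartic' (quartic'' t).
Proof.
apply: (is_derive_eq (derive_mul (is_derive1_cst (- 4 * p) t)
  (derive_mul (is_derive1_id t) (derive_q t)))).
by rewrite /cst /quartic''/=; ring.
Qed.

Lemma continuous_quartic : continuous quartic.
Proof. exact: derive_continuous derive_quartic. Qed.

Lemma continuous_quartic'' : continuous quartic''.
Proof.
apply: (@derive_continuous (fun t => 24 * p ^+ 2 * t)) => t.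
apply: (is_derive_eq (derive_mul (is_derive1_cst (- 4 * p) t) (derive_sub (is_derive1_cst 1 t)
  (derive_mul (is_derive1_cst (3 * p) t) (derive_mul (is_derive1_id t) (is_derive1_id t)))))).
by rewrite /cst/=; ring.
Qed.

Let p0 : 0 < p. Proof. by rewrite invr_gt0 exprn_gt0. Qed.
Let pN : p * (N * N) = 1. Proof. by rewrite /p; field; rewrite gt_eqF. Qed.

Let ptt t : t \in `[(- N), N] -> 0 <= p * (t * t) <= 1.
Proof.
rewrite in_itv/= => /andP[h1 h2]; apply/andP; split.
  by rewrite mulr_ge0 ?(ltW p0)// -expr2 sqr_ge0.
by rewrite -pN ler_pM2l//; nra.
Qed.

Lemma quartic_ge0 t : 0 <= quartic t.
Proof. by rewrite /quartic -expr2 sqr_ge0. Qed.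

Lemma quartic_le1 t : t \in `[(- N), N] -> quartic t <= 1.
Proof. by move=> /ptt /andP[? ?]; rewrite /quartic; nra. Qed.

Lemma quartic_ge (t : R) : `|t| <= N / 2 -> 2^-1 <= quartic t.
Proof.
move=> tN.
have tt : t * t <= N * N / 4.
  have -> : t * t = `|t| * `|t| by rewrite -normrM ger0_norm// -expr2 sqr_ge0.
  by have := normr_ge0 t; have := N0; nra.
have : p * (t * t) <= 1 / 4.
  have -> : 1 / 4 = p * (N * N / 4) :> R by rewrite mulrA pN.
  by rewrite ler_pM2l.
by rewrite /quartic; nra.
Qed.

Let quartic''_le t : t \in `[(- N), N] -> `|quartic'' t| <= 8 * p.
Proof.
move=> /ptt /andP[? ?]; rewrite /quartic'' ler_norml; have := p0 => ?.
by apply/andP; split; nra.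
Qed.

(** Two integrations by parts performed at once by the primitive [F], which vanishes at both ends.
    What remains is b^-2 times the integral of [quartic''] against [e], bounded by 8/N^2 on an
    interval of length 2N. The pair [e], [e1] stands for cosine and sine up to sign, so that real
    and imaginary parts are treated alike. *)
Lemma quartic_osc (b : R) (e e1 : R -> R) : b != 0 ->
  (forall t : R, is_derive t (1 : R) e (b * e1 t)) ->
  (forall t : R, is_derive t (1 : R) e1 (- b * e t)) ->
  (forall t, `|e t| <= 1) ->
  `|\int[leb1]_(t in `[(- N), N]) (quartic t * e t)| <= 16 / (N * b ^+ 2).
Proof.
move=> b0 de de1 e_le1.
have NN : - N < N by rewrite gtrN.
have ce := derive_continuous de.
pose F t := - b^-1 * (quartic t * e1 t) + (b^-1) ^+ 2 * (quartic' t * e t).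
have dF (t : R) : is_derive t (1 : R) F
    (quartic t * e t + (b^-1) ^+ 2 * (quartic'' t * e t)).
  apply: (is_derive_eq (derive_add
    (derive_mul (is_derive1_cst (- b^-1) t) (derive_mul (derive_quartic t) (de1 t)))
    (derive_mul (is_derive1_cst ((b^-1) ^+ 2) t) (derive_mul (derive_quartic' t) (de t))))).
  by rewrite /cst/=; field.
have c1 : continuous (fun t => quartic t * e t).
  by move=> t; apply: cvgM; [exact: continuous_quartic|exact: ce].
have c2 : continuous (fun t => (b^-1) ^+ 2 * (quartic'' t * e t)).
  move=> t; apply: cvgM; first exact: cvg_cst.
  by apply: cvgM; [exact: continuous_quartic''|exact: ce].
have q0 : 1 - p * (N * N) = 0 by rewrite pN subrr.
have FN : F N = 0 by rewrite /F /quartic /quartic' q0 !(mul0r, mulr0) addr0.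
have FNN : F (- N) = 0 by rewrite /F /quartic /quartic' mulrNN q0 !(mul0r, mulr0) addr0.
have := @Rintegral_derive _ F (- N) N NN _ dF.
rewrite FN FNN subrr RintegralD//; [|exact: continuous_integrable_itv|exact: continuous_integrable_itv].
move=> H; have {H} : \int[leb1]_(t in `[(- N), N]) (quartic t * e t) =
    - \int[leb1]_(t in `[(- N), N]) ((b^-1) ^+ 2 * (quartic'' t * e t)).
  apply/eqP; rewrite -addr_eq0; apply/eqP; apply: H.
  by move=> t; apply: cvgD; [exact: c1|exact: c2].
move=> ->; rewrite normrN.
rewrite (le_trans (@Rintegral_bound_itv (- N) N ((b^-1) ^+ 2 * (8 * p)) _ (ltW NN) c2 _))//.
  move=> t tN; rewrite normrM ger0_norm ?sqr_ge0// ler_wpM2l ?sqr_ge0// normrM.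
  have := quartic''_le tN; have := e_le1 t; have := normr_ge0 (quartic'' t); nra.
rewrite /p le_eqVlt; apply/orP; left; apply/eqP; field.
by rewrite b0 gt_eqF.
Qed.

Definition qwin : R -> R := quartic \_ `[(- N), N].

Lemma qwin_ge0 t : 0 <= qwin t.
Proof. by rewrite /qwin patchE; case: ifPn => // _; exact: quartic_ge0. Qed.

Lemma qwin_le1 t : qwin t <= 1.
Proof. by rewrite /qwin patchE; case: ifPn => // /[!inE] /quartic_le1. Qed.

Lemma qwin_ge (t : R) : `|t| <= N / 2 -> 2^-1 <= qwin t.
Proof.
move=> tN; rewrite /qwin patchE ifT; first exact: quartic_ge.
by rewrite inE/= in_itv/= -ler_norml; have := N0; lra.
Qed.

Lemma measurable_qwin : measurable_fun setT qwin.
Proof.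
apply/(measurable_restrictT quartic) => //.
by apply: measurable_funTS; apply: continuous_measurable_fun; exact: continuous_quartic.
Qed.

Lemma integrable_qwin : leb1.-integrable setT (fun t => (qwin t)%:E).
Proof.
rewrite (_ : (fun _ => _) = (EFin \o quartic) \_ `[(- N), N]); last by rewrite restrict_EFin.
apply: (iffLR (integrable_mkcond _ _)) => //.
exact: (continuous_integrable_itv (- N) N continuous_quartic).
Qed.

Definition qwin_osc (x t : R) : R[i] := ce (2 * pi * (t * x)) * (qwin t)%:C.

Lemma measurable_ce d (T : measurableType d) (f : T -> R) : measurable_fun setT f ->
  cmeas (fun x => ce (f x)).
Proof.
move=> mf; split => /=.
  exact: (measurableT_comp (continuous_measurable_fun (@continuous_cos R)) mf).
apply: measurable_funN.
exact: (measurableT_comp (continuous_measurable_fun (@continuous_sin R)) mf).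
Qed.

Lemma cintegrable_qwin_osc x : cintegrable leb1 (qwin_osc x).
Proof.
apply: (cintegrable_le _ integrable_qwin) => [|t]; last first.
  by rewrite normcM normc_ce mul1r normcR ger0_norm// qwin_ge0.
apply: cmeasM; last exact: cmeas_real measurable_qwin.
apply: measurable_ce; apply: measurable_funM => //.
by apply: measurable_funM => //; exact: measurable_cst.
Qed.

(** Origin of 34: let A be the modulus and b = 2 pi x. The trivial bound A <= 2N and the decay A <=
    32/(N b^2), 16 for each of the real and imaginary parts, give A (1 + (bN)^2) <= 2N + 32N. *)
Lemma cint_qwin_osc_le x : normc (cint leb1 (qwin_osc x)) <= 34 * N * (1 + (2 * pi * N * (x - 0)) ^+ 2)^-1.
Proof.
have B1 : normc (cint leb1 (qwin_osc x)) <= 2 * N.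
  rewrite (le_trans (normc_cint (cintegrable_qwin_osc x)))//.
  under eq_Rintegral do rewrite normcM normc_ce mul1r normcR ger0_norm ?qwin_ge0//.
  rewrite -Rintegral_mkcond (le_trans (ler_norm _))//.
  rewrite (le_trans (@Rintegral_bound_itv _ _ 1 _ _ continuous_quartic _))//; last by lra.
    by have := N0; lra.
  by move=> t tN; rewrite ger0_norm ?quartic_ge0// quartic_le1.
have [x0|x0] := eqVneq x 0.
  rewrite (_ : x - 0 = 0) ?subr0// mulr0 expr0n addr0 invr1 mulr1 (le_trans B1)//; have := N0; lra.
pose b := 2 * pi * x.
have b0 : b != 0 by rewrite !mulf_neq0// gt_eqF// pi_gt0.
have dbt (t : R) : is_derive t (1 : R) (fun t => 2 * pi * (t * x)) b.
  apply: (is_derive_eq (derive_mul (is_derive1_cst (2 * pi) t)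
    (derive_mul (is_derive1_id t) (is_derive1_cst x t)))).
  by rewrite /cst/= /b; ring.
have B2 : normc (cint leb1 (qwin_osc x)) <= 32 / (N * b ^+ 2).
  rewrite (le_trans (ler_normc_ReIm _))//.
  have -> : 32 / (N * b ^+ 2) = 16 / (N * b ^+ 2) + 16 / (N * b ^+ 2) :> R by ring.
  apply: lerD => /=.
    have -> : \int[leb1]_t Re (qwin_osc x t) =
        \int[leb1]_(t in `[(- N), N]) (quartic t * cos (2 * pi * (t * x))).
      rewrite [RHS]Rintegral_mkcond; apply: eq_Rintegral => t _.
      rewrite ReM /= mulr0 subr0 /qwin !patchE; case: ifPn => _; rewrite ?mulr0//.
      by rewrite mulrC.
    apply: (@quartic_osc b _ (fun t => - sin (2 * pi * (t * x)))) => // t.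
    - by apply: (is_derive_eq (derive_comp (dbt t) (is_derive_cos _))).
    - apply: (is_derive_eq (is_deriveN (derive_comp (dbt t) (is_derive_sin _)))).
      by rewrite mulNr.
    - by rewrite ler_norml cos_geN1 cos_le1.
  have -> : \int[leb1]_t Im (qwin_osc x t) =
      \int[leb1]_(t in `[(- N), N]) (quartic t * - sin (2 * pi * (t * x))).
    rewrite [RHS]Rintegral_mkcond; apply: eq_Rintegral => t _.
    rewrite ImM /= mulr0 add0r /qwin !patchE; case: ifPn => _; rewrite ?mulr0//.
    by rewrite mulrC.
  apply: (@quartic_osc b _ (fun t => - cos (2 * pi * (t * x)))) => // t.
  - apply: (is_derive_eq (is_deriveN (derive_comp (dbt t) (is_derive_sin _)))).
    by rewrite mulrN.
  - apply: (is_derive_eq (is_deriveN (derive_comp (dbt t) (is_derive_cos _)))).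
    by ring.
  - by rewrite normrN ler_norml sin_geN1 sin_le1.
have -> : 2 * pi * N * (x - 0) = b * N by rewrite /b subr0; ring.
rewrite ler_pdivlMr; last by rewrite ltr_pwDl// sqr_ge0.
rewrite mulrDr mulr1.
have : normc (cint leb1 (qwin_osc x)) * (b * N) ^+ 2 <= 32 * N.
  have -> : 32 * N = 32 / (N * b ^+ 2) * (b * N) ^+ 2 by field; rewrite b0 gt_eqF.
  by rewrite ler_wpM2r// sqr_ge0.
by have := N0; lra.
Qed.

End kernel.
End one_dimensional.

Section fourier_transform.
Variables (R : realType) (d : nat).
Local Notation E := 'rV[R]_d.
Local Notation leb := (lebesgue_rV R d).
Local Notation leb1 := (@lebesgue_measure R).
Implicit Types f g : E -> R[i].

Lemma edotC (x y : E) : edot x y = edot y x.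
Proof. by rewrite /edot; apply: eq_bigr => i _; rewrite mulrC. Qed.

Lemma measurable_edot : measurable_fun setT (fun z : E * E => edot z.1 z.2).
Proof.
apply: measurable_sum => i; apply: measurable_funM.
  exact: (measurableT_comp (@measurable_rV_coord R d i) measurable_fst).
exact: (measurableT_comp (@measurable_rV_coord R d i) measurable_snd).
Qed.

Lemma cmeas_ce_edot (c : R) : cmeas (fun z : E * E => ce (c * edot z.1 z.2)).
Proof.
apply: measurable_ce; apply: measurable_funM; first exact: measurable_cst.
exact: measurable_edot.
Qed.

Lemma cmeas_ce_edotl (c : R) (y : E) : cmeas (fun x : E => ce (c * edot x y)).
Proof.
exact: (cmeas_comp (cmeas_ce_edot c) (measurable_pair2 y)).
Qed.

Lemma cintegrable_ceM (c : R) (y : E) f : cintegrable leb f ->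
  cintegrable leb (fun x => ce (c * edot x y) * f x).
Proof.
apply: (@cintegrableMl _ _ _ _ _ _ 1); first exact: cmeas_ce_edotl.
by move=> x; rewrite normc_ce.
Qed.

Lemma fourierE f y : fourier f y = cint leb (fun x => ce (2 * pi * edot x y) * f x).
Proof. by []. Qed.

Lemma normc_fourier_le f y : cintegrable leb f ->
  normc (fourier f y) <= \int[leb]_x normc (f x).
Proof.
move=> intf; rewrite fourierE (le_trans (normc_cint (cintegrable_ceM _ _ intf)))//.
by under eq_Rintegral do rewrite normcM normc_ce mul1r.
Qed.

(** A positive integrable function on R^d. The redundant [1 *] and [- 0] make each factor an
    instance of [measurable_cauchy] and [integral_atan_kernel]. *)
Definition cauchy_weight (x : E) : R := \prod_(i < d) (1 + (1 * (x ord0 i - 0)) ^+ 2)^-1.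

Lemma cauchy_weight_gt0 x : 0 < cauchy_weight x.
Proof. by apply: prodr_gt0 => i _; rewrite invr_gt0 ltr_pwDl// sqr_ge0. Qed.

Lemma measurable_cauchy_weight : measurable_fun setT cauchy_weight.
Proof.
apply: measurable_prod => i _.
apply: (measurableT_comp _ (@measurable_rV_coord R d i)
  (f := fun t : R => (1 + (1 * (t - 0)) ^+ 2)^-1)).
exact: measurable_cauchy.
Qed.

Lemma integrable_cauchy_weight : leb.-integrable setT (fun x => (cauchy_weight x)%:E).
Proof.
apply/integrableP; split; first (by apply/measurable_EFinP; apply: measurable_cauchy_weight).
under eq_integral do rewrite /= ger0_norm ?(ltW (cauchy_weight_gt0 _))//.
apply: le_lt_trans (ltry (\prod_(i < d) (pi : R))).
apply: (@integral_prod_le R d (fun _ t => (1 + (1 * (t - 0)) ^+ 2)^-1) (fun=> pi)).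
- by move=> _ t; rewrite invr_ge0 addr_ge0// sqr_ge0.
- by move=> _; exact: measurable_cauchy.
- by move=> _; have := @integral_atan_kernel R 1 0 ltr01; rewrite divr1.
Qed.

(** Fubini gives measurability of partial integrals only for functions integrable on the product,
    and the Fourier kernel does not decay in the second variable. The weight [cauchy_weight] makes
    it integrable and is divided out afterwards. *)
Lemma cmeas_fourier f : cintegrable leb f -> cmeas (fourier f).
Proof.
move=> intf.
pose F (z : E * E) := ce (2 * pi * edot z.1 z.2) * f z.1 * (cauchy_weight z.2)%:C.
have mF : cmeas F.
  apply: cmeasM.
    apply: cmeasM; first exact: cmeas_ce_edot.
    exact: (cmeas_comp intf.1 measurable_fst).
  apply: cmeas_real; exact: (measurableT_comp measurable_cauchy_weight measurable_snd).
have Fab x y : normc (F (x, y)) <= normc (f x) * cauchy_weight y.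
  by rewrite /F !normcM normc_ce mul1r normcR ger0_norm// ltW// cauchy_weight_gt0.
have a0 x : 0 <= normc (f x) by exact: normc_ge0.
have b0 y : 0 <= cauchy_weight y by rewrite ltW// cauchy_weight_gt0.
have iF := @cintegrable_dominated _ _ _ _ _ leb leb F _ _ mF intf.2
  integrable_cauchy_weight Fab a0 b0.
pose iw (y : E) : R := \prod_(i < d) (1 + (1 * (y ord0 i - 0)) ^+ 2).
have wiw y : cauchy_weight y * iw y = 1.
  rewrite -big_split/= big1// => i _; rewrite mulVf// gt_eqF//.
  by rewrite ltr_pwDl// sqr_ge0.
have -> : fourier f = fun y => cint leb (fun x => F (x, y)) * (iw y)%:C.
  apply/funext => y; rewrite /F /=.
  under eq_cint do rewrite mulrC.
  rewrite cintZ; last exact: cintegrable_ceM.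
  by rewrite fourierE mulrAC -rmorphM/= wiw mul1r.
apply: cmeasM; last first.
  apply: cmeas_real; apply: measurable_prod => i _.
  apply: measurable_funD; first exact: measurable_cst.
  apply: measurable_funX; apply: measurable_funM; first exact: measurable_cst.
  by apply: measurable_funB; [exact: measurable_rV_coord|exact: measurable_cst].
have H (G : E * E -> R) : (leb \x leb)%E.-integrable setT (fun z => (G z)%:E) ->
    measurable_fun setT (fun y => \int[leb]_x G (x, y)).
  move=> iG; have mG := measurable_fubini_G iG.
  exact: (measurableT_comp (fine_measurable measurableT) mG).
split => /=.
  exact: (H _ (cintegrable_Re iF)).
exact: (H _ (cintegrable_Im iF)).
Qed.

Lemma cint_fourierM f g : cintegrable leb f -> cintegrable leb g ->
  cint leb (fun y => fourier f y * g y) = cint leb (fun x => f x * fourier g x).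
Proof.
move=> intf intg.
pose F (z : E * E) := ce (2 * pi * edot z.1 z.2) * f z.1 * g z.2.
have mF : cmeas F.
  apply: cmeasM; last exact: (cmeas_comp intg.1 measurable_snd).
  apply: cmeasM; first exact: cmeas_ce_edot.
  exact: (cmeas_comp intf.1 measurable_fst).
have Fab x y : normc (F (x, y)) <= normc (f x) * normc (g y).
  by rewrite /F !normcM normc_ce mul1r.
have := @cint_swap _ _ _ _ _ leb leb F _ _ mF intf.2 intg.2 Fab
  (fun x => normc_ge0 _) (fun x => normc_ge0 _).
have -> : (fun x => cint leb (fun y => F (x, y))) = (fun x => f x * fourier g x).
  apply/funext => x; rewrite fourierE -(cintZ (f x)); last exact: cintegrable_ceM.
  by apply: eq_cint => y; rewrite /F/= edotC mulrCA mulrA.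
have -> : (fun y => cint leb (fun x => F (x, y))) = (fun y => fourier f y * g y).
  apply/funext => y; rewrite fourierE mulrC -(cintZ (g y)); last exact: cintegrable_ceM.
  by apply: eq_cint => x; rewrite /F/= mulrC.
by move=> ->.
Qed.

Lemma ce_sum (I : Type) (s : seq I) (h : I -> R) :
  ce (\sum_(i <- s) h i) = \prod_(i <- s) ce (h i).
Proof. by elim/big_rec2 : _ => [|i a b _ <-]; rewrite ?ce0// ceD. Qed.

Lemma normc_prod (I : Type) (s : seq I) (h : I -> R[i]) :
  normc (\prod_(i <- s) h i) = \prod_(i <- s) normc (h i).
Proof.
by elim/big_rec2 : _ => [|i a b _ <-]; rewrite ?ComplexField.Normc.normc1// normcM.
Qed.

Lemma real_complex_prod (I : Type) (s : seq I) (h : I -> R) :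
  (\prod_(i <- s) h i)%:C = \prod_(i <- s) (h i)%:C :> R[i].
Proof. by elim/big_rec2 : _ => [|i a b _ <-] //; rewrite rmorphM. Qed.

Section bessel.
Variables (g : E -> R[i]) (intg : cintegrable leb g).
Variables (N : R) (N0 : 0 < N).

Let W (x : E) : R := \prod_(i < d) qwin N (x ord0 i).
Let K (x y : E) : R := \prod_(i < d) (34 * N * (1 + (2 * pi * N * (y ord0 i - x ord0 i)) ^+ 2)^-1).

Let W0 x : 0 <= W x. Proof. by apply: prodr_ge0 => i _; exact: qwin_ge0. Qed.
Let W1 x : W x <= 1.
Proof. by apply: prodr_ile1 => i _; rewrite qwin_ge0 qwin_le1. Qed.
Let K0 x y : 0 <= K x y.
Proof.
apply: prodr_ge0 => i _; rewrite mulr_ge0 ?invr_ge0 ?addr_ge0 ?sqr_ge0//.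
by rewrite mulr_ge0// ltW.
Qed.

Let KC x y : K x y = K y x.
Proof.
apply: eq_bigr => i _.
have -> : y ord0 i - x ord0 i = - (x ord0 i - y ord0 i) by ring.
by rewrite mulrN sqrrN.
Qed.

Let h (s t : R) : R := 34 * N * (1 + (2 * pi * N * (t - s)) ^+ 2)^-1.

Let measurable_h s : measurable_fun setT (h s).
Proof.
apply: (measurable_funM (f := fun=> 34 * N)); first exact: measurable_cst.
exact: measurable_cauchy.
Qed.

Let h_ge0 s t : 0 <= h s t.
Proof.
rewrite mulr_ge0 ?invr_ge0 ?addr_ge0 ?sqr_ge0//.
by rewrite mulr_ge0// ltW.
Qed.

Let h_le s t : h s t <= 34 * N.
Proof.
rewrite /h ler_pdivrMr ?ltr_pwDl ?sqr_ge0// ler_peMr ?lerDl ?sqr_ge0//.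
by rewrite mulr_ge0// ltW.
Qed.

Let mK : measurable_fun setT (fun z : E * E => K z.1 z.2).
Proof.
apply: measurable_prod => i _.
rewrite [X in measurable_fun _ X](_ : _ = h 0 \o (fun z : E * E => z.2 ord0 i - z.1 ord0 i)); last first.
  by apply/funext => z /=; rewrite /h subr0.
apply: measurableT_comp; first exact: measurable_h.
apply: measurable_funB.
  exact: (measurableT_comp (@measurable_rV_coord R d i) measurable_snd).
exact: (measurableT_comp (@measurable_rV_coord R d i) measurable_fst).
Qed.

Let K_le x y : K x y <= (34 * N) ^+ d.
Proof.
rewrite -[in leRHS](card_ord d) -prodr_const; apply: ler_prod => i _.
by apply/andP; split; [exact: h_ge0|exact: h_le].
Qed.

(** In each coordinate the integral is at most 34 N pi/(2 pi N) = 17, independently of N. *)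
Let int_K x : (\int[leb]_y (K x y)%:E <= (17 ^+ d)%:E)%E.
Proof.
rewrite -[in X in (_ <= X)%E](card_ord d) -prodr_const.
apply: (@integral_prod_le R d (fun i => h (x ord0 i)) (fun=> 17)).
- by move=> i t; exact: h_ge0.
- by move=> i; exact: measurable_h.
move=> i; under eq_integral do rewrite EFinM.
have mf : measurable_fun setT (fun t : R => ((1 + (2 * pi * N * (t - x ord0 i)) ^+ 2)^-1)%:E).
  (by apply/measurable_EFinP; apply: measurable_cauchy).
rewrite ge0_integralZl//; last 2 first.
- by move=> t _; rewrite lee_fin invr_ge0 addr_ge0// sqr_ge0.
- by rewrite lee_fin mulr_ge0// ltW.
have c0 : 0 < 2 * pi * N by rewrite !mulr_gt0// pi_gt0.
apply: (@le_trans _ _ ((34 * N)%:E * (pi / (2 * pi * N))%:E)%E).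
  apply: lee_wpmul2l; first by rewrite lee_fin mulr_ge0// ltW.
  exact: integral_atan_kernel.
rewrite -EFinM lee_fin le_eqVlt; apply/orP; left; apply/eqP.
have := pi_gt0 R; move: (@pi R) => q q0; field.
by rewrite (gt_eqF N0) (gt_eqF q0).
Qed.

Let int_W : cintegrable leb (fun x => (W x)%:C).
Proof.
have iq (i : 'I_d) : cintegrable leb1 (fun t => (qwin N t)%:C).
  apply: (cintegrable_le _ (integrable_qwin N)) => [|t].
    exact: cmeas_real (measurable_qwin N).
  by rewrite normcR ger0_norm// qwin_ge0.
have [+ _] := cint_prod iq.
by under eq_fun do rewrite -real_complex_prod.
Qed.

(** Modulation by x translates the transform, and the window is a product: what is bounded is the
    product of the one-dimensional transforms at y_i - x_i. *)
Let fourier_window x y :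
  normc (fourier (fun z => ce (- (2 * pi) * edot z x) * (W z)%:C) y) <= K x y.
Proof.
have [_] := @cint_prod R d (fun i => qwin_osc N (y ord0 i - x ord0 i)) (fun i => cintegrable_qwin_osc N _).
rewrite (_ : cint _ _ = fourier (fun z => ce (- (2 * pi) * edot z x) * (W z)%:C) y).
  move=> ->; rewrite normc_prod; apply: ler_prod => i _.
  rewrite normc_ge0/= -[X in 2 * pi * N * X]subr0; exact: cint_qwin_osc_le.
rewrite fourierE; apply: eq_cint => z.
rewrite /W real_complex_prod mulrA -ceD -mulNr -/(edot z x).
rewrite /edot !mulr_sumr -big_split/= ce_sum -big_split/=; apply: eq_bigr => i _.
by rewrite /qwin_osc; congr (ce _ * _); ring.
Qed.

Let B (x : E) : R[i] := conjc (fourier g x) * (W x)%:C.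

Let int_B : cintegrable leb B.
Proof.
apply: (@cintegrableMl _ _ _ _ _ _ (\int[leb]_x normc (g x))) => //.
  exact/cmeasJ/cmeas_fourier.
by move=> x; rewrite normcJ; exact: normc_fourier_le.
Qed.

Let int_gK x : leb.-integrable setT (fun y => (normc (g y) * K x y)%:E).
Proof.
have H := integrableZl measurableT ((34 * N) ^+ d) intg.2.
apply: (le_integrable _ _ _ H) => //.
  apply/measurable_EFinP; apply: measurable_funM; first exact: (measurable_normc intg.1).
  exact: (measurableT_comp mK (measurable_pair1 x)).
move=> y _ /=; rewrite lee_fin !ger0_norm ?mulr_ge0 ?normc_ge0//.
  by rewrite mulrC ler_wpM2r ?normc_ge0.
by rewrite exprn_ge0// mulr_ge0// ltW.
Qed.

(** Up to conjugation this transform pairs F g with the window modulated by x; the multiplication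
    formula moves F from g to the window, where [fourier_window] applies. *)
Let fourier_B x : normc (fourier B x) <= \int[leb]_y (normc (g y) * K x y).
Proof.
have iw : cintegrable leb (fun z => ce (- (2 * pi) * edot z x) * (W z)%:C).
  exact: cintegrable_ceM.
have -> : fourier B x = conjc (cint leb (fun z => fourier g z * (ce (- (2 * pi) * edot z x) * (W z)%:C))).
  rewrite -cintJ; last first.
    apply: (@cintegrableMl _ _ _ _ _ _ (\int[leb]_x normc (g x))) => //.
      exact: cmeas_fourier.
    by move=> z; exact: normc_fourier_le.
  rewrite fourierE; apply: eq_cint => z.
  by rewrite !conjcM mulNr ceN conjcK conjcR /B; ring.
rewrite normcJ cint_fourierM//.
have iF : cintegrable leb (fun y => g y * fourier (fun z => ce (- (2 * pi) * edot z x) * (W z)%:C) y).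
  apply: (cintegrable_le _ (int_gK x)) => [|y].
    by apply: cmeasM; [exact: intg.1|exact: cmeas_fourier].
  by rewrite normcM ler_wpM2l ?normc_ge0.
rewrite (le_trans (normc_cint iF))//; apply: le_Rintegral => //.
- exact: iF.2.
- exact: int_gK.
by move=> y _; rewrite normcM ler_wpM2l ?normc_ge0.
Qed.

(* For the weight [W], the kernel [F W (x - y)] is dominated by the integrable kernel
   [K]; writing [|F g|^2 W = F g . B] and moving F onto [B], AM-GM and Schur's test
   bound the integral. *)
Lemma bessel_window :
  (\int[leb]_x (normc (fourier g x) ^+ 2 * W x)%:E <=
   (17 ^+ d)%:E * \int[leb]_x (normc (g x) ^+ 2)%:E)%E.
Proof.
have iFB : cintegrable leb (fun y => fourier g y * B y).
  apply: (@cintegrableMl _ _ _ _ _ _ (\int[leb]_x normc (g x))) => //.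
    exact: cmeas_fourier.
  by move=> x; exact: normc_fourier_le.
have E1 x : fourier g x * B x = (normc (fourier g x) ^+ 2 * W x)%:C.
  by rewrite /B mulrA mul_conjc -rmorphM.
have igFB : cintegrable leb (fun x => g x * fourier B x).
  under eq_fun do rewrite mulrC.
  apply: (@cintegrableMl _ _ _ _ _ _ (\int[leb]_x normc (B x))) => //.
    exact: cmeas_fourier.
  by move=> x; exact: normc_fourier_le.
have mg := measurable_normc intg.1.
have mG : measurable_fun setT (fun z : E * E => (normc (g z.1) * normc (g z.2) * K z.1 z.2)%:E).
  apply/measurable_EFinP; apply: measurable_funM => //; apply: measurable_funM.
    exact: (measurableT_comp mg measurable_fst).
  exact: (measurableT_comp mg measurable_snd).
have mG1 : measurable_fun setT (fun z : E * E => (normc (g z.1) ^+ 2 * K z.1 z.2)%:E).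
  apply/measurable_EFinP; apply: measurable_funM => //; apply: measurable_funX.
  exact: (measurableT_comp mg measurable_fst).
have mG2 : measurable_fun setT (fun z : E * E => (normc (g z.2) ^+ 2 * K z.1 z.2)%:E).
  apply/measurable_EFinP; apply: measurable_funM => //; apply: measurable_funX.
  exact: (measurableT_comp mg measurable_snd).
have M0 : measurable_fun setT (fun x => \int[leb]_y (normc (g x) * normc (g y) * K x y)%:E)%E.
  have := @measurable_fun_fubini_tonelli_F _ _ _ _ _ leb _ mG.
  by apply => z; rewrite lee_fin !mulr_ge0 ?normc_ge0.
have M1 : measurable_fun setT (fun x => \int[leb]_y (normc (g x) ^+ 2 * K x y)%:E)%E.
  have := @measurable_fun_fubini_tonelli_F _ _ _ _ _ leb _ mG1.
  by apply => z; rewrite lee_fin mulr_ge0 ?sqr_ge0.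
have M2 : measurable_fun setT (fun x => \int[leb]_y (normc (g y) ^+ 2 * K x y)%:E)%E.
  have := @measurable_fun_fubini_tonelli_F _ _ _ _ _ leb _ mG2.
  by apply => z; rewrite lee_fin mulr_ge0 ?sqr_ge0.
have S1 : (\int[leb]_x \int[leb]_y (normc (g x) ^+ 2 * K x y)%:E <=
    (17 ^+ d)%:E * \int[leb]_x (normc (g x) ^+ 2)%:E)%E.
  rewrite -ge0_integralZl//; last 2 first.
  - (by apply/measurable_EFinP; apply: measurable_normc2; apply: intg.1).
  - by move=> x _; rewrite lee_fin sqr_ge0.
  apply: ge0_le_integral => //.
  - by move=> x _; apply: integral_ge0 => y _; rewrite lee_fin mulr_ge0 ?sqr_ge0.
  - apply: emeasurable_funM => //; (by apply/measurable_EFinP; apply: measurable_normc2; apply: intg.1).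
  move=> x _; under eq_integral do rewrite EFinM.
  rewrite ge0_integralZl//; last 3 first.
  - apply/measurable_EFinP; exact: (measurableT_comp mK (measurable_pair1 x)).
  - by move=> y _; rewrite lee_fin.
  - by rewrite lee_fin sqr_ge0.
  by rewrite muleC lee_wpmul2r// lee_fin sqr_ge0.
have S2 : (\int[leb]_x \int[leb]_y (normc (g y) ^+ 2 * K x y)%:E <=
    (17 ^+ d)%:E * \int[leb]_x (normc (g x) ^+ 2)%:E)%E.
  apply: le_trans S1.
  have G20 (z : E * E) : (0 <= (normc (g z.2) ^+ 2 * K z.1 z.2)%:E)%E.
    by rewrite lee_fin mulr_ge0 ?sqr_ge0.
  (* Tonelli exchanges the variables, and the symmetry of [K] reduces this bound to the previous
     one. *)
  have FT := @fubini_tonelli _ _ _ _ _ leb leb _ mG2 G20.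
  rewrite /fubini_F /fubini_G /= in FT; rewrite FT.
  by under eq_integral do under eq_integral do rewrite /= KC.
apply: (@le_trans _ _ (\int[leb]_x \int[leb]_y (normc (g x) * normc (g y) * K x y)%:E)%E).
  have -> : (\int[leb]_x (normc (fourier g x) ^+ 2 * W x)%:E)%E =
      (\int[leb]_x Re (fourier g x * B x))%:E.
    rewrite /Rintegral fineK; last first.
      exact: (integrable_fin_num measurableT (cintegrable_Re iFB)).
    by apply: eq_integral => x _; rewrite E1.
  apply: (@le_trans _ _ (\int[leb]_x normc (g x * fourier B x))%:E).
    rewrite lee_fin (_ : \int[leb]_x _ = Re (cint leb (fun x => fourier g x * B x)))//.
    rewrite cint_fourierM// (le_trans (ler_norm _))// (le_trans (ler_Re_normc _))//.
    exact: normc_cint.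
  rewrite /Rintegral fineK; last exact: (integrable_fin_num measurableT igFB.2).
  apply: ge0_le_integral => //.
  - by move=> x _; rewrite lee_fin normc_ge0.
  - (by apply/measurable_EFinP; apply: measurable_normc; apply: igFB.1).
  move=> x _; under [X in (_ <= X)%E]eq_integral do rewrite -mulrA EFinM.
  rewrite ge0_integralZl//; last 3 first.
  - by case: (integrableP _ _ _ (int_gK x)).
  - by move=> y _; rewrite lee_fin mulr_ge0 ?normc_ge0.
  - by rewrite lee_fin normc_ge0.
  rewrite normcM EFinM lee_wpmul2l ?lee_fin ?normc_ge0//.
  rewrite -(fineK (integrable_fin_num measurableT (int_gK x))) lee_fin.
  exact: fourier_B.
apply: (@le_trans _ _ (\int[leb]_x (2^-1%:E * \int[leb]_y (normc (g x) ^+ 2 * K x y)%:E +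
    2^-1%:E * \int[leb]_y (normc (g y) ^+ 2 * K x y)%:E))%E).
  apply: ge0_le_integral => //.
  - by move=> x _; apply: integral_ge0 => y _; rewrite lee_fin !mulr_ge0 ?normc_ge0.
  - by apply: emeasurable_funD; apply: emeasurable_funM.
  move=> x _.
  have m1 : measurable_fun setT (fun y => (normc (g x) ^+ 2 * K x y)%:E).
    exact: (measurableT_comp mG1 (measurable_pair1 x)).
  have m2 : measurable_fun setT (fun y => (normc (g y) ^+ 2 * K x y)%:E).
    exact: (measurableT_comp mG2 (measurable_pair1 x)).
  rewrite -!ge0_integralZl//; last 2 first.
  - by move=> y _; rewrite lee_fin mulr_ge0 ?sqr_ge0.
  - by move=> y _; rewrite lee_fin mulr_ge0 ?sqr_ge0.
  rewrite -ge0_integralD//; last 4 first.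
  - by move=> y _; rewrite -EFinM lee_fin mulr_ge0// mulr_ge0 ?sqr_ge0.
  - by apply: emeasurable_funM.
  - by move=> y _; rewrite -EFinM lee_fin mulr_ge0// mulr_ge0 ?sqr_ge0.
  - by apply: emeasurable_funM.
  apply: ge0_le_integral => //.
  - by move=> y _; rewrite lee_fin !mulr_ge0 ?normc_ge0.
  - exact: (measurableT_comp mG (measurable_pair1 x)).
  - by apply: emeasurable_funD; apply: emeasurable_funM.
  move=> y _; rewrite -!EFinM -EFinD lee_fin !mulrA -mulrDl ler_wpM2r//.
  have := sqr_ge0 (normc (g x) - normc (g y)); rewrite !expr2; lra.
rewrite ge0_integralD//; last 4 first.
- move=> x _; rewrite mule_ge0// integral_ge0// => y _.
  by rewrite lee_fin mulr_ge0 ?sqr_ge0.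
- exact: emeasurable_funM.
- move=> x _; rewrite mule_ge0// integral_ge0// => y _.
  by rewrite lee_fin mulr_ge0 ?sqr_ge0.
- exact: emeasurable_funM.
rewrite !ge0_integralZl//; last 2 first.
- by move=> x _; rewrite integral_ge0// => y _; rewrite lee_fin mulr_ge0 ?sqr_ge0.
- by move=> x _; rewrite integral_ge0// => y _; rewrite lee_fin mulr_ge0 ?sqr_ge0.
have G0 : (0 <= \int[leb]_x (normc (g x) ^+ 2)%:E)%E.
  by apply: integral_ge0 => x _; rewrite lee_fin sqr_ge0.
move: S1 S2 G0; move: (\int[leb]_x (normc (g x) ^+ 2)%:E)%E => G S1 S2 G0.
rewrite [X in (_ <= X)%E](_ : _ =
    (2^-1%:E * ((17 ^+ d)%:E * G) + 2^-1%:E * ((17 ^+ d)%:E * G))%E).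
  have h2 : (0 <= 2^-1%:E :> \bar R)%E by [].
  exact: (leeD (lee_wpmul2l h2 S1) (lee_wpmul2l h2 S2)).
rewrite -ge0_muleDl ?lee_fin//.
by rewrite -EFinD (_ : 2^-1 + 2^-1 = 1 :> R) ?mul1e//; field.
Qed.

End bessel.

(** On the ball of radius n the window with N = 2(n+1) is at least 1/2 in every coordinate, so 1 <=
    2^d W there; the bound under the window does not depend on n, which then tends to infinity. *)
Lemma fourier_bessel (g : E -> R[i]) : cintegrable leb g ->
  (\int[leb]_x (normc (fourier g x) ^+ 2)%:E <=
   (34 ^+ d)%:E * \int[leb]_x (normc (g x) ^+ 2)%:E)%E.
Proof.
move=> intg.
have mF : measurable_fun setT (fun x => (normc (fourier g x) ^+ 2)%:E).
  (by apply/measurable_EFinP; apply: measurable_normc2; apply: cmeas_fourier).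
have cn : continuous (fun x : E => `|x|) by exact: norm_continuous.
have mA (n : nat) : measurable [set x : E | `|x| <= n%:R].
  apply: closed_measurable_rV.
  by apply: (@closed_comp _ _ (fun x : E => `|x|) [set t | t <= n%:R]).
apply: (@ge0_integral_exhaust _ _ _ _ (fun n => [set x : E | `|x| <= n%:R])) => //.
- by move=> m n mn; apply/subsetPset => x /= /le_trans; apply; rewrite ler_nat.
- rewrite -subTset => x _; exists (Num.bound `|x|) => //=.
  by rewrite ltW// archi_boundP.
- by move=> x; rewrite lee_fin sqr_ge0.
move=> n; set N : R := 2 * n.+1%:R.
have N0 : 0 < N by rewrite mulr_gt0.
have W0 x : 0 <= \prod_(i < d) qwin N (x ord0 i) by apply: prodr_ge0 => i _; exact: qwin_ge0.
have mW : measurable_fun setT (fun x : E => \prod_(i < d) qwin N (x ord0 i)).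
  apply: measurable_prod => i _.
  exact: (measurableT_comp (measurable_qwin N) (@measurable_rV_coord R d i)).
have mFW : measurable_fun setT (fun x : E =>
    (normc (fourier g x) ^+ 2 * \prod_(i < d) qwin N (x ord0 i))%:E).
  apply/measurable_EFinP; apply: measurable_funM => //.
  by apply: measurable_normc2; exact: cmeas_fourier.
have -> : 34 ^+ d = 2 ^+ d * 17 ^+ d :> R.
  by rewrite -exprMn; congr (_ ^+ _); ring.
rewrite EFinM -muleA.
apply: (@le_trans _ _ ((2 ^+ d)%:E * \int[leb]_x
    (normc (fourier g x) ^+ 2 * \prod_(i < d) qwin N (x ord0 i))%:E)%E); last first.
  apply: lee_wpmul2l; first by rewrite lee_fin exprn_ge0.
  exact: bessel_window.
rewrite -ge0_integralZl//; last first.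
  by move=> x _; rewrite lee_fin mulr_ge0 ?sqr_ge0.
pose A := [set x : E | `|x| <= n%:R].
apply: (@le_trans _ _ (\int[leb]_(x in A) ((2 ^+ d)%:E *
    (normc (fourier g x) ^+ 2 * \prod_(i < d) qwin N (x ord0 i))%:E))%E).
  apply: ge0_le_integral => //.
  - by move=> x _; rewrite lee_fin sqr_ge0.
  - exact: measurable_funTS.
  - by apply: measurable_funTS; apply: emeasurable_funM.
  move=> x /= xn; rewrite -EFinM lee_fin mulrCA ler_peMr ?sqr_ge0//.
  rewrite -[X in X ^+ d]invrK exprVn mulrC ler_pdivlMr ?exprn_gt0 ?invr_gt0//.
  rewrite mul1r -[in leLHS](card_ord d) -prodr_const; apply: ler_prod => i _.
  rewrite invr_ge0 ler0n/=; apply: qwin_ge => //.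
  rewrite (le_trans (norm_coord_le _ _))// (le_trans xn)// /N mulrAC divff// mul1r.
  by rewrite ler_nat.
apply: ge0_subset_integral => //.
- exact: mA.
- by apply: emeasurable_funM.
- by move=> x _; rewrite -EFinM lee_fin !mulr_ge0 ?exprn_ge0 ?normc_ge0.
Qed.

End fourier_transform.

(** * Uniform boundedness of weakly null sequences *)

Section square_summable_tails.
Variable R : realType.
Implicit Type u : nat -> R.

(** Cauchy-Schwarz with weights 2^j, whose inverses sum to at most 2. Peeling off the first term, (s
    + t)^2 <= 2 s^2 + 2 t^2 costs a factor 2, just what shifting the weights supplies. *)
Lemma sqr_sum_le u n :
  (\sum_(0 <= j < n) u j) ^+ 2 <= 2 * \sum_(0 <= j < n) 2 ^+ j * u j ^+ 2.
Proof.
elim: n u => [|n IH] u; first by rewrite !big_geq// expr0n mulr0.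
rewrite !big_nat_recl//= expr0 mul1r.
have := IH (fun j => u j.+1); set a := \sum_(_ <= _ < _) _; set b := \sum_(_ <= _ < _) _.
rewrite (_ : \sum_(0 <= i < n) 2 ^+ i.+1 * u i.+1 ^+ 2 = 2 * b); last first.
  by rewrite mulr_sumr; apply: eq_bigr => i _; rewrite exprS mulrA.
by have := sqr_ge0 (u 0%N - a); nra.
Qed.

(** Absolute convergence follows from |u_j| <= 2^-j + 2^j u_j^2, and the bound is the limit of
    [sqr_sum_le]. *)
Lemma weighted_sqr_series u : (\sum_(j <oo) (2 ^+ j * u j ^+ 2)%:E < +oo)%E ->
  cvgn (series u) /\
  ((limn (series u) ^+ 2)%:E <= 2%:E * \sum_(j <oo) (2 ^+ j * u j ^+ 2)%:E)%E.
Proof.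
set Q := (\sum_(_ <oo) _)%E => Qoo.
have p0 j : 0 <= 2 ^+ j * u j ^+ 2 by rewrite mulr_ge0 ?sqr_ge0 ?exprn_ge0.
have cu : cvgn (series u).
  apply: normed_cvg.
  apply: (@series_le_cvg _ _ (fun j => geometric 1 2^-1 j + 2 ^+ j * u j ^+ 2)) => [n|n|n|].
  - by rewrite normr_ge0.
  - by rewrite addr_ge0// /geometric/= mul1r exprn_ge0 ?invr_ge0.
  - rewrite /geometric/= mul1r exprVn; set b := 2 ^+ n.
    have b0 : 0 < b by rewrite exprn_gt0.
    have := real_normK (num_real (u n)); have := normr_ge0 (u n).
    move: `|u n| => t t0 <-.
    rewrite -(ler_pM2l b0) mulrDr mulfV ?gt_eqF//.
    have := sqr_ge0 (b * t - 1); have := mulr_ge0 (ltW b0) t0; nra.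
  rewrite seriesD; apply: is_cvgD.
    by apply: is_cvg_geometric_series; rewrite ger0_norm ?invr_ge0// invf_lt1// ltr1n.
  exact: nnseries_is_cvg.
split => //.
have Q0 : (0 <= Q)%E by apply: nneseries_ge0 => j _ _; rewrite lee_fin.
have Qf : Q \is a fin_num by rewrite ge0_fin_numE.
rewrite -(fineK Qf) -EFinM lee_fin.
have c2 : (fun n => series u n ^+ 2) @ \oo --> limn (series u) ^+ 2.
  by rewrite expr2; under eq_fun do rewrite expr2; exact: cvgM.
rewrite -(cvg_lim (@Rhausdorff R) c2).
apply: limr_le; first by apply/cvg_ex; eexists; exact: c2.
apply: nearW => n; rewrite (le_trans (sqr_sum_le u n))// ler_pM2l//.
rewrite -lee_fin fineK// -sumEFin.
by apply: nneseries_lim_ge => j _ _; rewrite lee_fin.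
Qed.

(** The first K terms are finite, and the others are the shifted series multiplied by 2^K. *)
Lemma weighted_sqr_shift u K :
  (\sum_(j <oo) (2 ^+ j * u (K + j)%N ^+ 2)%:E < +oo)%E ->
  (\sum_(j <oo) (2 ^+ j * u j ^+ 2)%:E < +oo)%E.
Proof.
set Q := (\sum_(_ <oo) _)%E => Qoo.
have p0 v j : 0 <= 2 ^+ j * v j ^+ 2 :> R by rewrite mulr_ge0 ?sqr_ge0 ?exprn_ge0.
have Q0 : (0 <= Q)%E by apply: nneseries_ge0 => j _ _; rewrite lee_fin (p0 (fun j => u (K + j)%N)).
have Qf : Q \is a fin_num by rewrite ge0_fin_numE.
apply: (@le_lt_trans _ _ (\sum_(0 <= j < K) 2 ^+ j * u j ^+ 2 + 2 ^+ K * fine Q)%:E); last exact: ltry.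
apply: lime_le.
  by apply: is_cvg_nneseries => j _ _; rewrite lee_fin (p0 u).
apply: nearW => n; rewrite sumEFin lee_fin.
apply: (@le_trans _ _ (\sum_(0 <= j < K + n) 2 ^+ j * u j ^+ 2)).
  rewrite (@big_cat_nat _ _ _ n 0 (K + n))//= ?leq_addl// lerDl.
  by apply: sumr_ge0 => j _; exact: (p0 u).
rewrite (@big_cat_nat _ _ _ K 0 (K + n))//= ?leq_addr// lerD2l.
rewrite -{1}(add0n K) big_addn addKn mulrC -ler_pdivrMr ?exprn_gt0// mulr_suml.
rewrite -lee_fin fineK// -sumEFin.
apply: le_trans (_ : (\sum_(0 <= j < n) (2 ^+ j * u (K + j)%N ^+ 2)%:E <= Q)%E); last first.
  by apply: nneseries_lim_ge => j _ _; rewrite lee_fin (p0 (fun j => u (K + j)%N)).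
rewrite le_eqVlt; apply/orP; left; apply/eqP; apply: eq_bigr => j _; congr EFin.
by rewrite addnC exprD; field; rewrite expf_neq0.
Qed.

End square_summable_tails.

Section weak_boundedness.
Context d (T : measurableType d) (R : realType) (mu : {measure set T -> \bar R}).
Implicit Types f g h : T -> R.

Definition L2r h := measurable_fun setT h /\ (\int[mu]_x (h x ^+ 2)%:E < +oo)%E.
Definition sqL2 h : R := \int[mu]_x (h x ^+ 2).

Let msqr h : measurable_fun setT h -> measurable_fun setT (fun x => (h x ^+ 2)%:E).
Proof. by move=> mh; apply/measurable_EFinP; exact: measurable_funX. Qed.

Lemma sqL2_ge0 h : 0 <= sqL2 h.
Proof. by apply: Rintegral_ge0 => x _; exact: sqr_ge0. Qed.

Lemma sqL2E h : L2r h -> (\int[mu]_x (h x ^+ 2)%:E)%E = (sqL2 h)%:E.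
Proof.
move=> [mh h2]; rewrite /sqL2 /Rintegral fineK// ge0_fin_numE//.
by apply: integral_ge0 => x _; rewrite lee_fin sqr_ge0.
Qed.

Lemma L2r_integrable h : L2r h -> mu.-integrable setT (fun x => (h x ^+ 2)%:E).
Proof.
move=> [mh h2]; apply/integrableP; split; first exact: msqr.
by under eq_integral do rewrite /= ger0_norm ?sqr_ge0//.
Qed.

Lemma L2r_le h (g : T -> \bar R) : measurable_fun setT h -> measurable_fun setT g ->
  (forall x, ((h x ^+ 2)%:E <= g x)%E) -> (\int[mu]_x g x < +oo)%E -> L2r h.
Proof.
move=> mh mg hg goo; split => //; apply: le_lt_trans goo.
apply: ge0_le_integral => //.
- by move=> x _; rewrite lee_fin sqr_ge0.
- exact: msqr.
Qed.

Lemma L2rD f g : L2r f -> L2r g -> L2r (fun x => f x + g x).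
Proof.
move=> Lf Lg; have mf := Lf.1; have mg := Lg.1.
apply: (@L2r_le _ (fun x => ((2 * f x ^+ 2)%:E + (2 * g x ^+ 2)%:E)%E)).
- exact: measurable_funD.
- by apply: emeasurable_funD; apply/measurable_EFinP; apply: measurable_funM => //; exact: measurable_funX.
- by move=> x; rewrite -EFinD lee_fin; have := sqr_ge0 (f x - g x); rewrite !expr2; lra.
rewrite integralD//; last 2 first.
- exact: (integrableZl measurableT 2 (L2r_integrable Lf)).
- exact: (integrableZl measurableT 2 (L2r_integrable Lg)).
apply: lte_add_pinfty; under eq_integral do rewrite EFinM.
  rewrite ge0_integralZl//; last 2 first.
  - exact: msqr.
  - by move=> x _; rewrite lee_fin sqr_ge0.
  by rewrite sqL2E// -EFinM ltry.
rewrite ge0_integralZl//; last 2 first.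
- exact: msqr.
- by move=> x _; rewrite lee_fin sqr_ge0.
by rewrite sqL2E// -EFinM ltry.
Qed.

Lemma L2rZ c f : L2r f -> L2r (fun x => c * f x).
Proof.
move=> Lf; have mf := Lf.1.
apply: (@L2r_le _ (fun x => ((c ^+ 2)%:E * (f x ^+ 2)%:E)%E)).
- by apply: measurable_funM => //; exact: measurable_cst.
- by apply: emeasurable_funM => //; exact: msqr.
- by move=> x; rewrite -EFinM lee_fin exprMn.
rewrite ge0_integralZl//; last 3 first.
- exact: msqr.
- by move=> x _; rewrite lee_fin sqr_ge0.
- by rewrite lee_fin sqr_ge0.
by rewrite sqL2E// -EFinM ltry.
Qed.

Lemma L2rB f g : L2r f -> L2r g -> L2r (fun x => f x - g x).
Proof.
move=> Lf Lg; rewrite (_ : (fun x => _) = (fun x => f x + -1 * g x)).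
  by apply: L2rD => //; exact: L2rZ.
by apply/funext => x; rewrite mulN1r.
Qed.

Lemma sqL2Z c f : L2r f -> sqL2 (fun x => c * f x) = c ^+ 2 * sqL2 f.
Proof.
move=> Lf; rewrite /sqL2; under eq_Rintegral do rewrite exprMn.
by rewrite RintegralZl//; exact: L2r_integrable.
Qed.

Lemma L2r0 : L2r (fun=> 0).
Proof.
split; first exact: measurable_cst.
by under eq_integral do rewrite expr0n/=; rewrite integral0 ltry.
Qed.

Lemma L2r_mul_integrable f g : L2r f -> L2r g ->
  mu.-integrable setT (fun x => (f x * g x)%:E).
Proof.
move=> Lf Lg; have [mf mg] := (Lf.1, Lg.1).
have H := integrableD measurableT (L2r_integrable Lf) (L2r_integrable Lg).
apply: (le_integrable _ _ _ H) => //.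
  by apply/measurable_EFinP; exact: measurable_funM.
move=> x _ /=; rewrite lee_fin [leRHS]ger0_norm ?addr_ge0 ?sqr_ge0//.
rewrite ler_norml; apply/andP; split.
  by have := sqr_ge0 (f x + g x); rewrite !expr2; nra.
by have := sqr_ge0 (f x - g x); rewrite !expr2; nra.
Qed.

(** Optimising s would give Cauchy-Schwarz; the free parameter avoids square roots of the norms. *)
Lemma L2r_amgm s f g : 0 < s -> L2r f -> L2r g ->
  `|\int[mu]_x (f x * g x)| <= (s * sqL2 f + s^-1 * sqL2 g) / 2.
Proof.
move=> s0 Lf Lg; have ifg := L2r_mul_integrable Lf Lg.
have [i1 i2] := (L2r_integrable Lf, L2r_integrable Lg).
rewrite (le_trans (le_normr_Rintegral _ ifg))//.
have -> : (s * sqL2 f + s^-1 * sqL2 g) / 2 =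
    \int[mu]_x ((s / 2) * f x ^+ 2 + (s^-1 / 2) * g x ^+ 2).
  rewrite RintegralD//; last 2 first.
  - exact: (integrableZl measurableT _ i1).
  - exact: (integrableZl measurableT _ i2).
  by rewrite !RintegralZl// /sqL2; ring.
apply: le_Rintegral => //.
- exact: (integrable_norm ifg).
- have := integrableD measurableT (integrableZl measurableT (s / 2) i1) (integrableZl measurableT (s^-1 / 2) i2).
  by apply.
move=> x _; rewrite normrM -[in leRHS](real_normK (num_real (f x))) -[in leRHS](real_normK (num_real (g x))).
move: `|f x| `|g x| => a b.
rewrite -(ler_pM2l s0) mulrDr.
have -> : s * (s^-1 / 2 * b ^+ 2) = b ^+ 2 / 2 by field; rewrite gt_eqF.
by have := sqr_ge0 (s * a - b); rewrite !expr2; nra.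
Qed.

(** Completeness of L^2 for geometrically small terms. The weighted sums [Q K] of squares beyond K
    have integral at most 2 / 16^K, and bound the remainder of the series pointwise: its square is
    at most 2 [Q K]. *)
Lemma L2r_series (e : nat -> T -> R) : (forall k, L2r (e k)) ->
  (forall k, sqL2 (e k) <= (16 ^+ k)^-1) ->
  exists2 g, L2r g & forall K, sqL2 (fun x => g x - \sum_(0 <= k < K) e k x) <= 4 * (16 ^+ K)^-1.
Proof.
move=> Le qe.
pose Q K x := (\sum_(j <oo) (2 ^+ j * e (K + j)%N x ^+ 2)%:E)%E.
have p0 K j x : 0 <= 2 ^+ j * e (K + j)%N x ^+ 2 by rewrite mulr_ge0 ?sqr_ge0 ?exprn_ge0.
have mp K j : measurable_fun setT (fun x => (2 ^+ j * e (K + j)%N x ^+ 2)%:E).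
  apply/measurable_EFinP; apply: measurable_funM; first exact: measurable_cst.
  by apply: measurable_funX; exact: (Le _).1.
have mQ K : measurable_fun setT (Q K).
  by apply: ge0_emeasurable_sum => [j x _ _|j _]; [rewrite lee_fin|exact: mp].
have Q_ge0 K x : (0 <= Q K x)%E by apply: nneseries_ge0 => j _ _; rewrite lee_fin.
have intQ K : (\int[mu]_x Q K x <= (2 * (16 ^+ K)^-1)%:E)%E.
  rewrite integral_nneseries//; last by move=> j x _; rewrite lee_fin.
  apply: lime_le.
    apply: is_cvg_nneseries => j _ _; apply: integral_ge0 => x _; by rewrite lee_fin.
  apply: nearW => n.
  apply: (@le_trans _ _ (\sum_(0 <= j < n) (2 ^+ j * (16 ^+ (K + j))^-1)%:E)%E).
    apply: lee_sum => j _; under eq_integral do rewrite EFinM.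
    rewrite ge0_integralZl//; last 2 first.
    - exact: msqr (Le _).1.
    - by move=> x _; rewrite lee_fin sqr_ge0.
    by rewrite sqL2E// EFinM lee_wpmul2l// ?lee_fin ?exprn_ge0.
  rewrite sumEFin lee_fin.
  (* The weights leave the geometric series of ratio 2/16 = 1/8; its closed form has 8/7 < 2 as a
     limit. *)
  suff : \sum_(0 <= j < n) 2 ^+ j * (16 ^+ (K + j))^-1 <= (16 ^+ K)^-1 * (8 / 7 * (1 - (8 ^+ n)^-1)) :> R.
    move=> /le_trans; apply; rewrite mulrC ler_wpM2r ?invr_ge0 ?exprn_ge0//.
    have : 0 < (8 ^+ n)^-1 :> R by rewrite invr_gt0 exprn_gt0.
    by lra.
  elim: n => [|n IH].
    by rewrite big_geq// expr0 invr1 subrr !mulr0.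
  rewrite big_nat_recr//= (le_trans (lerD IH (lexx _)))//.
  have -> : 2 ^+ n * (16 ^+ (K + n))^-1 = (16 ^+ K)^-1 * (8 ^+ n)^-1 :> R.
    rewrite exprD (_ : 16 ^+ n = 2 ^+ n * 8 ^+ n :> R); last by rewrite -exprMn; congr (_ ^+ _); ring.
    by field; rewrite !expf_neq0.
  rewrite -mulrDr ler_wpM2l ?invr_ge0 ?exprn_ge0// exprS.
  have : 0 < (8 ^+ n)^-1 :> R by rewrite invr_gt0 exprn_gt0.
  rewrite invfM; lra.
pose D := [set x | (Q 0%N x < +oo)%E].
have mD : measurable D.
  by rewrite /D -[X in measurable X]setTI; exact: emeasurable_fun_infty_o.
(* Cut off where [Q 0] is infinite, the series converges at every point, so that its sum is
   measurable as a pointwise limit. *)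
pose e' k x := e k x * \1_D x.
have me' k : measurable_fun setT (e' k).
  apply: measurable_funM; first exact: (Le k).1.
  exact: measurable_indic.
have ce' x : cvgn (series (e'^~ x)).
  have [Dx|Dx] := pselect (D x).
    rewrite (_ : e'^~ x = e^~ x); last by apply/funext => k; rewrite /e' indicE mem_set// mulr1.
    by have [] := @weighted_sqr_series _ (e^~ x) Dx.
  rewrite (_ : e'^~ x = fun=> 0); last by apply/funext => k; rewrite /e' indicE memNset// mulr0.
  rewrite (_ : series _ = fun=> 0); first exact: is_cvg_cst.
  by apply/funext => n; rewrite /series/= big1.
pose g x := limn (series (e'^~ x)).
have mg : measurable_fun setT g.
  apply: (@measurable_fun_cvg _ _ _ _ (fun n x => series (e'^~ x) n)) => [n|x _]; last exact: ce'.
  by apply: measurable_sum => k; exact: me'.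
have gS K x : (((g x - \sum_(0 <= k < K) e k x) ^+ 2)%:E <= 2%:E * Q K x)%E.
  (* Where [Q K] is infinite the bound is vacuous; elsewhere [Q 0] is finite too and x lies in
     [D]. *)
  have [QK|QK] := ltP (Q K x) +oo%E; last first.
    by move: QK; rewrite leye_eq => /eqP ->; rewrite gt0_muley ?leey// lte_fin.
  have Dx : D x by exact: weighted_sqr_shift QK.
  have [cs sq] := @weighted_sqr_series _ (fun j => e (K + j)%N x) QK.
  suff -> : g x = \sum_(0 <= k < K) e k x + limn (series (fun j => e (K + j)%N x)).
    by rewrite addrAC subrr add0r.
  rewrite /g; apply: cvg_lim; first exact: Rhausdorff.
  rewrite (_ : e'^~ x = e^~ x); last by apply/funext => k; rewrite /e' indicE mem_set// mulr1.
  rewrite -(cvg_shiftn K).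
  rewrite (_ : (fun n => _) = (fun n => \sum_(0 <= k < K) e k x + series (fun j => e (K + j)%N x) n)).
    by apply: cvgD; [exact: cvg_cst|exact: cs].
  apply/funext => n; rewrite /series/= (@big_cat_nat _ _ _ K 0 (n + K))//= ?leq_addl//.
  congr (_ + _); rewrite -{1}(add0n K) big_addn addnK.
  by apply: eq_bigr => j _; rewrite addnC.
have int2Q K : (\int[mu]_x (2%:E * Q K x) <= (4 * (16 ^+ K)^-1)%:E)%E.
  rewrite ge0_integralZl//.
  rewrite (_ : 4 * (16 ^+ K)^-1 = 2 * (2 * (16 ^+ K)^-1)); last by ring.
  by rewrite EFinM lee_wpmul2l.
have m2Q K : measurable_fun setT (fun x => 2%:E * Q K x)%E by exact: emeasurable_funM.
have mgS K : measurable_fun setT (fun x => g x - \sum_(0 <= k < K) e k x).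
  by apply: measurable_funB => //; apply: measurable_sum => k; exact: (Le k).1.
have LgS K : L2r (fun x => g x - \sum_(0 <= k < K) e k x).
  by apply: (L2r_le _ (m2Q K) (gS K)) => //; apply: le_lt_trans (int2Q K) _; exact: ltry.
exists g.
  have := LgS 0%N; rewrite (_ : (fun x => _) = g)//.
  by apply/funext => x; rewrite big_geq// subr0.
move=> K; rewrite -lee_fin -sqL2E//; apply: le_trans (int2Q K).
apply: ge0_le_integral => //.
- by move=> x _; rewrite lee_fin sqr_ge0.
- exact: msqr.
Qed.

(* Gliding hump: if the norms are unbounded, the sum of
   [4^-k a_(n_k) / |a_(n_k)|] along a sparse subsequence is an L^2 function whose
   pairings with [a_(n_k)] stay above 1. *)
Lemma weakly_null_bounded (a : nat -> T -> R) : (forall n, L2r (a n)) ->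
  (forall h, L2r h -> (fun n => \int[mu]_x (a n x * h x)) @ \oo --> (0 : R)) ->
  exists C : R, forall n, sqL2 (a n) <= C.
Proof.
move=> La wa; apply: contrapT => unb.
(* Unboundedness persists beyond any index m: the norms up to m are bounded by their sum. *)
have big_after (C : R) m : exists2 n, (m < n)%N & C < sqL2 (a n).
  apply: contrapT => H; apply: unb.
  exists (C + \sum_(0 <= k < m.+1) sqL2 (a k)) => n.
  have C0 : \sum_(0 <= k < m.+1) sqL2 (a k) >= 0.
    by apply: sumr_ge0 => k _; exact: sqL2_ge0.
  have [nm|mn] := leqP n m.
    have Cpos : sqL2 (a m.+1) <= C.
      by rewrite leNgt; apply/negP => ?; apply: H; exists m.+1.
    have C_ge0 : 0 <= C by apply: le_trans Cpos; exact: sqL2_ge0.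
    rewrite (le_trans _ (lerD C_ge0 (lexx _)))// add0r big_mkord.
    have nm' : (n < m.+1)%N by [].
    rewrite (bigD1 (Ordinal nm'))//= lerDl.
    by apply: sumr_ge0 => k _; exact: sqL2_ge0.
  rewrite (@le_trans _ _ C)//; last by rewrite lerDl.
  by rewrite leNgt; apply/negP => ?; apply: H; exists n.
(* The size 100 * 16^k makes 4^-k |a_n| at least 10. The pairing of a_(n_k) with the k-th term is
   then at least 10, that with the earlier terms at least -1, and that with the later ones will
   consume at most half of the first. *)
pose P k m (S : T -> R) n := [/\ (m < n)%N, 100 * 16 ^+ k <= sqL2 (a n) &
  `|\int[mu]_x (a n x * S x)| <= 1].
have exP k m S : L2r S -> exists n, P k m S n.
  move=> LS; have /cvgrPdist_le/(_ 1 ltr01)[N _ HN] := wa S LS.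
  have [n mn Cn] := big_after (100 * 16 ^+ k) (maxn m N).
  exists n; split.
  - by rewrite (leq_ltn_trans _ mn)// leq_maxl.
  - exact: ltW.
  - have := HN n; rewrite sub0r normrN; apply => /=.
    by rewrite ltnW// (leq_ltn_trans _ mn)// leq_maxr.
pose c k n := (4 ^+ k)^-1 / Num.sqrt (sqL2 (a n)).
(* The state is the last index chosen and the partial sum built so far; the next index depends on
   both. *)
pose nxt k (p : nat * (T -> R)) := let n := get (P k p.1 p.2) in
  (n, fun x => p.2 x + c k n * a n x).
pose s := fix s k := if k is k'.+1 then nxt k' (s k') else (0%N, fun=> 0 : R).
pose n_ k := get (P k (s k).1 (s k).2).
pose e k x := c k (n_ k) * a (n_ k) x.
have sS k : s k.+1 = (n_ k, fun x => (s k).2 x + e k x) by [].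
have Le k : L2r (e k) by exact: L2rZ.
have Ls k : L2r (s k).2.
  by elim: k => [|k IH]; [exact: L2r0|rewrite sS; exact: L2rD].
have Pn k : P k (s k).1 (s k).2 (n_ k) by apply: getPex; exact: exP (Ls k).
have sE k x : (s k).2 x = \sum_(0 <= j < k) e j x.
  elim: k => [|k IH]; first by rewrite big_geq.
  by rewrite big_nat_recr//= -IH.
have r0 k : 0 < sqL2 (a (n_ k)).
  by case: (Pn k) => _ + _; apply: lt_le_trans; rewrite mulr_gt0// exprn_gt0.
have qe k : sqL2 (e k) <= (16 ^+ k)^-1.
  rewrite sqL2Z// /c; set r := Num.sqrt _.
  have rr : r ^+ 2 = sqL2 (a (n_ k)) by rewrite sqr_sqrtr ?sqL2_ge0.
  have rp : 0 < r by rewrite sqrtr_gt0.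
  rewrite -rr (_ : (16 ^+ k)^-1 = ((4 ^+ k)^-1) ^+ 2).
    by rewrite le_eqVlt; apply/orP; left; apply/eqP; field; rewrite expf_neq0//= gt_eqF.
  by rewrite exprVn -exprM mulnC exprM (_ : 4 ^+ 2 = 16)//; ring.
have [g Lg gK] := L2r_series Le qe.
have LgS k : L2r (fun x => g x - (s k.+1).2 x) by exact: L2rB.
have lower k : 1 <= \int[mu]_x (a (n_ k) x * g x).
  case: (Pn k) => _ big small.
  have -> : \int[mu]_x (a (n_ k) x * g x) = \int[mu]_x (a (n_ k) x * (s k).2 x) +
      \int[mu]_x (a (n_ k) x * e k x) + \int[mu]_x (a (n_ k) x * (g x - (s k.+1).2 x)).
    have i1 := L2r_mul_integrable (La (n_ k)) (Ls k).
    have i2 := L2r_mul_integrable (La (n_ k)) (Le k).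
    have i3 := L2r_mul_integrable (La (n_ k)) (LgS k).
    have i12 : mu.-integrable setT (fun x => (a (n_ k) x * (s k).2 x + a (n_ k) x * e k x)%:E).
      exact: (integrableD measurableT i1 i2).
    rewrite -(RintegralD measurableT i1 i2) -(RintegralD measurableT i12 i3).
    by apply: eq_Rintegral => x _; rewrite sS/=; ring.
  set r := Num.sqrt (sqL2 (a (n_ k))).
  have rr : r ^+ 2 = sqL2 (a (n_ k)) by rewrite sqr_sqrtr ?sqL2_ge0.
  have rp : 0 < r by rewrite sqrtr_gt0.
  set t := (4 ^+ k)^-1 : R.
  have tp : 0 < t by rewrite invr_gt0 exprn_gt0.
  have tr : 10 <= t * r.
    have tr0 : 0 <= t * r by rewrite ltW// mulr_gt0.
    rewrite -(@ler_pXn2r _ 2) ?nnegrE// exprMn rr.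
    rewrite /t exprVn -exprM mulnC exprM (_ : 4 ^+ 2 = 16); last by ring.
    rewrite [leRHS]mulrC ler_pdivlMr ?exprn_gt0// (le_trans _ big)//.
    by rewrite ler_pM2r ?exprn_gt0//; rewrite -natrX.
  have E1 : \int[mu]_x (a (n_ k) x * e k x) = t * r.
    rewrite (_ : \int[mu]_x _ = \int[mu]_x (c k (n_ k) * a (n_ k) x ^+ 2)).
      rewrite RintegralZl//; last exact: L2r_integrable.
      rewrite -/(sqL2 _) -rr /c -/r -/t; field; exact: lt0r_neq0.
    by apply: eq_Rintegral => x _; rewrite /e; ring.
  have E2 : `|\int[mu]_x (a (n_ k) x * (g x - (s k.+1).2 x))| <= t * r / 2.
    (* The remainder has norm at most t/2 and a_(n_k) has norm r; t/(2r) is the parameter for which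
       the inequality gives the product of the two. *)
    have th0 : 0 < t / r / 2 by rewrite !divr_gt0.
    rewrite (le_trans (L2r_amgm th0 (La _) (LgS k)))//.
    have := gK k.+1; under eq_fun do rewrite -sE.
    have -> : 4 * (16 ^+ k.+1)^-1 = t ^+ 2 / 4.
      rewrite /t exprVn -exprM mulnC exprM (_ : 4 ^+ 2 = 16); last by ring.
      by rewrite exprS; field; rewrite expf_neq0.
    rewrite -rr => h.
    have -> : t * r / 2 = (t / r / 2 * r ^+ 2 + (t / r / 2)^-1 * (t ^+ 2 / 4)) / 2.
      by field; rewrite !lt0r_neq0.
    by rewrite ler_pM2r ?invr_gt0// lerD2l ler_pM2l ?invr_gt0.
  rewrite E1; move: small E2; rewrite !ler_norml => /andP[+ _] /andP[+ _].
  by move=> ? ?; lra.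
have n_mono k : (k <= n_ k)%N.
  elim: k => [//|k IH]; rewrite (leq_ltn_trans IH)//.
  by case: (Pn k.+1); rewrite sS.
have /cvgrPdist_lt/(_ 1 ltr01)[N _ HN] := wa g Lg.
have := HN (n_ N) (n_mono N); rewrite sub0r normrN /= => h.
by have := lower N; have := ler_norm (\int[mu]_x (a (n_ N) x * g x)); lra.
Qed.

End weak_boundedness.

(** * Smooth functions and their Fourier transforms *)

Section quadratic_derivative.
Variable R : realType.

(** A quadratic remainder is easy to produce both for integrals depending on a parameter and for
    functions flat at a point. *)
Lemma quadratic_is_derive (V : normedModType R) (f : V -> R) (x v : V) (L C : R) :
  (forall h : R, `|f (h *: v + x) - f x - h * L| <= C * h ^+ 2) -> is_derive x v f L.
Proof.
move=> H.
have cv : (fun h => h^-1 *: ((f \o shift x) (h *: v) - f x)) @ 0^' --> L.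
  apply/cvgrPdist_le => e e0; near=> h.
  have h0 : h != 0 by near: h; exact: nbhs_dnbhs_neq.
  have C0 : 0 < `|C| + 1 by rewrite ltr_wpDl.
  have he : `|h| <= e / (`|C| + 1) by near: h; apply: dnbhs0_le; rewrite divr_gt0.
  rewrite /= (_ : L - _ = - (h^-1 * (f (h *: v + x) - f x - h * L))); last first.
    by rewrite mulrBr mulKf// opprB.
  rewrite normrN normrM normfV -(ler_pM2l (_ : 0 < `|h|)) ?normr_gt0//.
  rewrite mulrA mulfV ?normr_eq0// mul1r (le_trans (H h))//.
  rewrite -(real_normK (num_real h)) expr2 mulrCA ler_wpM2l//.
  rewrite ler_pdivlMr// in he; rewrite mulrC (le_trans _ he)// ler_wpM2l//.
  by rewrite (le_trans (ler_norm _))// lerDl.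
apply: DeriveDef; first by apply/cvg_ex; exists L.
exact: cvg_lim cv.
Unshelve. all: by end_near. Qed.

Lemma within_setT_continuous (T U : topologicalType) (f : T -> U) :
  {within setT, continuous f} -> continuous f.
Proof. by move=> cf x; have := cf x; rewrite /continuous_at nbhs_subspaceT. Qed.

End quadratic_derivative.

Section complex_continuity.
Variables (R : realType) (T : topologicalType).
Implicit Types f g : T -> R[i].

Definition ccont f := continuous (fun x : T => Re (f x)) /\ continuous (fun x : T => Im (f x)).

Lemma ccont_cst (c : R[i]) : ccont (fun _ : T => c).
Proof. by split; exact: cst_continuous. Qed.

Lemma ccontD f g : ccont f -> ccont g -> ccont (fun x => f x + g x).
Proof.
move=> [f1 f2] [g1 g2]; split.
  by under eq_fun do rewrite ReD; move=> x; exact: (cvgD (f1 x) (g1 x)).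
by under eq_fun do rewrite ImD; move=> x; exact: (cvgD (f2 x) (g2 x)).
Qed.

Lemma ccontM f g : ccont f -> ccont g -> ccont (fun x => f x * g x).
Proof.
move=> [f1 f2] [g1 g2]; split.
  under eq_fun do rewrite ReM; move=> x.
  exact: (cvgB (cvgM (f1 x) (g1 x)) (cvgM (f2 x) (g2 x))).
under eq_fun do rewrite ImM; move=> x.
exact: (cvgD (cvgM (f1 x) (g2 x)) (cvgM (f2 x) (g1 x))).
Qed.

Lemma ccont_sum (I : Type) (s : seq I) (F : I -> T -> R[i]) :
  (forall i, ccont (F i)) -> ccont (fun x => \sum_(i <- s) F i x).
Proof.
move=> cF; elim: s => [|i s IH].
  by under eq_fun do rewrite big_nil; exact: ccont_cst.
by under eq_fun do rewrite big_cons; exact: ccontD.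
Qed.

Lemma ccontJ f : ccont f -> ccont (fun x => conjc (f x)).
Proof.
move=> [f1 f2]; split; first by under eq_fun do rewrite ReJ.
by under eq_fun do rewrite ImJ; move=> x; exact: (cvgN (f2 x)).
Qed.

Lemma ccontN f : ccont f -> ccont (fun x => - f x).
Proof.
move=> [f1 f2]; split.
  by under eq_fun do rewrite ReN; move=> x; exact: (cvgN (f1 x)).
by under eq_fun do rewrite ImN; move=> x; exact: (cvgN (f2 x)).
Qed.

Lemma ccont_prod (I : Type) (s : seq I) (F : I -> T -> R[i]) :
  (forall i, ccont (F i)) -> ccont (fun x => \prod_(i <- s) F i x).
Proof.
move=> cF; elim: s => [|i s IH].
  by under eq_fun do rewrite big_nil; exact: ccont_cst.
by under eq_fun do rewrite big_cons; exact: ccontM.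
Qed.

End complex_continuity.

Section smooth_functions.
Variables (R : realType) (d : nat).
Local Notation E := 'rV[R]_d.
Local Notation vec i := (delta_mx ord0 i : E).
Implicit Types f g : E -> R[i].

Lemma ccontP f : ccontinuous setT f <-> ccont f.
Proof.
split=> -[f1 f2]; split; solve [exact: within_setT_continuous|exact: continuous_subspaceT].
Qed.

Lemma ccont_cmeas f : ccont f -> cmeas f.
Proof. by move=> [f1 f2]; split; exact: continuous_measurable_rV. Qed.

Definition cderivable f := forall i x,
  derivable (fun y => Re (f y)) x (vec i) /\ derivable (fun y => Im (f y)) x (vec i).

Definition has_cpartial i f x (L : R[i]) :=
  is_derive x (vec i) (fun y => Re (f y)) (Re L) /\
  is_derive x (vec i) (fun y => Im (f y)) (Im L).

Lemma has_cpartialE i f x L : has_cpartial i f x L -> cpartial i f x = L.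
Proof. by move=> [d1 d2]; apply: complexP => /=; exact: derive_val. Qed.

Lemma cderivable_has f : cderivable f <-> forall i x, has_cpartial i f x (cpartial i f x).
Proof.
split=> [H i x|H i x]; last by have [d1 d2] := H i x; split; exact: ex_derive.
by have [d1 d2] := H i x; split; exact: derivableP.
Qed.

Lemma has_cpartialD i f g x a b : has_cpartial i f x a -> has_cpartial i g x b ->
  has_cpartial i (fun x => f x + g x) x (a + b).
Proof.
move=> [f1 f2] [g1 g2]; split.
  by under eq_fun do rewrite ReD; rewrite ReD; exact: is_deriveD.
by under eq_fun do rewrite ImD; rewrite ImD; exact: is_deriveD.
Qed.

Let is_derive_mul (p q : E -> R) x v a b : is_derive x v p a -> is_derive x v q b ->
  is_derive x v (fun x => p x * q x) (a * q x + p x * b).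
Proof.
move=> dp dq; have := is_deriveM dp dq.
rewrite (_ : p * q = (fun t => p t * q t))// => H.
by apply: (is_derive_eq H); rewrite /GRing.scale/=; ring.
Qed.

Lemma has_cpartialM i f g x a b : has_cpartial i f x a -> has_cpartial i g x b ->
  has_cpartial i (fun x => f x * g x) x (a * g x + f x * b).
Proof.
move=> [f1 f2] [g1 g2]; split.
  under eq_fun do rewrite ReM.
  apply: (is_derive_eq (is_deriveB (is_derive_mul f1 g1) (is_derive_mul f2 g2))).
  by rewrite ReD !ReM; ring.
under eq_fun do rewrite ImM.
apply: (is_derive_eq (is_deriveD (is_derive_mul f1 g2) (is_derive_mul f2 g1))).
by rewrite ImD !ImM; ring.
Qed.

Lemma has_cpartial_cst i (c : R[i]) x : has_cpartial i (fun=> c) x 0.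
Proof. by split; exact: is_derive_cst. Qed.

Lemma quadratic_has_cpartial i f x L (C : R) :
  (forall h : R, normc (f (h *: vec i + x) - f x - h%:C * L) <= C * h ^+ 2) ->
  has_cpartial i f x L.
Proof.
move=> H; split; apply: (quadratic_is_derive (C := C)) => h; rewrite (le_trans _ (H h))//.
  by rewrite (le_trans _ (ler_Re_normc _))// !ReD !ReN ReM/= mul0r subr0.
by rewrite (le_trans _ (ler_Im_normc _))// !ImD !ImN ImM/= mul0r addr0.
Qed.

(* Coinduction principle: a class of C^1 functions stable under partial derivatives
   consists of smooth functions. *)
Lemma smooth_coind (S : set (E -> R[i])) :
  (forall f, S f -> [/\ ccont f, cderivable f & forall i, S (cpartial i f)]) ->
  forall f, S f -> smooth f.
Proof.
move=> HS f Sf s.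
have Ss : S (cpartials s f).
  by elim: s => [|i s IH] //=; have [_ _ H] := HS _ IH; exact: H.
have [c dd _] := HS _ Ss; split; first exact/ccontP.
  by move=> i x; exact: (dd i x).1.
by move=> i x; exact: (dd i x).2.
Qed.

Lemma cpartials_cat s t f : cpartials s (cpartials t f) = cpartials (s ++ t) f.
Proof. by rewrite /cpartials foldr_cat. Qed.

Lemma smooth_cpartials s f : smooth f -> smooth (cpartials s f).
Proof. by move=> sf t; rewrite cpartials_cat; exact: sf. Qed.

Lemma smooth_ccont f : smooth f -> ccont f.
Proof. by move=> /(_ [::])[/ccontP]. Qed.

Lemma smooth_cderivable f : smooth f -> cderivable f.
Proof. by move=> /(_ [::])[_ d1 d2] i x; split; [exact: d1|exact: d2]. Qed.

Lemma smooth_has f i x : smooth f -> has_cpartial i f x (cpartial i f x).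
Proof. by move=> /smooth_cderivable/cderivable_has; exact. Qed.

(* All the ways of distributing the derivatives in [s] over the two factors of a
   product. *)
Fixpoint splits (s : seq 'I_d) : seq (seq 'I_d * seq 'I_d) :=
  if s is i :: s' then
    [seq (i :: p.1, p.2) | p <- splits s'] ++ [seq (p.1, i :: p.2) | p <- splits s']
  else [:: ([::], [::])].

Lemma has_cpartial_sum (I : Type) (s : seq I) (F G : I -> E -> R[i]) i x :
  (forall j, has_cpartial i (F j) x (G j x)) ->
  has_cpartial i (fun x => \sum_(j <- s) F j x) x (\sum_(j <- s) G j x).
Proof.
move=> H; elim: s => [|j s IH].
  by under eq_fun do rewrite big_nil; rewrite big_nil; exact: has_cpartial_cst.
by under eq_fun do rewrite big_cons; rewrite big_cons; exact: has_cpartialD.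
Qed.

Lemma cpartials_mul s f g : smooth f -> smooth g ->
  cpartials s (fun x => f x * g x) =
  fun x => \sum_(p <- splits s) cpartials p.1 f x * cpartials p.2 g x.
Proof.
move=> sf sg; elim: s => [|i s IH].
  by apply/funext => x; rewrite big_seq1.
apply/funext => x; rewrite /= IH; apply: has_cpartialE.
rewrite big_cat/= !big_map -big_split/=.
apply: (@has_cpartial_sum _ _ _ (fun p x => cpartial i (cpartials p.1 f) x * cpartials p.2 g x
   + cpartials p.1 f x * cpartial i (cpartials p.2 g) x) _ _) => p.
by apply: has_cpartialM; apply: smooth_has; exact: smooth_cpartials.
Qed.

Lemma smoothM f g : smooth f -> smooth g -> smooth (fun x => f x * g x).
Proof.
move=> sf sg s; rewrite cpartials_mul//.
have c t (h : E -> R[i]) : smooth h -> ccont (cpartials t h : E -> R[i]).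
  by move=> sh; apply: smooth_ccont; exact: smooth_cpartials.
have H i x : has_cpartial i (fun x => \sum_(p <- splits s) cpartials p.1 f x * cpartials p.2 g x) x
   (\sum_(p <- splits s) (cpartial i (cpartials p.1 f) x * cpartials p.2 g x
   + cpartials p.1 f x * cpartial i (cpartials p.2 g) x)).
  apply: (@has_cpartial_sum _ _ _ (fun p x => cpartial i (cpartials p.1 f) x * cpartials p.2 g x
     + cpartials p.1 f x * cpartial i (cpartials p.2 g) x) _ _) => p.
  by apply: has_cpartialM; apply: smooth_has; exact: smooth_cpartials.
split.
- apply/ccontP; apply: ccont_sum => p; apply: ccontM; exact: c.
- by move=> i x; have [h _] := H i x; exact: ex_derive.
- by move=> i x; have [_ h] := H i x; exact: ex_derive.
Qed.

Lemma cpartials_outside (K : set E) f s : closed K -> (forall x, ~ K x -> f x = 0) ->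
  forall x, ~ K x -> cpartials s f x = 0.
Proof.
move=> cK f0; elim: s => [//|i s IH] x Kx /=.
apply: has_cpartialE.
have n0 : \forall y \near x, cpartials s f y = 0.
  have : nbhs x (~` K) by apply: open_nbhs_nbhs; split => //; exact: closed_openC.
  by apply: filterS => y; exact: IH.
split; apply: (near_eq_is_derive (f := fun=> 0)); try exact: is_derive_cst.
  by move: n0; apply: filterS => y ->.
by move: n0; apply: filterS => y ->.
Qed.

End smooth_functions.

Section fourier_smooth.
Variables (R : realType) (d : nat).
Local Notation E := 'rV[R]_d.
Local Notation leb := (lebesgue_rV R d).
Local Notation vec i := (delta_mx ord0 i : E).
Implicit Types f g th : E -> R[i].

Lemma edotxx (x : E) : edot x x = enorm x ^+ 2.
Proof.
by rewrite /enorm sqr_sqrtr// sumr_ge0// => i _; rewrite -expr2 sqr_ge0.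
Qed.

Lemma enorm_ge0 (x : E) : 0 <= enorm x. Proof. exact: sqrtr_ge0. Qed.

Lemma coord_le_enorm (x : E) i : `|x ord0 i| <= enorm x.
Proof.
rewrite -(@ler_pXn2r _ 2) ?nnegrE ?enorm_ge0// real_normK ?num_real// -edotxx.
rewrite /edot (bigD1 i)//= -expr2 lerDl sumr_ge0// => j _.
by rewrite -expr2 sqr_ge0.
Qed.

Lemma measurable_enorm : measurable_fun setT (@enorm R d).
Proof.
apply: (measurableT_comp (f := @Num.sqrt R)).
  by apply: continuous_measurable_fun; exact: sqrt_continuous.
apply: measurable_sum => i; apply: measurable_funM; exact: measurable_rV_coord.
Qed.

(** Decay without smoothness. The class contains the Schwartz functions and is stable under
    multiplication by monomials, which is what differentiating the transform does to [th]. *)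
Definition rapid th := cmeas th /\
  forall j : nat, exists M : R, forall x, enorm x ^+ j * normc (th x) <= M.

(** The inverse of the weight is at most (1 + |x|^2)^d <= 2^d (1 + |x|^(2d)), so the decay bounds of
    orders 0 and 2d suffice. *)
Lemma rapid_cauchy_weight th : rapid th ->
  exists M : R, forall x, normc (th x) <= M * cauchy_weight x.
Proof.
move=> [_ bth]; have [M0 h0] := bth 0%N; have [M1 h1] := bth (2 * d)%N.
exists (2 ^+ d * (M0 + M1)) => x.
have P : \prod_(i < d) (1 + (1 * (x ord0 i - 0)) ^+ 2) <= 2 ^+ d * (1 + enorm x ^+ (2 * d)).
  apply: (@le_trans _ _ (\prod_(i < d) (1 + enorm x ^+ 2))).
    apply: ler_prod => i _; rewrite mul1r subr0 addr_ge0 ?sqr_ge0//= lerD2l.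
    by rewrite -(real_normK (num_real (x ord0 i))) ler_pXn2r ?nnegrE ?enorm_ge0// coord_le_enorm.
  rewrite prodr_const card_ord exprM.
  have e0 : 0 <= enorm x ^+ 2 by exact: sqr_ge0.
  have [e1|e1] := leP (enorm x ^+ 2) 1.
    apply: (@le_trans _ _ (2 ^+ d)); last by rewrite ler_peMr ?exprn_ge0// lerDl exprn_ge0.
    by apply: lerXn2r; rewrite ?nnegrE; lra.
  apply: (@le_trans _ _ ((2 * enorm x ^+ 2) ^+ d)).
    by apply: lerXn2r; rewrite ?nnegrE; lra.
  by rewrite exprMn ler_wpM2l ?exprn_ge0// lerDr.
have w : cauchy_weight x * \prod_(i < d) (1 + (1 * (x ord0 i - 0)) ^+ 2) = 1.
  rewrite -big_split/= big1// => i _; rewrite mulVf// gt_eqF//.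
  by rewrite ltr_pwDl// sqr_ge0.
have w0 := cauchy_weight_gt0 x.
rewrite -[leLHS]mulr1 -[X in _ * X]w [cauchy_weight x * _]mulrC mulrA ler_pM2r//.
apply: (@le_trans _ _ (normc (th x) * (2 ^+ d * (1 + enorm x ^+ (2 * d))))).
  by rewrite ler_wpM2l ?normc_ge0.
rewrite mulrCA ler_wpM2l ?exprn_ge0// mulrDr mulr1 mulrC lerD//.
  by have := h0 x; rewrite expr0 mul1r.
Qed.

Lemma rapid_cintegrable th : rapid th -> cintegrable leb th.
Proof.
move=> rth; have [M hM] := rapid_cauchy_weight rth.
apply: (cintegrable_le rth.1 _ hM).
exact: (integrableZl measurableT M (integrable_cauchy_weight R d)).
Qed.

Lemma rapidM th (m : E -> R[i]) (C : R) k : rapid th -> cmeas m ->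
  (forall x, normc (m x) <= C * enorm x ^+ k) -> rapid (fun x => m x * th x).
Proof.
move=> [mth bth] mm mC; split; first exact: cmeasM.
move=> j; have [M hM] := bth (j + k)%N.
exists (`|C| * M) => x; rewrite normcM mulrA.
apply: (@le_trans _ _ (enorm x ^+ j * (`|C| * enorm x ^+ k) * normc (th x))).
  rewrite ler_wpM2r ?normc_ge0// ler_wpM2l ?exprn_ge0 ?enorm_ge0//.
  by rewrite (le_trans (mC x))// ler_wpM2r ?exprn_ge0 ?enorm_ge0// ler_norm.
rewrite mulrCA -!mulrA ler_wpM2l// mulrA -exprD; exact: hM.
Qed.

(** The factor -2 pi i x_i that differentiation in y_i brings down from the kernel e^(-2 pi i
    x.y). *)
Definition dfactor (i : 'I_d) (x : E) : R[i] := 0 -i* (2 * pi * x ord0 i).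
Definition monomial (s : seq 'I_d) (x : E) : R[i] := \prod_(i <- s) dfactor i x.

Lemma cmeas_dfactor i : cmeas (dfactor i).
Proof.
split => /=; first exact: measurable_cst.
apply: measurable_funN; apply: measurable_funM; first exact: measurable_cst.
exact: measurable_rV_coord.
Qed.

Lemma normc_dfactor i x : normc (dfactor i x) = 2 * pi * `|x ord0 i|.
Proof.
rewrite /dfactor /= expr0n/= add0r sqrrN sqrtr_sqr normrM ger0_norm//.
by rewrite mulr_ge0 ?pi_ge0.
Qed.

Lemma normc_dfactor_le i x : normc (dfactor i x) <= 2 * pi * enorm x.
Proof. by rewrite normc_dfactor ler_wpM2l ?mulr_ge0 ?pi_ge0// coord_le_enorm. Qed.

Lemma cmeas_monomial s : cmeas (monomial s).
Proof. by apply: cmeas_prod => i _; exact: cmeas_dfactor. Qed.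

Lemma normc_monomial_le s x : normc (monomial s x) <= (2 * pi) ^+ size s * enorm x ^+ size s.
Proof.
elim: s => [|i s IH].
  by rewrite /monomial big_nil !expr0 mulr1 ComplexField.Normc.normc1.
rewrite /monomial big_cons normcM /=.
rewrite [leRHS](_ : _ = (2 * pi * enorm x) * ((2 * pi) ^+ size s * enorm x ^+ size s)).
  by apply: ler_pM; rewrite ?normc_ge0 ?normc_dfactor_le.
by rewrite !exprS; ring.
Qed.

Lemma rapid_monomial s th : rapid th -> rapid (fun x => monomial s x * th x).
Proof.
move=> rth; apply: (rapidM rth (cmeas_monomial s) (k := size s)).
exact: normc_monomial_le.
Qed.

Lemma rapid_dfactor i th : rapid th -> rapid (fun x => dfactor i x * th x).
Proof.
move=> rth; apply: (rapidM rth (cmeas_dfactor i) (k := 1%N) (C := 2 * pi)) => x.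
by rewrite expr1; exact: normc_dfactor_le.
Qed.

Lemma rapid_enorm_integrable k th : rapid th ->
  leb.-integrable setT (fun x => (enorm x ^+ k * normc (th x))%:E).
Proof.
move=> rth.
have r : rapid (fun x => (enorm x ^+ k)%:C * th x).
  apply: (rapidM rth (k := k) (C := 1)) => [|x].
    by apply: cmeas_real; apply: measurable_funX; exact: measurable_enorm.
  by rewrite normcR mul1r ger0_norm// exprn_ge0// enorm_ge0.
have := (rapid_cintegrable r).2.
by under eq_fun do rewrite normcM normcR ger0_norm ?exprn_ge0 ?enorm_ge0//.
Qed.

Lemma edot_vec (x y : E) (h : R) i : edot x (h *: vec i + y) = h * x ord0 i + edot x y.
Proof.
rewrite /edot; under eq_bigr do rewrite !mxE mulrDr.
rewrite big_split/=; congr (_ + _).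
rewrite (bigD1 i)//= !eqxx mulr1 big1 ?addr0 1?mulrC// => j ji.
by rewrite (negbTE ji) ?andbF !mulr0.
Qed.

(** The Taylor remainder of the kernel is at most 2 (2 pi h x_i)^2 by [normc_ce_taylor], and |x|^2
    |th| is integrable: the difference quotient has a remainder quadratic in h. *)
Lemma fourier_has_cpartial th i y : rapid th ->
  has_cpartial i (fourier th) y (fourier (fun x => dfactor i x * th x) y).
Proof.
move=> rth.
have ith := rapid_cintegrable rth.
have idth := rapid_cintegrable (rapid_dfactor i rth).
pose C := \int[leb]_x ((2 * (2 * pi) ^+ 2) * (enorm x ^+ 2 * normc (th x))).
apply: (@quadratic_has_cpartial _ _ _ _ _ _ C) => h.
rewrite !fourierE -cintB; [|exact: cintegrable_ceM|exact: cintegrable_ceM].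
rewrite -cintZ; last exact: cintegrable_ceM.
rewrite -cintB; last 2 first.
- have := cintegrableD (cintegrable_ceM (2 * pi) (h *: vec i + y) ith) (cintegrableZ (-1) (cintegrable_ceM (2 * pi) y ith)).
  by under eq_fun do rewrite mulN1r.
- by apply: cintegrableZ; exact: cintegrable_ceM.
have Fx x : ce (2 * pi * edot x (h *: vec i + y)) * th x - ce (2 * pi * edot x y) * th x -
    h%:C * (ce (2 * pi * edot x y) * (dfactor i x * th x)) =
    ce (2 * pi * edot x y) * ((ce (2 * pi * h * x ord0 i) - 1 + 0 +i* (2 * pi * h * x ord0 i)) * th x).
  rewrite edot_vec mulrDr ceD.
  have -> : 2 * pi * (h * x ord0 i) = 2 * pi * h * x ord0 i by ring.
  have -> : h%:C * (ce (2 * pi * edot x y) * (dfactor i x * th x)) =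
     ce (2 * pi * edot x y) * ((h%:C * dfactor i x) * th x) by ring.
  have -> : h%:C * dfactor i x = - (0 +i* (2 * pi * h * x ord0 i)).
    by apply: complexP; rewrite /= ?ReM ?ImM/=; ring.
  by ring.
under eq_cint do rewrite Fx.
have ii : leb.-integrable setT (fun x : E => (2 * (2 * pi) ^+ 2 * (enorm x ^+ 2 * normc (th x)))%:E).
  exact: (integrableZl measurableT _ (rapid_enorm_integrable 2 rth)).
have iG : leb.-integrable setT (fun x : E => (h ^+ 2 * (2 * (2 * pi) ^+ 2 * (enorm x ^+ 2 * normc (th x))))%:E).
  exact: (integrableZl measurableT _ ii).
have bG x : normc (ce (2 * pi * edot x y) * ((ce (2 * pi * h * x ord0 i) - 1 + 0 +i* (2 * pi * h * x ord0 i)) * th x))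
    <= h ^+ 2 * (2 * (2 * pi) ^+ 2 * (enorm x ^+ 2 * normc (th x))).
  rewrite !normcM normc_ce mul1r.
  apply: (@le_trans _ _ (2 * (2 * pi * h * x ord0 i) ^+ 2 * normc (th x))).
    by rewrite ler_wpM2r ?normc_ge0// normc_ce_taylor.
  have -> : 2 * (2 * pi * h * x ord0 i) ^+ 2 = h ^+ 2 * (2 * (2 * pi) ^+ 2) * x ord0 i ^+ 2 by ring.
  rewrite [leRHS](_ : _ = h ^+ 2 * (2 * (2 * pi) ^+ 2) * enorm x ^+ 2 * normc (th x)); last by ring.
  rewrite ler_wpM2r ?normc_ge0// ler_wpM2l//.
    by apply: mulr_ge0; [exact: sqr_ge0|apply: mulr_ge0 => //; exact: sqr_ge0].
  by rewrite -(real_normK (num_real (x ord0 i))) ler_pXn2r ?nnegrE ?enorm_ge0// coord_le_enorm.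
have iF : cintegrable leb (fun x => ce (2 * pi * edot x y) *
    ((ce (2 * pi * h * x ord0 i) - 1 + 0 +i* (2 * pi * h * x ord0 i)) * th x)).
  apply: (cintegrable_le _ iG bG).
  apply: cmeasM; first exact: cmeas_ce_edotl.
  apply: cmeasM; last exact: rth.1.
  have mx : measurable_fun setT (fun x : E => 2 * pi * h * x ord0 i).
    by apply: measurable_funM; [exact: measurable_cst|exact: measurable_rV_coord].
  apply: cmeasD; first by apply: cmeasB; [exact: measurable_ce|exact: cmeas_cst].
  by split => //=; exact: measurable_cst.
rewrite (le_trans (normc_cint iF))// /C [leRHS]mulrC -RintegralZl//.
apply: le_Rintegral => //; exact: iF.2.
Qed.

(** [smooth] asks for joint continuity, which directional derivatives do not give. *)
Lemma fourier_lipschitz th : rapid th -> exists C : R,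
  forall y z : E, normc (fourier th y - fourier th z) <= C * `|y - z|.
Proof.
move=> rth; have ith := rapid_cintegrable rth.
exists (\int[leb]_x ((4 * pi * d%:R) * (enorm x ^+ 1 * normc (th x)))) => y z.
rewrite !fourierE -cintB; [|exact: cintegrable_ceM|exact: cintegrable_ceM].
have Fx x : ce (2 * pi * edot x y) * th x - ce (2 * pi * edot x z) * th x =
    ce (2 * pi * edot x z) * ((ce (2 * pi * edot x (y - z)) - 1) * th x).
  have -> : edot x y = edot x z + edot x (y - z).
    rewrite /edot -big_split/=; apply: eq_bigr => i _; rewrite !mxE; ring.
  by rewrite mulrDr ceD; ring.
under eq_cint do rewrite Fx.
have ii : leb.-integrable setT (fun x : E => (4 * pi * d%:R * (enorm x ^+ 1 * normc (th x)))%:E).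
  exact: (integrableZl measurableT _ (rapid_enorm_integrable 1 rth)).
have iG : leb.-integrable setT (fun x : E => (`|y - z| * (4 * pi * d%:R * (enorm x ^+ 1 * normc (th x))))%:E).
  exact: (integrableZl measurableT _ ii).
have ed x : `|edot x (y - z)| <= d%:R * enorm x * `|y - z|.
  rewrite /edot (le_trans (ler_norm_sum _ _ _))//.
  rewrite (@le_trans _ _ (\sum_(i < d) enorm x * `|y - z|))//.
    by apply: ler_sum => i _; rewrite normrM ler_pM// ?coord_le_enorm// norm_coord_le.
  by rewrite sumr_const card_ord -[leLHS]mulr_natl mulrA.
have bG x : normc (ce (2 * pi * edot x z) * ((ce (2 * pi * edot x (y - z)) - 1) * th x))
    <= `|y - z| * (4 * pi * d%:R * (enorm x ^+ 1 * normc (th x))).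
  rewrite !normcM normc_ce mul1r.
  apply: (@le_trans _ _ (2 * `|2 * pi * edot x (y - z)| * normc (th x))).
    by rewrite ler_wpM2r ?normc_ge0// normc_ce_sub1.
  rewrite expr1 !mulrA ler_wpM2r ?normc_ge0// normrM (ger0_norm (_ : 0 <= 2 * pi)) ?mulr_ge0 ?pi_ge0//.
  have -> : `|y - z| * 4 * pi * d%:R * enorm x = 2 * (2 * pi) * (d%:R * enorm x * `|y - z|) by ring.
  rewrite [leLHS](_ : _ = 2 * (2 * pi) * `|edot x (y - z)|); last by ring.
  by rewrite ler_wpM2l// !mulr_ge0 ?pi_ge0.
have iF : cintegrable leb (fun x => ce (2 * pi * edot x z) * ((ce (2 * pi * edot x (y - z)) - 1) * th x)).
  apply: (cintegrable_le _ iG bG).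
  apply: cmeasM; first exact: cmeas_ce_edotl.
  apply: cmeasM; last exact: rth.1.
  by apply: cmeasB; [exact: cmeas_ce_edotl|exact: cmeas_cst].
rewrite (le_trans (normc_cint iF))// [leRHS]mulrC -RintegralZl//.
apply: le_Rintegral => //; exact: iF.2.
Qed.

Lemma lipschitz_ccont f (C : R) : (forall y z : E, normc (f y - f z) <= C * `|y - z|) -> ccont f.
Proof.
move=> H.
have L (p : E -> R) : (forall y z, `|p y - p z| <= C * `|y - z|) -> continuous p.
  move=> Hp x; apply/(@cvgrPdist_le _ _ _ (nbhs x) (nbhs_filter x)) => e e0; near=> y.
  have C0 : 0 < `|C| + 1 by rewrite ltr_wpDl.
  have he : `|x - y| <= e / (`|C| + 1).
    near: y; apply/nbhs_ballP; exists (e / (`|C| + 1)); first by rewrite /= divr_gt0.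
    by move=> z; rewrite -ball_normE /= => /ltW.
  rewrite (le_trans (Hp x y))//; rewrite ler_pdivlMr// in he.
  rewrite mulrC (le_trans _ he)// ler_wpM2l//.
  by rewrite (le_trans (ler_norm _))// lerDl.
split; apply: L => y z; rewrite (le_trans _ (H y z))//.
  by rewrite (le_trans _ (ler_Re_normc _))// ReD ReN.
by rewrite (le_trans _ (ler_Im_normc _))// ImD ImN.
Unshelve. all: by end_near. Qed.

Lemma fourier_cderivable th : rapid th -> cderivable (fourier th).
Proof.
by move=> rth i x; have [h1 h2] := fourier_has_cpartial i x rth; split; exact: ex_derive.
Qed.

Lemma cpartial_fourier th i : rapid th ->
  cpartial i (fourier th) = fourier (fun x => dfactor i x * th x).
Proof.
by move=> rth; apply/funext => y; apply: has_cpartialE; exact: fourier_has_cpartial.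
Qed.

Lemma smooth_fourier th : rapid th -> smooth (fourier th).
Proof.
move=> rth; apply: (@smooth_coind _ _ [set f | exists2 t, rapid t & f = fourier t]); last by exists th.
move=> f [t rt ->]; split.
- by have [C hC] := fourier_lipschitz rt; exact: lipschitz_ccont hC.
- exact: fourier_cderivable.
- move=> i; exists (fun x => dfactor i x * t x); first exact: rapid_dfactor.
  exact: cpartial_fourier.
Qed.

Lemma cpartials_fourier th s : rapid th ->
  cpartials s (fourier th) = fourier (fun x => monomial s x * th x).
Proof.
move=> rth; elim: s => [|i s IH] /=.
  by congr fourier; apply/funext => x; rewrite /monomial big_nil mul1r.
rewrite IH cpartial_fourier; last exact: rapid_monomial.
by congr fourier; apply/funext => x; rewrite /monomial big_cons mulrA.
Qed.

Lemma schwartz_rapid th : schwartz th -> rapid th.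
Proof.
move=> [sth bth]; split; first by apply: ccont_cmeas; exact: smooth_ccont.
by move=> j; have [M hM] := bth j [::]; exists M.
Qed.

End fourier_smooth.

(** * Smooth bump functions *)

Section flat_functions.
Variable R : realType.
Implicit Type P : {poly R}.

(** All derivatives of e^(-1/t), extended by 0, have the form P(1/t) e^(-1/t). With the polynomial
    as a parameter the family is closed under differentiation, as [smooth_coind] demands. *)
Definition flat P (t : R) : R := if 0 < t then P.[t^-1] * expR (- t^-1) else 0.

Lemma horner_le_expR P : exists C : R, forall u, 0 <= u -> `|P.[u]| <= C * expR u.
Proof.
exists (\sum_(i < size P) `|P`_i| * i`!%:R) => u u0.
rewrite horner_coef (le_trans (ler_norm_sum _ _ _))// mulr_suml.
apply: ler_sum => i _; rewrite normrM -mulrA ler_wpM2l// ger0_norm ?exprn_ge0//.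
case: (nat_of_ord i) => [|n].
  by rewrite expr0 fact0 mul1r (le_trans _ (expR_ge1Dx u))// lerDl.
have f0 : 0 < n.+1`!%:R :> R by rewrite ltr0n fact_gt0.
rewrite -ler_pdivrMl// mulrC (le_trans _ (expR_ge1Dxn n u0))// lerDr//.
Qed.

(** For u = 1/t, the exponential dominates u^2 P(u), hence |P(u)| e^(-u) <= C t^2. This gives the
    derivative 0 at the junction t = 0. *)
Lemma flat_quadratic P : exists C : R, forall t, `|flat P t| <= C * t ^+ 2.
Proof.
have [C HC] := horner_le_expR (P * 'X^2).
have C0 : 0 <= C.
  by have := HC 0 (lexx 0); rewrite expR0 mulr1; apply: le_trans.
exists C => t; rewrite /flat; case: ifPn => t0; last by rewrite normr0 mulr_ge0// sqr_ge0.
have u0 : 0 <= t^-1 by rewrite invr_ge0 ltW.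
have := HC _ u0; rewrite hornerM hornerXn normrM (ger0_norm (sqr_ge0 _)) => h.
rewrite normrM expRN [X in _ * X]ger0_norm ?invr_ge0 ?expR_ge0// ler_pdivrMr ?expR_gt0//.
rewrite mulrAC -ler_pdivrMr ?exprn_gt0//.
by rewrite -exprVn.
Qed.

Definition flat_deriv P : {poly R} := 'X^2 * (P - P^`()).

Lemma flat_is_derive P (t : R) : is_derive t (1 : R) (flat P) (flat (flat_deriv P) t).
Proof.
have [t0|t0|->] := ltgtP t 0.
- rewrite {2}/flat ltNge (ltW t0)/=.
  apply: (near_eq_is_derive (f := fun=> 0)) (is_derive_cst _ _ _).
  have : nbhs t [set s | s < 0] by apply: open_nbhs_nbhs; split => //; exact: open_lt.
  by apply: filterS => s /= s0; rewrite /flat ltNge (ltW s0).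
- rewrite {2}/flat t0.
  have dV : is_derive t (1 : R) (fun s : R => s^-1) (- t ^- 2).
    have tn0 : id t != 0 by rewrite gt_eqF.
    have did : derivable (id : R -> R) t 1 by exact: derivable_id.
    apply: DeriveDef; first exact: derivableV.
    by rewrite deriveV// derive_id /GRing.scale/= mulr1.
  have dP : is_derive t (1 : R) (fun s : R => P.[s^-1]) (- t ^- 2 * P^`().[t^-1]).
    exact: (derive_comp dV (is_derive_poly P _)).
  have dE : is_derive t (1 : R) (fun s : R => expR (- s^-1)) (t ^- 2 * expR (- t^-1)).
    apply: (is_derive_eq (derive_comp (is_deriveN dV) (is_derive_expR _))).
    by rewrite opprK.
  have dF : is_derive t (1 : R) (fun s : R => P.[s^-1] * expR (- s^-1))
      ((flat_deriv P).[t^-1] * expR (- t^-1)).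
    apply: (is_derive_eq (derive_mul dP dE)).
    by rewrite /flat_deriv hornerM hornerXn hornerD hornerN exprVn; ring.
  apply: (near_eq_is_derive _ dF).
  have : nbhs t [set s | 0 < s] by apply: open_nbhs_nbhs; split => //; exact: open_gt.
  by apply: filterS => s /= s0; rewrite /flat s0.
- rewrite [X in is_derive _ _ _ X](_ : _ = 0); last by rewrite /flat ltxx.
  have [C HC] := flat_quadratic P.
  apply: (@quadratic_is_derive _ _ _ _ _ _ C) => h.
  by rewrite mulr0 subr0 /GRing.scale/= mulr1 addr0 {2}/flat ltxx subr0.
Qed.

Lemma flat_continuous P : continuous (flat P).
Proof. exact: derive_continuous (flat_is_derive P). Qed.

Lemma flatZ (a : R) P t : flat (a *: P) t = a * flat P t.
Proof. by rewrite /flat; case: ifPn => _; rewrite ?mulr0// hornerZ mulrA. Qed.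

Lemma flat0 t : flat 0 t = 0.
Proof. by rewrite /flat; case: ifPn => // _; rewrite horner0 mul0r. Qed.

Lemma flat1_ge0 t : 0 <= flat 1 t.
Proof. by rewrite /flat; case: ifPn => // _; rewrite hornerC mul1r expR_ge0. Qed.

Lemma flat1_gt0 t : (0 < flat 1 t) = (0 < t).
Proof. by rewrite /flat; case: ifPn; rewrite ?ltxx// hornerC mul1r expR_gt0. Qed.

End flat_functions.

Section bumps.
Variables (R : realType) (d : nat).
Local Notation E := 'rV[R]_d.
Local Notation vec i := (delta_mx ord0 i : E).

(** Coinduction on the family obtained by varying the polynomial. The derivatives in the other
    coordinates vanish and are written with [flat 0] to remain in it. *)
Lemma smooth_flat_coord (i : 'I_d) (a c : R) (P : {poly R}) :
  smooth (fun x : E => (flat P (a * x ord0 i + c))%:C).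
Proof.
have d1 (Q : {poly R}) (j : 'I_d) (x : E) :
    has_cpartial j (fun x : E => (flat Q (a * x ord0 i + c))%:C) x
      (if j == i then flat (a *: flat_deriv Q) (a * x ord0 i + c) else flat 0 (a * x ord0 i + c))%:C.
  split => /=; last exact: is_derive_cst.
  (* Restriction to the line through x in direction j; its difference quotient is that of the
     function on R^d. *)
  pose k (h : R) : R := flat Q (a * (h * (j == i)%:R + x ord0 i) + c).
  pose L : R := a * (j == i)%:R * flat (flat_deriv Q) (a * x ord0 i + c).
  have dk : is_derive (0 : R) (1 : R) k L.
    have dl : is_derive (0 : R) (1 : R) (fun h : R => a * (h * (j == i)%:R + x ord0 i) + c) (a * (j == i)%:R).
      apply: (is_derive_eq (derive_add (derive_mul (is_derive1_cst a 0) (derive_add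
        (derive_mul (is_derive1_id 0) (is_derive1_cst (j == i)%:R 0)) (is_derive1_cst (x ord0 i) 0))) (is_derive1_cst c 0))).
      by ring.
    have := derive_comp dl (flat_is_derive Q _); rewrite mul0r add0r; exact.
  have -> : (if j == i then flat (a *: flat_deriv Q) (a * x ord0 i + c)
      else flat 0 (a * x ord0 i + c)) = L.
    by rewrite /L; case: eqP => _; rewrite ?mulr1 ?mulr0 ?mul0r ?flat0// flatZ.
  have kE (h : R) : flat Q (a * (h *: vec j + x) ord0 i + c) = k h.
    by rewrite /k !mxE eqxx/= eq_sym.
  have k0 : k 0 = flat Q (a * x ord0 i + c) by rewrite /k mul0r add0r.
  have [+ kL] := dk; rewrite /derivable => ck.
  have E1 : (fun h : R => h^-1 *: ((k \o shift 0) (h *: (1 : R)) - k 0)) =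
      (fun h : R => h^-1 *: (((fun y : E => flat Q (a * y ord0 i + c)) \o shift x) (h *: vec j)
        - flat Q (a * x ord0 i + c))).
    apply/funext => h; congr (_ *: (_ - _)) => //.
    by rewrite /= -/(h *: vec j + x) kE /GRing.scale/= mulr1 addr0.
  apply: DeriveDef; first by rewrite /derivable -E1.
  by rewrite -kL /derive E1.
apply: (@smooth_coind _ _ [set f | exists Q, f = fun x : E => (flat Q (a * x ord0 i + c))%:C]); last by exists P.
move=> f [Q ->]; split.
- split => /=; last exact: cst_continuous.
  move=> x; apply: (@continuous_comp _ _ _ (fun x : E => a * x ord0 i + c) (flat Q)); last exact: flat_continuous.
  exact: (cvgD (cvgM (cvg_cst a) (@coord_continuous R 1 d ord0 i x)) (cvg_cst c)).
- by move=> j x; have [h1 h2] := d1 Q j x; split; exact: ex_derive.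
- move=> j; exists (if j == i then a *: flat_deriv Q else 0).
  apply/funext => x; rewrite (has_cpartialE (d1 Q j x)).
  by case: eqP.
Qed.

Lemma smooth_cst (c : R[i]) : smooth (fun _ : E => c).
Proof.
apply: (@smooth_coind _ _ [set f | exists c, f = fun _ : E => c]); last by exists c.
move=> f [b ->]; split.
- exact: ccont_cst.
- by move=> i x; split => /=; exact: derivable_cst.
- by move=> i; exists 0; apply/funext => x; apply: has_cpartialE; exact: has_cpartial_cst.
Qed.

Lemma smooth_prod (I : Type) (s : seq I) (F : I -> E -> R[i]) :
  (forall i, smooth (F i)) -> smooth (fun x => \prod_(i <- s) F i x).
Proof.
move=> sF; elim: s => [|i s IH].
  by under eq_fun do rewrite big_nil; exact: smooth_cst.
by under eq_fun do rewrite big_cons; exact: smoothM.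
Qed.

(** Each coordinate contributes one factor for either end of the interval ]c_i - r, c_i + r[; the
    coefficients 1 and -1 fit [smooth_flat_coord]. *)
Definition bump (c : E) (r : R) (x : E) : R :=
  \prod_(i < d) (flat 1 (1 * x ord0 i + (r - c ord0 i)) * flat 1 (-1 * x ord0 i + (r + c ord0 i))).

Lemma smooth_bump c r : smooth (fun x => (bump c r x)%:C).
Proof.
rewrite /bump; under eq_fun do rewrite real_complex_prod.
apply: smooth_prod => i; under eq_fun do rewrite rmorphM.
by apply: smoothM; exact: smooth_flat_coord.
Qed.

Lemma bump_ge0 c r x : 0 <= bump c r x.
Proof. by apply: prodr_ge0 => i _; rewrite mulr_ge0// flat1_ge0. Qed.

Lemma bump_gt0P c r x : 0 < r -> (0 < bump c r x) = (`|x - c| < r).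
Proof.
move=> r0; apply/idP/idP => [b0|xc].
  apply: rV_norm_lt => // i; rewrite !mxE.
  have : bump c r x != 0 by rewrite gt_eqF.
  move=> /prodf_neq0/(_ i isT); rewrite mulf_eq0 negb_or => /andP[h1 h2].
  have : 0 < flat 1 (1 * x ord0 i + (r - c ord0 i)) by rewrite lt0r h1 flat1_ge0.
  have : 0 < flat 1 (-1 * x ord0 i + (r + c ord0 i)) by rewrite lt0r h2 flat1_ge0.
  by rewrite !flat1_gt0 ltr_norml => ? ?; apply/andP; split; lra.
apply: prodr_gt0 => i _.
have := le_lt_trans (norm_coord_le (x - c) i) xc; rewrite !mxE ltr_norml => /andP[? ?].
by rewrite mulr_gt0// flat1_gt0; lra.
Qed.

End bumps.

(** * Sequences tending to zero in L^2 *)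

Section L2_sequences.
Variables (R : realType) (d : nat).
Local Notation E := 'rV[R]_d.
Local Notation leb := (lebesgue_rV R d).
Implicit Types h g b : nat -> E -> R[i].

Definition sqint (f : E -> R[i]) : \bar R := (\int[leb]_x (normc (f x) ^+ 2)%:E)%E.

Lemma sqint_ge0 f : (0 <= sqint f)%E.
Proof. by apply: integral_ge0 => x _; rewrite lee_fin sqr_ge0. Qed.

Lemma measurable_sqint (f : E -> R[i]) : cmeas f -> measurable_fun setT (fun x : E => (normc (f x) ^+ 2)%:E).
Proof. by move=> mf; apply/measurable_EFinP; exact: measurable_normc2. Qed.

Lemma sqint_le (f g : E -> R[i]) (M : R) : cmeas f -> cmeas g ->
  (forall x, normc (f x) <= M * normc (g x)) -> (sqint f <= (M ^+ 2)%:E * sqint g)%E.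
Proof.
move=> mf mg fg; rewrite /sqint -ge0_integralZl//; last 3 first.
- exact: measurable_sqint.
- by move=> x _; rewrite lee_fin sqr_ge0.
- by rewrite lee_fin sqr_ge0.
apply: ge0_le_integral => //.
- by move=> x _; rewrite lee_fin sqr_ge0.
- exact: measurable_sqint.
- by apply: emeasurable_funM => //; exact: measurable_sqint.
move=> x _; rewrite -EFinM lee_fin -exprMn lerXn2r ?nnegrE ?normc_ge0//.
by rewrite (le_trans (normc_ge0 _) (fg x)).
Qed.

Lemma sqintD (f g : E -> R[i]) : cmeas f -> cmeas g ->
  (sqint (fun x => f x + g x)%R <= 2%:E * sqint f + 2%:E * sqint g)%E.
Proof.
move=> mf mg; have [Mf Mg] := (measurable_sqint mf, measurable_sqint mg).
have n0 (k : E -> R[i]) x : (0 <= (normc (k x) ^+ 2)%:E)%E by rewrite lee_fin sqr_ge0.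
rewrite /sqint -!ge0_integralZl// -ge0_integralD//; last 4 first.
- by move=> x _; rewrite -EFinM lee_fin mulr_ge0 ?sqr_ge0.
- exact: emeasurable_funM.
- by move=> x _; rewrite -EFinM lee_fin mulr_ge0 ?sqr_ge0.
- exact: emeasurable_funM.
apply: ge0_le_integral => //.
- by move=> x _; rewrite lee_fin sqr_ge0.
- by apply: measurable_sqint; exact: cmeasD.
- by apply: emeasurable_funD; exact: emeasurable_funM.
move=> x _; rewrite -!EFinM -EFinD lee_fin.
apply: (@le_trans _ _ ((normc (f x) + normc (g x)) ^+ 2)).
  by rewrite lerXn2r ?nnegrE ?addr_ge0 ?normc_ge0// ler_normcD.
by have := sqr_ge0 (normc (f x) - normc (g x)); rewrite !expr2; lra.
Qed.

Definition L2null h := (forall n, cmeas (h n)) /\ (fun n => sqint (h n)) @ \oo --> 0%E.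
Definition L2bdd h := (forall n, cmeas (h n)) /\ exists C : R, forall n, (sqint (h n) <= C%:E)%E.

Lemma squeeze0 (f g : nat -> \bar R) : (forall n, (0 <= f n)%E) ->
  (\forall n \near \oo, (f n <= g n)%E) -> g @ \oo --> 0%E -> f @ \oo --> 0%E.
Proof.
move=> f0 fg cg; apply: squeeze_cvge cg; last exact: cvg_cst.
by move: fg; apply: filterS => n fgn; rewrite f0.
Qed.

Lemma cvge0Z (c : R) (f : nat -> \bar R) : f @ \oo --> 0%E ->
  (fun n => c%:E * f n)%E @ \oo --> 0%E.
Proof. by move=> cf; rewrite -(mule0 c%:E); apply: cvgeZl. Qed.

Lemma L2null_le h g (M : R) : (forall n, cmeas (h n)) -> L2null g ->
  (\forall n \near \oo, forall x, normc (h n x) <= M * normc (g n x)) -> L2null h.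
Proof.
move=> mh [mg cg] hg; split => //; apply: (squeeze0 _ _ (cvge0Z (M ^+ 2) cg)).
  by move=> n; exact: sqint_ge0.
by move: hg; apply: filterS => n; exact: sqint_le.
Qed.

Lemma L2nullM b h (M : R) : (forall n, cmeas (b n)) -> (forall n x, normc (b n x) <= M) ->
  L2null h -> L2null (fun n x => b n x * h n x).
Proof.
move=> mb bM Lh; apply: (L2null_le _ Lh (M := M)).
  by move=> n; apply: cmeasM => //; exact: Lh.1.
by apply: nearW => n x; rewrite normcM ler_wpM2r ?normc_ge0.
Qed.

Lemma L2nullD h g : L2null h -> L2null g -> L2null (fun n x => h n x + g n x).
Proof.
move=> [mh ch] [mg cg]; split; first by move=> n; exact: cmeasD.
apply: (squeeze0 (g := fun n => (2%:E * sqint (h n) + 2%:E * sqint (g n))%E)).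
- by move=> n; exact: sqint_ge0.
- by apply: nearW => n; exact: sqintD.
by rewrite -(adde0 0%E); apply: cvgeD => //; exact: cvge0Z.
Qed.

Lemma L2null0 : L2null (fun _ _ => 0).
Proof.
split; first by move=> n; exact: cmeas_cst.
rewrite /sqint normc0 expr0n/= integral0; exact: cvg_cst.
Qed.

Lemma L2nullN h : L2null h -> L2null (fun n x => - h n x).
Proof.
move=> Lh; apply: (L2null_le _ Lh (M := 1)).
  by move=> n; apply: cmeasN; exact: Lh.1.
by apply: nearW => n x; rewrite normcN mul1r.
Qed.

Lemma L2null_sum (I : Type) (s : seq I) (P : pred I) (F : I -> nat -> E -> R[i]) :
  (forall i, P i -> L2null (F i)) -> L2null (fun n x => \sum_(i <- s | P i) F i n x).
Proof.
move=> HF; elim: s => [|i s IH].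
  rewrite (_ : (fun _ _ => _) = (fun _ _ => 0)); first exact: L2null0.
  by apply/funext => n; apply/funext => x; rewrite big_nil.
rewrite (_ : (fun _ _ => _) = (fun n x => (if P i then F i n x else 0) + \sum_(i <- s | P i) F i n x)).
  by apply: L2nullD => //; case: (boolP (P i)) => Pi; [exact: HF|exact: L2null0].
by apply/funext => n; apply/funext => x; rewrite big_cons; case: (P i); rewrite ?add0r.
Qed.

Lemma eq_L2null h g : (forall n x, h n x = g n x) -> L2null h -> L2null g.
Proof.
by move=> hg; rewrite (_ : h = g)//; apply/funext => n; apply/funext => x.
Qed.

Lemma mul_sqint_integrable (f g : E -> R[i]) : cmeas f -> cmeas g ->
  (sqint f < +oo)%E -> (sqint g < +oo)%E -> cintegrable leb (fun x => f x * g x).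
Proof.
move=> mf mg f2 g2.
have i (k : E -> R[i]) : cmeas k -> (sqint k < +oo)%E -> leb.-integrable setT (fun x => (normc (k x) ^+ 2)%:E).
  move=> mk k2; apply/integrableP; split; first exact: measurable_sqint.
  by under eq_integral do rewrite /= ger0_norm ?sqr_ge0//.
apply: (@cintegrable_le _ _ _ _ _ (fun x => normc (f x) ^+ 2 + normc (g x) ^+ 2)).
- exact: cmeasM.
- exact: (integrableD measurableT (i _ mf f2) (i _ mg g2)).
move=> x; rewrite normcM.
by have := sqr_ge0 (normc (f x) - normc (g x)); have := sqr_ge0 (normc (f x) + normc (g x)); rewrite !expr2; lra.
Qed.

Lemma normc_cint_amgm (f g : E -> R[i]) (s : R) : 0 < s -> cmeas f -> cmeas g ->
  (sqint f < +oo)%E -> (sqint g < +oo)%E ->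
  ((normc (cint leb (fun x => f x * g x)%R))%:E <= s%:E * sqint f + (s^-1)%:E * sqint g)%E.
Proof.
move=> s0 mf mg f2 g2; have ifg := mul_sqint_integrable mf mg f2 g2.
have n0 (k : E -> R[i]) x : (0 <= (normc (k x) ^+ 2)%:E)%E by rewrite lee_fin sqr_ge0.
have [Mf Mg] := (measurable_sqint mf, measurable_sqint mg).
have s1 : 0 <= s^-1 by rewrite invr_ge0 ltW.
apply: (@le_trans _ _ (\int[leb]_x normc (f x * g x))%:E).
  by rewrite lee_fin; exact: normc_cint.
rewrite /Rintegral fineK; last exact: (integrable_fin_num measurableT ifg.2).
rewrite /sqint -!ge0_integralZl ?lee_fin ?(ltW s0)// -ge0_integralD//; last 4 first.
- by move=> x _; rewrite -EFinM lee_fin mulr_ge0 ?sqr_ge0 ?ltW.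
- exact: emeasurable_funM.
- by move=> x _; rewrite -EFinM lee_fin mulr_ge0 ?sqr_ge0.
- exact: emeasurable_funM.
apply: ge0_le_integral => //.
- by move=> x _; rewrite lee_fin normc_ge0.
- by apply/measurable_EFinP; exact: measurable_normc ifg.1.
- by apply: emeasurable_funD; exact: emeasurable_funM.
move=> x _; rewrite -!EFinM -EFinD lee_fin normcM.
move: (normc (f x)) (normc (g x)) (normc_ge0 (f x)) (normc_ge0 (g x)) => a c a0 c0.
rewrite -(ler_pM2l s0) mulrDr [s * (s^-1 * _)]mulrA mulfV ?gt_eqF// mul1r.
have := sqr_ge0 (s * a - c); have := mulr_ge0 (ltW s0) (mulr_ge0 a0 c0); rewrite !expr2; nra.
Qed.

Lemma L2null_pairing h g : L2null h -> L2bdd g ->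
  (fun n => normc (cint leb (fun x => h n x * g n x))) @ \oo --> (0 : R).
Proof.
move=> [mh ch] [mg [C gC]].
have C0 : 0 <= C by rewrite -lee_fin (le_trans (sqint_ge0 _) (gC 0%N)).
apply/cvgrPdist_le => e e0.
(* The parameter is fixed by the bound C on [g] so that its share is at most e/2 for every n; only
   then is n taken large for [h]. *)
pose s : R := 2 * (C + 1) / e.
have s0 : 0 < s by rewrite divr_gt0// mulr_gt0// ltr_wpDl.
have small : \forall n \near \oo, (sqint (h n) <= (e / 2 / s)%:E)%E.
  have es0 : 0 < e / 2 / s by rewrite divr_gt0// divr_gt0.
  have : nbhs (0%E : \bar R) [set y | (y <= (e / 2 / s)%:E)%E].
    rewrite -[0%E]/(0%:E); apply: (@filterS _ _ _ [set y | (y < (e / 2 / s)%:E)%E]); first by move=> y /ltW.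
    by apply: open_nbhs_nbhs; split; [exact: open_ereal_lt_ereal|rewrite /= lte_fin].
  by move=> /ch.
move: small; apply: filterS => n hn.
rewrite sub0r normrN ger0_norm ?normc_ge0// -lee_fin.
apply: (le_trans (normc_cint_amgm s0 (mh n) (mg n) _ _)).
- by rewrite (le_lt_trans hn)// ltry.
- by rewrite (le_lt_trans (gC n))// ltry.
apply: (@le_trans _ _ (s%:E * (e / 2 / s)%:E + (s^-1)%:E * C%:E)%E).
  apply: leeD; apply: lee_wpmul2l; rewrite ?lee_fin ?invr_ge0 ?(ltW s0)//.
rewrite -!EFinM -EFinD lee_fin.
have -> : s * (e / 2 / s) = e / 2 by field; rewrite gt_eqF.
have : s^-1 * C <= e / 2.
  have C1 : 0 < C + 1 by rewrite ltr_wpDl.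
  have -> : s^-1 * C = e / 2 * (C / (C + 1)).
    by rewrite /s; field; rewrite (gt_eqF e0) (gt_eqF C1).
  rewrite ler_piMr//; first by rewrite divr_ge0// ltW.
  by rewrite ler_pdivrMr// mul1r lerDl.
lra.
Qed.

Lemma L2null_fourier h : (forall n, cintegrable leb (h n)) -> L2null h ->
  L2null (fun n => fourier (h n)).
Proof.
move=> ih [mh ch]; split; first by move=> n; exact: cmeas_fourier.
apply: (squeeze0 _ _ (cvge0Z (34 ^+ d) ch)); first by move=> n; exact: sqint_ge0.
by apply: nearW => n; exact: fourier_bessel.
Qed.

Lemma L2bdd_fourier h : (forall n, cintegrable leb (h n)) -> L2bdd h ->
  L2bdd (fun n => fourier (h n)).
Proof.
move=> ih [mh [C hC]]; split; first by move=> n; exact: cmeas_fourier.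
exists (34 ^+ d * C) => n; apply: (le_trans (fourier_bessel (ih n))).
by rewrite EFinM lee_wpmul2l//; exact: hC.
Qed.

Lemma measurable_enorm_le (rho : R) : measurable [set x : E | enorm x <= rho].
Proof.
rewrite -[X in measurable X]setTI.
have := measurable_fun_ler (@measurable_enorm R d) (measurable_cst rho : measurable_fun setT (fun _ : E => rho)).
move=> /(_ measurableT [set true]); rewrite (_ : _ @^-1` _ = [set x : E | enorm x <= rho]).
  exact.
by apply/seteqP; split.
Qed.

(** On this ball the integrable function [cauchy_weight] is at least (1 + rho^2)^-d. *)
Lemma lebesgue_enorm_le_fin (rho : R) : (leb [set x : E | (enorm x <= rho)%R] < +oo)%E.
Proof.
have mA := measurable_enorm_le rho.
have [M0|M0] := ltP rho 0.
  rewrite (_ : [set x | _] = set0) ?measure0 ?ltry// -subset0 => x /=.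
  by rewrite leNgt (lt_le_trans M0 (enorm_ge0 _)).
apply: (@le_lt_trans _ _ (\int[leb]_x (((1 + rho ^+ 2) ^+ d) * cauchy_weight x)%:E)%E).
  rewrite -(setIT [set x | _]) -integral_indic//.
  have mw : measurable_fun setT (fun x : E => ((1 + rho ^+ 2) ^+ d * cauchy_weight x)%:E).
    by apply/measurable_EFinP; apply: measurable_funM; [exact: measurable_cst|exact: measurable_cauchy_weight].
  have r0 : 0 <= 1 + rho ^+ 2 by rewrite addr_ge0// sqr_ge0.
  apply: ge0_le_integral => //.
  - by apply/measurable_EFinP; exact: measurable_indic.
  move=> x _; rewrite lee_fin indicE; case: (boolP (x \in _)) => [|_]; last first.
    by rewrite mulr_ge0 ?exprn_ge0// ltW// cauchy_weight_gt0.
  rewrite inE/= => xr; rewrite /cauchy_weight prodfV -[X in _ <= _ / X]mul1r.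
  have P0 : 0 < \prod_(i < d) (1 + (1 * (x ord0 i - 0)) ^+ 2).
    by apply: prodr_gt0 => i _; rewrite ltr_pwDl// sqr_ge0.
  rewrite mul1r ler_pdivlMr// mul1r -[in leRHS](card_ord d) -prodr_const.
  apply: ler_prod => i _; rewrite mul1r subr0 addr_ge0 ?sqr_ge0//= lerD2l.
  rewrite -(real_normK (num_real (x ord0 i))) lerXn2r ?nnegrE//.
  exact: le_trans (coord_le_enorm _ _) xr.
have := integrableZl measurableT ((1 + rho ^+ 2) ^+ d) (integrable_cauchy_weight R d).
move=> /(integrable_lty measurableT); exact.
Qed.

(* The low frequencies tend to 0 by dominated convergence, the high ones are
   damped by the multiplier. *)
Lemma L2null_multiplier b h (M B : R) : (forall n, cmeas (b n)) ->
  (forall n x, normc (b n x) <= M * (1 + enorm x)^-1) ->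
  L2bdd h -> (forall n x, normc (h n x) <= B) ->
  (forall x, (fun n => normc (h n x)) @ \oo --> (0 : R)) ->
  L2null (fun n x => b n x * h n x).
Proof.
move=> mb bM [mh [C hC]] hB h0; split; first by move=> n; exact: cmeasM.
have M0 : 0 <= M.
  have := le_trans (normc_ge0 _) (bM 0%N 0); rewrite pmulr_lge0// invr_gt0.
  by rewrite ltr_wpDr// enorm_ge0.
have C0 : 0 <= C by rewrite -lee_fin (le_trans (sqint_ge0 _) (hC 0%N)).
pose D (rho : R) := [set x : E | enorm x <= rho].
have mD rho : measurable (D rho) by exact: measurable_enorm_le.
have low (rho : R) : (fun n => \int[leb]_(x in D rho) (normc (h n x) ^+ 2)%:E)%E @ \oo --> 0%E.
  have iB : leb.-integrable (D rho) (fun _ : E => (B ^+ 2)%:E).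
    apply/integrableP; split; first exact: measurable_cst.
    by rewrite integral_cst//= lte_mul_pinfty ?lebesgue_enorm_le_fin.
  have := @dominated_cvg _ _ _ leb (D rho) (mD rho) (fun n x => (normc (h n x) ^+ 2)%:E) (fun=> 0%E) (fun=> (B ^+ 2)%:E).
  rewrite integral0; apply => //.
  - by move=> n; apply: measurable_funTS; exact: measurable_sqint.
  - move=> x _; apply: cvg_EFin; first exact: nearW.
    by have := cvgM (h0 x) (h0 x); rewrite mulr0; exact.
  - move=> n x _; rewrite /= lee_fin ger0_norm ?sqr_ge0//.
    by rewrite lerXn2r ?nnegrE ?normc_ge0// (le_trans (normc_ge0 _) (hB n x)).
have bound (rho : R) n : 0 <= rho ->
    (sqint (fun x => b n x * h n x)%R <= (M ^+ 2)%:E * \int[leb]_(x in D rho) (normc (h n x) ^+ 2)%:E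
      + ((M * (1 + rho)^-1) ^+ 2 * C)%:E)%E.
  move=> r0.
  have mbh := measurable_sqint (cmeasM (mb n) (mh n)).
  have mhn := measurable_sqint (mh n).
  have n0 (k : E -> R[i]) x : (0 <= (normc (k x) ^+ 2)%:E)%E by rewrite lee_fin sqr_ge0.
  have e1 x : 0 < 1 + enorm x by rewrite ltr_wpDr// enorm_ge0.
  rewrite /sqint -(setvU (D rho)) setUC ge0_integral_setU//=; last 3 first.
  - by rewrite setUCr.
  - by move=> x _; rewrite lee_fin sqr_ge0.
  - by rewrite disj_set2E setICr.
  apply: leeD.
    rewrite -ge0_integralZl//; last 2 first.
    - exact: measurable_funTS.
    - by rewrite lee_fin sqr_ge0.
    apply: ge0_le_integral => //.
    - by move=> x _; rewrite lee_fin sqr_ge0.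
    - exact: measurable_funTS.
    - by apply: emeasurable_funM => //; exact: measurable_funTS.
    move=> x _; rewrite -EFinM lee_fin -exprMn lerXn2r ?nnegrE ?mulr_ge0 ?normc_ge0//.
    rewrite normcM ler_wpM2r ?normc_ge0// (le_trans (bM n x))//.
    by rewrite ler_piMr// invf_le1 ?lerDl ?enorm_ge0//; exact: e1.
  apply: (@le_trans _ _ (\int[leb]_(x in ~` D rho) (((M * (1 + rho)^-1) ^+ 2)%:E * (normc (h n x) ^+ 2)%:E))%E).
    apply: ge0_le_integral => //.
    - exact: measurableC.
    - by move=> x _; rewrite lee_fin sqr_ge0.
    - exact: measurable_funTS.
    - by apply: emeasurable_funM => //; exact: measurable_funTS.
    move=> x /negP; rewrite -ltNge => xr; rewrite -EFinM lee_fin -exprMn.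
    have rM : 0 <= M * (1 + rho)^-1 by rewrite mulr_ge0// invr_ge0 addr_ge0.
    apply: lerXn2r; rewrite ?nnegrE ?normc_ge0//; first by rewrite mulr_ge0// normc_ge0.
    rewrite normcM ler_wpM2r ?normc_ge0// (le_trans (bM n x))// ler_wpM2l//.
    rewrite lef_pV2 ?posrE; [by rewrite lerD2l ltW|exact: e1|by rewrite ltr_wpDr].
  rewrite ge0_integralZl//; last 3 first.
  - exact: measurableC.
  - exact: measurable_funTS.
  - by rewrite lee_fin sqr_ge0.
  rewrite [X in (_ <= X)%E]EFinM; apply: lee_wpmul2l; first by rewrite lee_fin sqr_ge0.
    apply: le_trans (hC n); apply: ge0_subset_integral => //.
    exact: measurableC.
  exact: measurableC.
have fin2 n : sqint (fun x => b n x * h n x) \is a fin_num.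
  rewrite ge0_fin_numE ?sqint_ge0//.
  apply: (@le_lt_trans _ _ ((M ^+ 2)%:E * sqint (h n))%E).
    apply: sqint_le => //; first exact: cmeasM.
    move=> x; rewrite normcM ler_wpM2r ?normc_ge0// (le_trans (bM n x))//.
    by rewrite ler_piMr// invf_le1 ?lerDl ?enorm_ge0// ltr_wpDr// enorm_ge0.
  apply: (@le_lt_trans _ _ ((M ^+ 2)%:E * C%:E)%E); last by rewrite -EFinM ltry.
  by rewrite lee_wpmul2l// lee_fin sqr_ge0.
rewrite (_ : (fun n => _) = EFin \o (fun n => fine (sqint (fun x => b n x * h n x)))); last first.
  by apply/funext => n /=; rewrite fineK.
apply: cvg_EFin; first exact: nearW.
rewrite (_ : _ \o _ = (fun n => fine (sqint (fun x => b n x * h n x))))//.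
apply/cvgrPdist_le => e e0.
(* With this choice the high frequencies contribute at most (e/2) rho/(1 + rho)^2, hence at most
   e/2. *)
pose rho : R := 2 * (M ^+ 2 * C) / e.
have r0 : 0 <= rho by rewrite divr_ge0 ?(ltW e0)// !mulr_ge0 ?sqr_ge0.
have small : \forall n \near \oo, ((M ^+ 2)%:E * \int[leb]_(x in D rho) (normc (h n x) ^+ 2)%:E <= (e / 2)%:E)%E.
  have : nbhs (0%E : \bar R) [set y | (y <= (e / 2)%:E)%E].
    apply: (@filterS _ _ _ [set y | (y < (e / 2)%:E)%E]); first by move=> y /ltW.
    by apply: open_nbhs_nbhs; split; [exact: open_ereal_lt_ereal|rewrite /= lte_fin divr_gt0].
  by move=> /(cvge0Z (M ^+ 2) (low rho)).
move: small; apply: filterS => n hn.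
rewrite sub0r normrN ger0_norm ?fine_ge0 ?sqint_ge0// -lee_fin fineK//.
apply: (le_trans (bound rho n r0)).
apply: (@le_trans _ _ ((e / 2)%:E + (e / 2)%:E)%E); last by rewrite -EFinD -splitr.
apply: leeD => //; rewrite lee_fin.
have r1 : 0 < 1 + rho by rewrite ltr_wpDr.
have e20 : 0 < e / 2 by rewrite divr_gt0.
have hK : M ^+ 2 * C = e / 2 * rho by rewrite /rho; field; rewrite gt_eqF.
have -> : (M / (1 + rho)) ^+ 2 * C = M ^+ 2 * C / (1 + rho) ^+ 2.
  by field; rewrite gt_eqF.
rewrite hK ler_pdivrMr ?exprn_gt0// ler_pM2l// sqrrD expr1n mul1r mulr2n.
by have := sqr_ge0 rho; lra.
Qed.

End L2_sequences.

(** * Localisation in an open set *)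

Section local_functions.
Variables (R : realType) (d : nat).
Local Notation E := 'rV[R]_d.
Local Notation leb := (lebesgue_rV R d).
Variables (Om : set E) (oOm : open Om).
Implicit Types f g b v : E -> R[i].

(** At points of K the openness of [Om] gives continuity; off the closed set K the function is
    locally 0. *)
Lemma glue_continuous (K : set E) (p : E -> R) : closed K -> K `<=` Om ->
  {within Om, continuous p} -> (forall x, ~ K x -> p x = 0) -> continuous p.
Proof.
move=> cK KO cp p0 x; have [Kx|Kx] := pselect (K x).
  by move: cp; rewrite continuous_open_subspace// => cp; apply: cp; rewrite inE; exact: KO.
have n0 : \forall y \near x, 0 = p y.
  have : nbhs x (~` K) by apply: open_nbhs_nbhs; split => //; exact: closed_openC.
  by apply: filterS => y Ky; rewrite p0.
rewrite /continuous_at p0//; apply: (@cvg_near_cst _ _ _ _ (nbhs x) (nbhs_filter x)).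
by move: n0; apply: filterS => y <-.
Qed.

Lemma glue_ccont (K : set E) f : compact K -> K `<=` Om ->
  ccontinuous Om f -> (forall x, ~ K x -> f x = 0) -> ccont f.
Proof.
move=> cK KO [f1 f2] f0; have cl : closed K by exact: compact_closed.
by split; apply: (glue_continuous cl KO) => // x Kx; rewrite f0.
Qed.

Lemma ccontinuous_within f : ccont f -> ccontinuous Om f.
Proof. by move=> [f1 f2]; split; exact: continuous_subspaceT. Qed.

Lemma cmeas_extend f : cmeasurable Om f -> (forall x, ~ Om x -> f x = 0) -> cmeas f.
Proof.
move=> [m1 m2] f0; have mO := open_measurable_rV oOm.
have H (p : E -> R) : measurable_fun Om p -> (forall x, ~ Om x -> p x = 0) -> measurable_fun setT p.
  move=> mp p0; rewrite (_ : p = p \_ Om); first exact/(measurable_restrictT p mO).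
  apply/funext => x; rewrite patchE; case: ifPn => //; rewrite notin_setE => /p0 ->//.
by split; apply: H => // x /f0 ->.
Qed.

Lemma ccontinuous_cmeasurable f : ccontinuous Om f -> cmeasurable Om f.
Proof. by move=> [f1 f2]; split; exact: within_measurable_rV. Qed.

Lemma cmeasurableM f g : cmeasurable Om f -> cmeasurable Om g ->
  cmeasurable Om (fun x => f x * g x).
Proof.
move=> [f1 f2] [g1 g2]; split.
  by under eq_fun do rewrite ReM; apply: measurable_funB; apply: measurable_funM.
by under eq_fun do rewrite ImM; apply: measurable_funD; apply: measurable_funM.
Qed.

Lemma real_bounded_compact (T : topologicalType) (K : set T) (p : T -> R) : compact K ->
  {within K, continuous p} -> exists B : R, forall x, K x -> `|p x| <= B.
Proof.
move=> cK cp; have /compact_bounded[B [_ HB]] := continuous_compact cp cK.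
exists (B + 1) => x Kx; apply: (HB (B + 1)); first by rewrite ltrDl.
by exists x.
Qed.

Lemma cbounded_compact (T : topologicalType) (A K : set T) (f : T -> R[i]) :
  compact K -> K `<=` A -> ccontinuous A f ->
  exists2 B : R, 0 <= B & forall x, K x -> normc (f x) <= B.
Proof.
move=> cK KA [f1 f2].
have [B1 H1] := real_bounded_compact cK (continuous_subspaceW KA f1).
have [B2 H2] := real_bounded_compact cK (continuous_subspaceW KA f2).
exists (`|B1| + `|B2|); first by rewrite addr_ge0.
move=> x Kx; rewrite (le_trans (ler_normc_ReIm _))// lerD//.
  by rewrite (le_trans (H1 x Kx))// ler_norm.
by rewrite (le_trans (H2 x Kx))// ler_norm.
Qed.

Lemma enorm_le_norm (x : E) : enorm x <= d.+1%:R * `|x|.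
Proof.
rewrite -(@ler_pXn2r _ 2) ?nnegrE ?enorm_ge0 ?mulr_ge0//.
rewrite -edotxx /edot (@le_trans _ _ (\sum_(i < d) `|x| ^+ 2))//.
  apply: ler_sum => i _; rewrite -expr2 -(real_normK (num_real (x ord0 i))).
  by rewrite lerXn2r ?nnegrE// norm_coord_le.
rewrite sumr_const card_ord -[leLHS]mulr_natl exprMn ler_wpM2r ?sqr_ge0//.
by rewrite -natrX ler_nat expnS expn1 mulSn (leq_trans (leqnSn d))// leq_addr.
Qed.

Lemma compact_measure_fin (K : set E) : compact K -> (leb K < +oo)%E.
Proof.
move=> cK; have [B [_ HB]] := compact_bounded cK.
have H x : K x -> enorm x <= d.+1%:R * (B + 1).
  move=> Kx; rewrite (le_trans (enorm_le_norm x))// ler_wpM2l//.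
  by apply: HB Kx; rewrite ltrDl.
apply: (@le_lt_trans _ _ (leb [set x | enorm x <= d.+1%:R * (B + 1)])); last exact: lebesgue_enorm_le_fin.
apply: le_measure; rewrite ?inE//.
- exact: compact_measurable_rV.
- exact: measurable_enorm_le.
Qed.

Lemma integrable_indic_compact (K : set E) : compact K ->
  leb.-integrable setT (fun x => (\1_K x)%:E).
Proof.
move=> cK; have mK := compact_measurable_rV cK.
apply/integrableP; split; first by apply/measurable_EFinP; exact: measurable_indic.
under eq_integral do rewrite /= ger0_norm ?indicE ?ler0n// -indicE.
by rewrite integral_indic// setIT compact_measure_fin.
Qed.

Lemma closed_norm_ball_compact (x : E) (r : R) : compact [set y : E | `|y - x| <= r].
Proof.
apply: bounded_closed_compact.
  exists (`|x| + r); split; first exact: num_real.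
  move=> M xrM y /= yx; rewrite -(subrK x y) (le_trans (ler_normD _ _))//.
  by rewrite (le_trans _ (ltW xrM))// addrC lerD2l.
apply: (@closed_comp _ _ (fun y : E => `|y - x|) [set t | t <= r]); last exact: closed_le.
move=> y _; apply: continuous_comp; last exact: norm_continuous.
by apply: continuousB; [exact: cvg_id|exact: cst_continuous].
Qed.

Lemma compact_neighborhood (x : E) : Om x ->
  exists2 r : R, 0 < r & [set y : E | `|y - x| <= r] `<=` Om.
Proof.
move=> Ox; have /nbhs_ballP[e /= e0 eO] : nbhs x Om by exact: open_nbhs_nbhs.
exists (e / 2); first by rewrite divr_gt0.
move=> y /= yx; apply: eO; rewrite -ball_normE /= distrC (le_lt_trans yx)//.
by rewrite ltr_pdivrMr// ltr_pMr// ltr1n.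
Qed.

Lemma locally_uniform_continuous (p_ : nat -> E -> R) (p : E -> R) :
  (forall n, {within Om, continuous (p_ n)}) ->
  (forall K : set E, compact K -> K `<=` Om -> forall e, 0 < e ->
    \forall n \near \oo, forall x, K x -> `|p_ n x - p x| < e) ->
  {within Om, continuous p}.
Proof.
move=> cp up; rewrite continuous_open_subspace// => x; rewrite inE => Ox.
have [r r0 rO] := compact_neighborhood Ox.
apply/(@cvgrPdist_le _ _ _ (nbhs x) (nbhs_filter x)) => e e0.
have e3 : 0 < e / 3 by rewrite divr_gt0.
have [N _ HN] := up _ (@closed_norm_ball_compact x r) rO _ e3.
have HNN := HN N (leqnn N).
have := cp N; rewrite continuous_open_subspace// => /(_ x).
rewrite inE => /(_ Ox)/(@cvgrPdist_le _ _ _ (nbhs x) (nbhs_filter x))/(_ _ e3) H1.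
have H2 : \forall y \near x, `|y - x| <= r.
  apply/nbhs_ballP; exists r => // y; rewrite -ball_normE/= distrC; exact: ltW.
near=> y.
have yr : `|y - x| <= r by near: y.
have h1 := HNN _ yr.
have h2 : `|p_ N x - p x| < e / 3 by apply: HNN; rewrite /= subrr normr0 ltW.
have h3 : `|p_ N x - p_ N y| <= e / 3 by near: y.
rewrite (_ : p x - p y = - (p_ N x - p x) + (p_ N x - p_ N y) + (p_ N y - p y)); last by ring.
rewrite (le_trans (ler_normD _ _))// (le_trans (lerD (ler_normD _ _) (lexx _)))//.
by rewrite normrN; lra.
Unshelve. all: by end_near. Qed.

Lemma locally_uniform_ccontinuous (f_ : nat -> E -> R[i]) f :
  (forall n, ccontinuous Om (f_ n)) ->
  (forall K : set E, compact K -> K `<=` Om -> forall e, 0 < e ->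
    \forall n \near \oo, forall x, K x -> normc (f_ n x - f x) < e) ->
  ccontinuous Om f.
Proof.
move=> cf uf; split.
  apply: (@locally_uniform_continuous (fun n x => Re (f_ n x))) => [n|K cK KO e e0].
    exact: (cf n).1.
  apply: filterS (uf K cK KO e e0) => n H x Kx; rewrite (le_lt_trans _ (H x Kx))//.
  by rewrite (le_trans _ (ler_Re_normc _))// ReD ReN.
apply: (@locally_uniform_continuous (fun n x => Im (f_ n x))) => [n|K cK KO e e0].
  exact: (cf n).2.
apply: filterS (uf K cK KO e e0) => n H x Kx; rewrite (le_lt_trans _ (H x Kx))//.
by rewrite (le_trans _ (ler_Im_normc _))// ImD ImN.
Qed.

Section compact_support.
Variables (K : set E) (cK : compact K) (KO : K `<=` Om).
Let mK : measurable K. Proof. exact: compact_measurable_rV. Qed.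

Lemma cmeas_mul_local b v : ccontinuous Om b -> (forall x, ~ K x -> b x = 0) ->
  cmeasurable Om v -> cmeas (fun x => b x * v x).
Proof.
move=> cb b0 mv; apply: cmeas_extend.
  by apply: cmeasurableM => //; exact: ccontinuous_cmeasurable.
by move=> x Ox; rewrite b0 ?mul0r// => /KO.
Qed.

Lemma sqint_mul_local b v (B : R) : ccontinuous Om b -> (forall x, ~ K x -> b x = 0) ->
  cmeasurable Om v -> (forall x, K x -> normc (b x) <= B) ->
  (sqint (fun x => b x * v x)%R <= (B ^+ 2)%:E * \int[leb]_(x in K) (normc (v x) ^+ 2)%:E)%E.
Proof.
move=> cb b0 mv bB; have mbv := cmeas_mul_local cb b0 mv.
have mvK : measurable_fun K (fun x => (normc (v x) ^+ 2)%:E).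
  have [m1 m2] := mv; apply: (@measurable_funS _ _ _ _ Om) => //; first exact: open_measurable_rV.
  apply/measurable_EFinP; under eq_fun do rewrite normc_sqr.
  by apply: measurable_funD; apply: measurable_funX.
have -> : sqint (fun x => b x * v x) = (\int[leb]_(x in K) (normc (b x * v x)%R ^+ 2)%:E)%E.
  rewrite [RHS]integral_mkcond; apply: eq_integral => x _; rewrite patchE.
  by case: ifPn => //; rewrite notin_setE => /b0 ->; rewrite mul0r normc0 expr0n.
rewrite -ge0_integralZl//; last 2 first.
- by move=> x _; rewrite lee_fin sqr_ge0.
- by rewrite lee_fin sqr_ge0.
apply: ge0_le_integral => //.
- by move=> x _; rewrite lee_fin sqr_ge0.
- by apply: measurable_funTS; exact: measurable_sqint.
- by apply: emeasurable_funM.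
move=> x Kx; rewrite -EFinM lee_fin -exprMn normcM.
have B0 : 0 <= B by rewrite (le_trans (normc_ge0 _) (bB x Kx)).
by rewrite lerXn2r ?nnegrE ?mulr_ge0 ?normc_ge0// ler_wpM2r ?normc_ge0// bB.
Qed.

(** On K, |f| <= |f|^2 + 1, and K has finite measure. *)
Lemma cintegrable_local f : cmeas f -> (forall x, ~ K x -> f x = 0) -> (sqint f < +oo)%E ->
  cintegrable leb f /\ ((\int[leb]_x normc (f x))%:E <= sqint f + leb K)%E.
Proof.
move=> mf f0 f2; have Kf := compact_measure_fin cK.
have i2 : leb.-integrable setT (fun x => (normc (f x) ^+ 2)%:E).
  apply/integrableP; split; first exact: measurable_sqint.
  by under eq_integral do rewrite /= ger0_norm ?sqr_ge0//.
have iK := integrable_indic_compact cK.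
have i2K := integrableD measurableT i2 iK.
have bf x : normc (f x) <= normc (f x) ^+ 2 + \1_K x.
  rewrite indicE; case: (boolP (x \in K)) => [_|]; last first.
    by rewrite notin_setE => /f0 ->; rewrite normc0 expr0n addr0.
  by have := sqr_ge0 (normc (f x) - 2^-1); rewrite expr2 => h; rewrite /=; have := normc_ge0 (f x); nra.
have intf := cintegrable_le mf i2K bf; split => //.
rewrite /Rintegral fineK; last exact: (integrable_fin_num measurableT intf.2).
have -> : leb K = (\int[leb]_x (\1_K x)%:E)%E by rewrite integral_indic// setIT.
rewrite /sqint -ge0_integralD//; last 3 first.
- by move=> x _; rewrite lee_fin sqr_ge0.
- exact: measurable_sqint.
- by apply/measurable_EFinP; exact: measurable_indic.
apply: ge0_le_integral => //.
- by move=> x _; rewrite lee_fin normc_ge0.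
- by apply/measurable_EFinP; exact: measurable_normc.
- by apply: emeasurable_funD; [exact: measurable_sqint|apply/measurable_EFinP; exact: measurable_indic].
by move=> x _; rewrite -EFinD lee_fin.
Qed.

End compact_support.

Section weakly_null_sequences.
Variables (r : nat) (u : nat -> E -> 'cV[R[i]]_r) (wu : weakly_null Om u).

(** Testing against the vector whose only component is the conjugate of h isolates the i-th
    component of u_n. *)
Let pairing (i : 'I_r) (h : E -> R[i]) n : cintegral (fun x => \sum_(j < r) u n x j ord0 *
    conjc ((\col_j (if j == i then conjc (h x) else 0) : 'cV_r) j ord0)) =
  cint leb (fun x => h x * u n x i ord0).
Proof.
apply: eq_cint => x; rewrite (bigD1 i)//= mxE eqxx conjcK mulrC big1 ?addr0// => j ji.
by rewrite mxE (negbTE ji) conjc0 mulr0.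
Qed.

Let L2comp_col (i : 'I_r) (h : E -> R[i]) : L2comp Om h ->
  forall j, L2comp Om (fun x => (\col_j (if j == i then conjc (h x) else 0) : 'cV[R[i]]_r) j ord0).
Proof.
move=> [mh h2 [K cK h0]] j; split.
- under eq_fun do rewrite mxE; case: (j == i); last exact: cmeas_cst.
  exact: (cmeasJ mh).
- under eq_integral do rewrite mxE; case: (j == i).
    by under eq_integral do rewrite normcJ.
  by rewrite normc0 expr0n/= integral0 ltry.
- by exists K => // x Kx; rewrite mxE h0// conjc0; case: (j == i).
Qed.

Lemma weakly_null_pairing (i : 'I_r) (h : E -> R[i]) : L2comp Om h ->
  ccvg (fun n => cint leb (fun x => h x * u n x i ord0)) 0.
Proof.
move=> Lh; have [_ H] := wu; have := H _ (L2comp_col i Lh).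
by rewrite /ccvg; under eq_fun do rewrite pairing; under [X in _ /\ (X @ _ --> _)]eq_fun do rewrite pairing.
Qed.

Lemma ccvg0_normc (z : nat -> R[i]) : ccvg z 0 -> (fun n => normc (z n)) @ \oo --> (0 : R).
Proof.
move=> [z1 z2]; apply: (@squeeze_cvgr _ _ _ _ (fun=> 0) (fun n => `|Re (z n)| + `|Im (z n)|)).
- by apply: nearW => n; rewrite normc_ge0 ler_normc_ReIm.
- exact: cvg_cst.
have := cvgD (cvg_norm z1) (cvg_norm z2); rewrite /= normr0 addr0; exact.
Qed.

(** The gliding hump is applied to the real and imaginary parts of 1_K u_n; a real L^2 function
    multiplied by 1_K is an admissible test function and picks out either part. *)
Lemma weakly_null_bounded_compact (K : set E) (i : 'I_r) : compact K -> K `<=` Om ->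
  exists2 C : R, 0 <= C & forall n, (\int[leb]_(x in K) (normc (u n x i ord0) ^+ 2)%:E <= C%:E)%E.
Proof.
move=> cK KO; have mK := compact_measurable_rV cK; have mO := open_measurable_rV oOm.
have [Lu _] := wu.
have mu n : cmeas (fun x => (\1_K x)%:C * u n x i ord0).
  apply: cmeas_extend => [|x Ox]; last by rewrite indicE memNset ?mul0r// => /KO.
  apply: cmeasurableM; last exact: (Lu n i).1.
  split => /=; last exact: measurable_cst.
  by apply: measurable_funTS; exact: measurable_indic.
have u2 n : (sqint (fun x => ((\1_K x)%:C * u n x i ord0)%R) = \int[leb]_(x in K) (normc (u n x i ord0) ^+ 2)%:E)%E.
  rewrite [RHS]integral_mkcond; apply: eq_integral => x _; rewrite patchE indicE.
  by case: (x \in K); rewrite ?mul1r// mul0r normc0 expr0n.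
have u2fin n : (sqint (fun x => ((\1_K x)%:C * u n x i ord0)%R) < +oo)%E.
  by rewrite u2; exact: (Lu n i).2.
pose w n x := (\1_K x)%:C * u n x i ord0.
have L1 n : L2r leb (fun x => Re (w n x)).
  apply: (L2r_le (mu n).1 (measurable_sqint (mu n))) (u2fin n) => x.
  by rewrite lee_fin normc_sqr lerDl sqr_ge0.
have L2 n : L2r leb (fun x => Im (w n x)).
  apply: (L2r_le (mu n).2 (measurable_sqint (mu n))) (u2fin n) => x.
  by rewrite lee_fin normc_sqr lerDr sqr_ge0.
have Lh h : L2r leb h -> L2comp Om (fun x => (h x * \1_K x)%:C).
  move=> [mh h2]; split.
  - by apply: cmeas_real; apply: measurable_funM => //; exact: measurable_indic.
  - apply: le_lt_trans h2; apply: ge0_le_integral => //.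
    + by move=> x _; rewrite lee_fin sqr_ge0.
    + apply: measurable_sqint; apply: cmeas_real; apply: measurable_funM => //; exact: measurable_indic.
    + by apply/measurable_EFinP; exact: measurable_funX.
    move=> x _; rewrite lee_fin normcR real_normK ?num_real// exprMn indicE.
    by case: (x \in K); rewrite /= ?expr1n ?mulr1// expr0n mulr0 sqr_ge0.
  - by exists K => // x Kx; rewrite indicE memNset// mulr0.
have [C1 H1] : exists C : R, forall n, sqL2 leb (fun x => Re (w n x)) <= C.
  apply: weakly_null_bounded L1 _ => h /Lh/(weakly_null_pairing i)[+ _].
  rewrite (_ : (fun n => Re _) = (fun n => \int[leb]_x (Re (w n x) * h x)))//.
  apply/funext => n; apply: eq_Rintegral => x _; rewrite /w !ReM/=; ring.
have [C2 H2] : exists C : R, forall n, sqL2 leb (fun x => Im (w n x)) <= C.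
  apply: weakly_null_bounded L2 _ => h /Lh/(weakly_null_pairing i)[_].
  rewrite (_ : (fun n => Im _) = (fun n => \int[leb]_x (Im (w n x) * h x)))//.
  apply/funext => n; apply: eq_Rintegral => x _; rewrite /w !ImM/=; ring.
have B n : (\int[leb]_(x in K) (normc (u n x i ord0) ^+ 2)%:E <= (C1 + C2)%:E)%E.
  rewrite -u2 /sqint.
  rewrite (_ : (fun x => _) = (fun x : E => (Re (w n x) ^+ 2)%:E + (Im (w n x) ^+ 2)%:E)%E); last first.
    by apply/funext => x; rewrite normc_sqr EFinD.
  rewrite integralD//; [|exact: L2r_integrable|exact: L2r_integrable].
  by rewrite (sqL2E (L1 n)) (sqL2E (L2 n)) -EFinD lee_fin lerD.
exists (C1 + C2) => //.
by rewrite -lee_fin (le_trans _ (B 0%N))// integral_ge0// => x _; rewrite lee_fin sqr_ge0.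
Qed.

Section fixed_coefficient.
Variables (a : E -> R[i]) (Ca : Cc Om a) (i : 'I_r).
Let v n x := a x * u n x i ord0.

Let Lv : L2bdd v /\ (forall n, cintegrable leb (v n)) /\
  exists B : R, forall n, \int[leb]_x normc (v n x) <= B.
Proof.
have [/ccontP ca [K [cK KO] a0]] := Ca.
have cO := ccontinuous_within ca.
have [B B0 HB] := cbounded_compact cK KO cO.
have [C C0 HC] := weakly_null_bounded_compact i cK KO.
have mu n := (wu.1 n i).1.
have vB n : (sqint (v n) <= (B ^+ 2 * C)%:E)%E.
  apply: (le_trans (sqint_mul_local cK KO cO a0 (mu n) HB)).
  by rewrite [leRHS]EFinM lee_wpmul2l ?lee_fin ?sqr_ge0.
have mv n : cmeas (v n) := cmeas_mul_local KO cO a0 (mu n).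
have v0 n x : ~ K x -> v n x = 0 by move=> Kx; rewrite /v a0// mul0r.
have vfin n : (sqint (v n) < +oo)%E by rewrite (le_lt_trans (vB n))// ltry.
have cl n := cintegrable_local cK (mv n) (v0 n) (vfin n).
split; first by split => //; exists (B ^+ 2 * C).
split; first by move=> n; exact: (cl n).1.
exists (B ^+ 2 * C + fine (leb K)) => n; rewrite -lee_fin (le_trans (cl n).2)//.
have Kf : leb K \is a fin_num by rewrite ge0_fin_numE// compact_measure_fin.
by rewrite EFinD fineK// leeD2r.
Qed.

Lemma cintegrable_mul_Cc n : cintegrable leb (v n). Proof. exact: Lv.2.1. Qed.

Lemma L2bdd_mul_Cc : L2bdd v. Proof. exact: Lv.1. Qed.

(** At a fixed frequency the transform is the pairing of u_n with the kernel times [a], a compactly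
    supported L^2 function. *)
Lemma fourier_mul_Cc_cvg x : (fun n => normc (fourier (v n) x)) @ \oo --> (0 : R).
Proof.
have [/ccontP ca [K [cK KO] a0]] := Ca.
have [B B0 HB] := cbounded_compact cK KO (ccontinuous_within ca).
have Lc : L2comp Om (fun y => ce (2 * pi * edot y x) * a y).
  have mc : cmeas (fun y => ce (2 * pi * edot y x) * a y).
    by apply: cmeasM; [exact: cmeas_ce_edotl|exact: ccont_cmeas].
  split; first exact: mc.
  - apply: (@le_lt_trans _ _ (\int[leb]_y ((B ^+ 2)%:E * (\1_K y)%:E))%E).
      have mK := compact_measurable_rV cK.
      apply: ge0_le_integral => //.
      + by move=> y _; rewrite lee_fin sqr_ge0.
      + exact: measurable_sqint.
      + by apply: emeasurable_funM => //; apply/measurable_EFinP; exact: measurable_indic.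
      move=> y _; rewrite -EFinM lee_fin normcM normc_ce mul1r indicE.
      case: (boolP (y \in K)) => [|]; rewrite ?inE ?notin_setE => Ky.
        by rewrite mulr1 lerXn2r ?nnegrE ?normc_ge0// HB.
      by rewrite a0// normc0 expr0n mulr0.
    have iK := integrable_indic_compact cK.
    exact: (integrable_lty measurableT (integrableZl measurableT (B ^+ 2) iK)).
  - by exists K => // y Ky; rewrite a0// mulr0.
have := ccvg0_normc (weakly_null_pairing i Lc).
by under eq_fun do under eq_cint do rewrite -mulrA.
Qed.

Lemma L2null_multiplier_fourier (b : nat -> E -> R[i]) (M : R) : (forall n, cmeas (b n)) ->
  (forall n x, normc (b n x) <= M * (1 + enorm x)^-1) ->
  L2null (fun n x => b n x * fourier (v n) x).
Proof.
move=> mb bM; have [Lv1 [Lv2 [B HB]]] := Lv.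
apply: (L2null_multiplier mb bM (B := B)).
- exact: L2bdd_fourier.
- by move=> n x; rewrite (le_trans (normc_fourier_le x (Lv2 n))).
- exact: fourier_mul_Cc_cvg.
Qed.

End fixed_coefficient.

(** Coefficients that tend to 0 uniformly on K, against components bounded in L^2(K). This absorbs
    the replacement of A_n by its limit. *)
Lemma L2null_fourier_vanishing (K : set E) (e : nat -> E -> R[i]) (i : 'I_r) :
  compact K -> K `<=` Om -> (forall n, ccontinuous Om (e n)) ->
  (forall n x, ~ K x -> e n x = 0) ->
  (forall s : R, 0 < s -> \forall n \near \oo, forall x, K x -> normc (e n x) <= s) ->
  (forall n, cintegrable leb (fun x => e n x * u n x i ord0)) /\
  L2null (fun n => fourier (fun x => e n x * u n x i ord0)).
Proof.
move=> cK KO ce e0 es; have mu n := (wu.1 n i).1.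
have me n : cmeas (fun x => e n x * u n x i ord0) := cmeas_mul_local KO (ce n) (e0 n) (mu n).
have [C C0 HC] := weakly_null_bounded_compact i cK KO.
have bnd n (B : R) : (forall x, K x -> normc (e n x) <= B) ->
    (sqint (fun x => (e n x * u n x i ord0)%R) <= (B ^+ 2 * C)%:E)%E.
  move=> eB; apply: (le_trans (sqint_mul_local cK KO (ce n) (e0 n) (mu n) eB)).
  by rewrite [leRHS]EFinM lee_wpmul2l ?lee_fin ?sqr_ge0.
have fin n : (sqint (fun x => (e n x * u n x i ord0)%R) < +oo)%E.
  by have [B B0 HB] := cbounded_compact cK KO (ce n); rewrite (le_lt_trans (bnd n B HB))// ltry.
have ie n : cintegrable leb (fun x => e n x * u n x i ord0).
  apply: (cintegrable_local cK (me n) _ (fin n)).1.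
  by move=> x Kx; rewrite e0// mul0r.
split => //; apply: L2null_fourier => //; split => //.
have F n : sqint (fun x => e n x * u n x i ord0) \is a fin_num by rewrite ge0_fin_numE ?sqint_ge0.
rewrite (_ : (fun n => _) = EFin \o (fun n => fine (sqint (fun x => e n x * u n x i ord0)))); last first.
  by apply/funext => n /=; rewrite fineK.
apply: cvg_EFin; first exact: nearW.
rewrite (_ : _ \o _ = (fun n => fine (sqint (fun x => e n x * u n x i ord0))))//.
apply/cvgrPdist_le => s s0.
(* The square integral is at most the squared bound on the coefficient times C; this bound makes it
   at most s. *)
have t0 : 0 < Num.sqrt (s / (C + 1)) by rewrite sqrtr_gt0 divr_gt0// ltr_wpDl.
apply: filterS (es _ t0) => n /bnd h.
rewrite sub0r normrN ger0_norm ?fine_ge0 ?sqint_ge0// -lee_fin fineK// (le_trans h)//.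
rewrite lee_fin sqr_sqrtr ?divr_ge0 ?(ltW s0) ?addr_ge0//.
by rewrite mulrAC ler_pdivrMr ?ltr_wpDl// ler_wpM2l ?(ltW s0)// lerDl.
Qed.

End weakly_null_sequences.
End local_functions.

(** * Multi-indices and the Fourier transform of the equation *)

Lemma measurable_invr d (T : measurableType d) (R : realType) (f : T -> R) :
  (forall x, 0 <= f x) -> measurable_fun setT f -> measurable_fun setT (fun x => (f x)^-1).
Proof.
move=> f0 mf; under eq_fun do rewrite -powR_inv1//.
by apply: (measurableT_comp (f := fun t : R => powR t (-1))) => //; apply: measurable_powR.
Qed.

Section multi_indices.
Variables (R : realType) (d : nat).
Local Notation E := 'rV[R]_d.

Definition mi_seq (a : 'I_d -> nat) : seq 'I_d :=
  flatten [seq nseq (a i) i | i <- enum 'I_d].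

Lemma big_mi_seq (T : Type) (idx : T) (op : Monoid.com_law idx) (a : 'I_d -> nat) (F : 'I_d -> T) :
  \big[op/idx]_(i <- mi_seq a) F i = \big[op/idx]_(i < d) iter (a i) (op (F i)) idx.
Proof.
rewrite /mi_seq big_flatten big_map big_enum; apply: eq_bigr => i _.
by elim: (a i) => [|n IH]; rewrite ?big_nil// big_cons IH.
Qed.

Lemma size_mi_seq (a : 'I_d -> nat) : size (mi_seq a) = mi_abs a.
Proof.
rewrite -sum1_size big_mi_seq; apply: eq_bigr => i _.
by elim: (a i) => //= n ->.
Qed.

Lemma prod_mi_seq (a : 'I_d -> nat) (F : 'I_d -> R[i]) :
  \prod_(i <- mi_seq a) F i = \prod_(i < d) F i ^+ a i.
Proof. by rewrite big_mi_seq; apply: eq_bigr => i _; rewrite -Monoid.iteropE. Qed.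

Lemma splits_size (s : seq 'I_d) p : p \in splits s -> (size p.2 <= size s)%N.
Proof.
elim: s p => [|i s IH] p; first by rewrite inE => /eqP ->.
rewrite mem_cat => /orP[/mapP[p' /IH h ->]|/mapP[p' /IH h ->]] //=.
exact: leqW.
Qed.

(** Singles out the term with all derivatives on the second factor. In the application it is the
    only one whose monomial has full degree. *)
Lemma sum_splits (V : zmodType) (s : seq 'I_d) (F : seq 'I_d * seq 'I_d -> V) :
  \sum_(p <- splits s) F p =
  F ([::], s) + \sum_(p <- splits s | (size p.2 < size s)%N) F p.
Proof.
elim: s F => [|i s IH] F; first by rewrite /= big_seq1 big_cons big_nil/= addr0.
rewrite /= !big_cat !big_map/= (IH (fun p => F (p.1, i :: p.2)))/=.
rewrite [X in _ = _ + (X + _)](_ : _ = \sum_(p <- splits s) F (i :: p.1, p.2)); last first.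
  rewrite [LHS]big_mkcond big_seq [RHS]big_seq; apply: eq_bigr => p ps.
  by rewrite ltnS splits_size.
by rewrite addrCA.
Qed.

(** The sign of the distributional derivative cancels that of the factors -2 pi i x_i. *)
Lemma monomial_mi_seq (a : 'I_d -> nat) (x : E) :
  (-1) ^+ mi_abs a * monomial (mi_seq a) x =
  (0 +i* (2 * pi)) ^+ mi_abs a * (\prod_(i < d) x ord0 i ^+ a i)%:C.
Proof.
rewrite /monomial prod_mi_seq real_complex_prod.
rewrite (eq_bigr (fun i => (- (0 +i* (2 * pi))) ^+ a i * (x ord0 i)%:C ^+ a i)); last first.
  move=> i _; rewrite -exprMn; congr (_ ^+ _); apply: complexP.
    by rewrite ReM ReN/=; ring.
  by rewrite ImM ReN ImN/=; ring.
rewrite big_split/= mulrA; congr (_ * _).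
  by rewrite prodrXr -exprMn mulN1r opprK.
by apply: eq_bigr => i _; rewrite real_complexX.
Qed.

Lemma prod_coord_scale (a : 'I_d -> nat) (c : R) (x : E) :
  \prod_(i < d) (c *: x) ord0 i ^+ a i = c ^+ mi_abs a * \prod_(i < d) x ord0 i ^+ a i.
Proof.
rewrite -prodrXr -big_split/=; apply: eq_bigr => i _.
by rewrite mxE exprMn.
Qed.

Lemma norm_prod_coord_le (a : 'I_d -> nat) (x : E) :
  `|\prod_(i < d) x ord0 i ^+ a i| <= enorm x ^+ mi_abs a.
Proof.
rewrite normr_prod -prodrXr; apply: ler_prod => i _.
by rewrite normrX exprn_ge0//= lerXn2r ?nnegrE ?enorm_ge0// coord_le_enorm.
Qed.

End multi_indices.

Section weights.
Variables (R : realType) (d l m : nat) (lm : (l <= m)%N).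
Variables (eps0 epsoo e : R) (eps0_gt0 : 0 < eps0) (e0 : eps0 <= e) (eoo : e <= epsoo).
Local Notation E := 'rV[R]_d.

Let e_gt0 : 0 < e. Proof. exact: lt_le_trans e0. Qed.

Let term_ge0 (x : E) s : 0 <= e ^+ (s - l) * enorm x ^+ s.
Proof. by rewrite mulr_ge0 ?exprn_ge0 ?enorm_ge0 ?ltW. Qed.

Lemma hweight_ge1 (x : E) : 1 <= hweight l m e x.
Proof. by rewrite /hweight lerDl sumr_ge0. Qed.

(** The top term of the weight alone, with eps replaced by its lower bound. *)
Lemma hweight_ge_top (x : E) : enorm x ^+ m <= (eps0 ^+ (m - l))^-1 * hweight l m e x.
Proof.
rewrite ler_pdivlMl ?exprn_gt0// /hweight big_nat_recr//=.
have h : eps0 ^+ (m - l) * enorm x ^+ m <= e ^+ (m - l) * enorm x ^+ m.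
  rewrite ler_wpM2r ?exprn_ge0 ?enorm_ge0//.
  by apply: lerXn2r => //; rewrite nnegrE ltW.
rewrite (le_trans h)// addrA lerDr addr_ge0// sumr_ge0//.
Qed.

(** A monomial of degree below m gains a full factor 1 + |x| against the weight: for |x| <= 1 the
    constant term of the weight suffices, beyond that its top term does. *)
Lemma hweight_lower_order (x : E) t : (t < m)%N ->
  enorm x ^+ t * (1 + enorm x) <= 2 * (1 + (eps0 ^+ (m - l))^-1) * hweight l m e x.
Proof.
move=> tm; have x0 := enorm_ge0 x.
have [x1|/ltW x1] := leP (enorm x) 1.
  have a : enorm x ^+ t * (1 + enorm x) <= 2.
    rewrite (_ : (2 : R) = 1 * (1 + 1)); last by ring.
    by rewrite ler_pM ?exprn_ge0 ?addr_ge0 ?exprn_ile1// lerD2l.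
  rewrite (le_trans a)// -mulrA ler_peMr// mulr_ege1 ?hweight_ge1//.
  by rewrite lerDl invr_ge0 exprn_ge0// ltW.
have a : enorm x ^+ t * (1 + enorm x) <= 2 * enorm x ^+ m.
  have h1 : enorm x ^+ t <= enorm x ^+ m by rewrite ler_weXn2l// ltnW.
  have h2 : enorm x ^+ t.+1 <= enorm x ^+ m by rewrite ler_weXn2l.
  by rewrite mulrDr mulr1 -exprSr; lra.
rewrite (le_trans a)// -mulrA ler_wpM2l// (le_trans (hweight_ge_top x))//.
by rewrite ler_wpM2r ?(le_trans ler01 (hweight_ge1 x))// lerDr.
Qed.

(** For |x| >= 1 every power in the weight is at most |x|^m; the upper bound on eps makes the
    constant uniform in n. *)
Lemma hweight_le_top (x : E) : 1 <= enorm x ->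
  hweight l m e x <= (1 + \sum_(l <= s < m.+1) epsoo ^+ (s - l)) * enorm x ^+ m.
Proof.
move=> x1; have x0 := enorm_ge0 x.
rewrite /hweight mulrDl mul1r lerD ?exprn_ege1// mulr_suml big_nat [leRHS]big_nat.
apply: ler_sum => s /andP[_]; rewrite ltnS => sm; apply: ler_pM.
- by rewrite exprn_ge0// ltW.
- by rewrite exprn_ge0.
- by apply: lerXn2r => //; rewrite nnegrE ltW// (lt_le_trans e_gt0).
- by rewrite ler_weXn2l.
Qed.

Lemma measurable_hweight : measurable_fun setT (@hweight R d l m e).
Proof.
apply: measurable_funD; first exact: measurable_cst.
apply: measurable_sum => s; apply: measurable_funM; first exact: measurable_cst.
by apply: measurable_funX; exact: measurable_enorm.
Qed.

End weights.

Section moving_coefficient.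
Variables (R : realType) (d : nat).
Local Notation E := 'rV[R]_d.
Local Notation leb := (lebesgue_rV R d).
Variables (Om : set E) (oOm : open Om).
Variables (r : nat) (u : nat -> E -> 'cV[R[i]]_r) (wu : weakly_null Om u).
Variables (K : set E) (cK : compact K) (KO : K `<=` Om).

Lemma fourierB (f g : E -> R[i]) y : cintegrable leb f -> cintegrable leb g ->
  fourier (fun x => f x - g x) y = fourier f y - fourier g y.
Proof.
move=> fi gi; rewrite !fourierE -cintB; [|exact: cintegrable_ceM..].
by apply: eq_cint => x; rewrite mulrBr.
Qed.

Section local_coefficient.
Variables (c : E -> R[i]) (cc : ccontinuous Om c) (c0 : forall x, ~ K x -> c x = 0).

Lemma Cc_local : Cc Om c.
Proof. by split; [apply/ccontP; exact: (glue_ccont oOm cK KO)|exists K]. Qed.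

Lemma cintegrable_local_mul n i : cintegrable leb (fun x => c x * u n x i ord0).
Proof. exact: (cintegrable_mul_Cc oOm wu Cc_local). Qed.

Lemma sqint_fourier_local n i : (sqint (fourier (fun x => (c x * u n x i ord0)%R)) < +oo)%E.
Proof.
have [_ [C HC]] := L2bdd_fourier (fun n => cintegrable_local_mul n i) (L2bdd_mul_Cc oOm wu Cc_local i).
by rewrite (le_lt_trans (HC n))// ltry.
Qed.

End local_coefficient.

Variables (c : nat -> E -> R[i]) (cc : forall n, ccontinuous Om (c n))
  (c0 : forall n x, ~ K x -> c n x = 0).
Variables (a : E -> R[i]) (ca : ccontinuous Om a) (a0 : forall x, ~ K x -> a x = 0).
Hypothesis cvg_ca : forall s : R, 0 < s ->
  \forall n \near \oo, forall x, K x -> normc (c n x - a x) <= s.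
Variable i : 'I_r.

Lemma L2null_fourier_moving : L2null (fun n x =>
  fourier (fun x => c n x * u n x i ord0) x - fourier (fun x => a x * u n x i ord0) x).
Proof.
have ccD n : ccontinuous Om (fun x => c n x - a x).
  apply: ccontinuous_within; apply: ccontD.
    by apply: (glue_ccont oOm cK KO (cc n)); exact: c0.
  by apply: ccontN; apply: (glue_ccont oOm cK KO ca).
have cD0 n x : ~ K x -> c n x - a x = 0 by move=> Kx; rewrite c0// a0// subrr.
have [_] := L2null_fourier_vanishing oOm wu i cK KO ccD cD0 cvg_ca.
apply: eq_L2null => n x; rewrite -fourierB; last 2 first.
- by apply: cintegrable_local_mul; [exact: cc|exact: c0].
- exact: cintegrable_local_mul.
by rewrite (_ : (fun y => (c n y - a y) * _) = (fun y => c n y * u n y i ord0 - a y * u n y i ord0))//;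
  apply/funext => y; rewrite mulrBl.
Qed.

(** Write c_n = a + (c_n - a): the fixed coefficient is handled by the decay of the multiplier, the
    difference by its smallness and the bound M on the multiplier. *)
Lemma L2null_multiplier_moving (b : nat -> E -> R[i]) (M : R) : (forall n, cmeas (b n)) ->
  (forall n x, normc (b n x) <= M * (1 + enorm x)^-1) ->
  L2null (fun n x => b n x * fourier (fun x => c n x * u n x i ord0) x).
Proof.
move=> mb bM.
have h1 := L2null_multiplier_fourier oOm wu (Cc_local ca a0) i mb bM.
have M0 : 0 <= M.
  have := bM 0%N 0; rewrite -(@ler_pM2r _ (1 + enorm (0 : E))) ?ltr_pwDl ?enorm_ge0//.
  rewrite -mulrA mulVf ?gt_eqF ?ltr_pwDl ?enorm_ge0// mulr1; apply: le_trans.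
  by rewrite mulr_ge0 ?normc_ge0// addr_ge0 ?enorm_ge0.
have bb n x : normc (b n x) <= M.
  rewrite (le_trans (bM n x))// ler_piMr// invf_le1 ?lerDl ?enorm_ge0//.
  by rewrite ltr_pwDl ?enorm_ge0.
have h2 := L2nullM mb bb L2null_fourier_moving.
apply: eq_L2null (L2nullD h1 h2) => n x /=.
by rewrite mulrBr addrC subrK.
Qed.

End moving_coefficient.

Section finite_energy.
Variables (R : realType) (d : nat).
Local Notation E := 'rV[R]_d.
Implicit Types f b : E -> R[i].

Definition sqfin f := cmeas f /\ (sqint f < +oo)%E.

Lemma sqfin_sum (I : Type) (s : seq I) (P : pred I) (F : I -> E -> R[i]) :
  (forall i, P i -> sqfin (F i)) -> sqfin (fun x => \sum_(i <- s | P i) F i x).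
Proof.
move=> FF; elim: s => [|i s IH].
  under eq_fun do rewrite big_nil; split; first exact: cmeas_cst.
  by rewrite /sqint; under eq_integral do rewrite normc0 expr0n/=; rewrite integral0 ltry.
have [ms fs] := IH; case: (boolP (P i)) => Pi; last first.
  by under eq_fun do rewrite big_cons (negbTE Pi).
have [mF fF] := FF i Pi; under eq_fun do rewrite big_cons Pi.
split; first exact: cmeasD.
rewrite (le_lt_trans (sqintD mF ms))// lte_add_pinfty// lte_mul_pinfty//.
Qed.

Lemma sqfinM b f (M : R) : cmeas b -> (forall x, normc (b x) <= M) -> sqfin f ->
  sqfin (fun x => b x * f x).
Proof.
move=> mb bM [mf ff]; have mbf := cmeasM mb mf; split => //.
rewrite (le_lt_trans (sqint_le (M := M) mbf mf _))//.
  by move=> x; rewrite normcM ler_wpM2r ?normc_ge0.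
by rewrite lte_mul_pinfty// ?lee_fin ?sqr_ge0.
Qed.

End finite_energy.

(** * An explicit Fourier transform for phi f_n *)

Section explicit_transform.
Variables (R : realType) (d m l q r : nat).
Local Notation E := 'rV[R]_d.
Local Notation leb := (lebesgue_rV R d).
Variables (Om : set E) (oOm : open Om).
Variables (u : nat -> E -> 'cV[R[i]]_r) (wu : weakly_null Om u).
Variables (phi : E -> R[i]) (K : set E) (cK : compact K) (KO : K `<=` Om)
  (sphi : smooth phi) (phi0 : forall x, ~ K x -> phi x = 0).

(** One Leibniz term for phi . hat theta: the derivatives in [p.1] fall on phi, those in [p.2] on
    hat theta, where they become the factor [monomial p.2] before the transform. *)
Definition product_term (B : E -> 'M[R[i]]_(q, r)) (v : E -> 'cV[R[i]]_r) k
    (p : seq 'I_d * seq 'I_d) (xi : E) : R[i] :=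
  monomial p.2 xi *
  \sum_(i < r) fourier (fun x => cpartials p.1 phi x * B x k i * v x i ord0) xi.

Definition product_transform (e : R) (B : mi_le d m -> E -> 'M[R[i]]_(q, r))
    (v : E -> 'cV[R[i]]_r) k (xi : E) : R[i] :=
  \sum_(a : mi_le d m | (l <= mi_len a <= m)%N)
    (e ^+ (mi_len a - l))%:C * (-1) ^+ mi_len a *
    \sum_(p <- splits (mi_seq (mi_val a))) product_term (B a) v k p xi.

Section coefficient.
Variables (B : E -> 'M[R[i]]_(q, r)) (k : 'I_q).
Hypothesis cB : forall i, ccontinuous Om (fun x => B x k i).

Lemma coefficient_outside s i x : ~ K x -> cpartials s phi x * B x k i = 0.
Proof.
move=> Kx; have cl : closed K by exact: compact_closed.
by rewrite (cpartials_outside s cl phi0 Kx) mul0r.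
Qed.

Lemma ccontinuousM_within (f g : E -> R[i]) : ccont f -> ccontinuous Om g ->
  ccontinuous Om (fun x => f x * g x).
Proof.
move=> [f1 f2] [g1 g2]; move: g1 g2; rewrite !continuous_open_subspace// => g1 g2.
split; rewrite continuous_open_subspace// => x xO.
  under eq_fun do rewrite ReM.
  exact: (cvgB (cvgM (f1 x) (g1 x xO)) (cvgM (f2 x) (g2 x xO))).
under eq_fun do rewrite ImM.
exact: (cvgD (cvgM (f1 x) (g2 x xO)) (cvgM (f2 x) (g1 x xO))).
Qed.

Lemma ccontinuous_coefficient s i : ccontinuous Om (fun x => cpartials s phi x * B x k i).
Proof. by apply: ccontinuousM_within => //; apply: smooth_ccont; exact: smooth_cpartials. Qed.

Lemma cintegrable_coefficient s i n :
  cintegrable leb (fun x => cpartials s phi x * B x k i * u n x i ord0).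
Proof.
apply: (cintegrable_local_mul oOm wu cK KO (ccontinuous_coefficient s i)).
exact: coefficient_outside.
Qed.

Lemma sqint_fourier_coefficient s i n :
  (sqint (fourier (fun x => (cpartials s phi x * B x k i * u n x i ord0)%R)) < +oo)%E.
Proof.
apply: (sqint_fourier_local oOm wu cK KO (ccontinuous_coefficient s i)).
exact: coefficient_outside.
Qed.

Lemma cmeas_product_term p n : cmeas (product_term B (u n) k p).
Proof.
apply: cmeasM; first exact: cmeas_monomial.
by apply: cmeas_sum => i _; apply: cmeas_fourier; exact: cintegrable_coefficient.
Qed.

Lemma cint_product_term p n th : rapid th ->
  let v x := (B x *m u n x) k ord0 * (cpartials p.1 phi x * cpartials p.2 (fourier th) x) in
  [/\ cintegrable leb (fun xi => product_term B (u n) k p xi * th xi), cintegrable leb v &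
  cint leb (fun xi => product_term B (u n) k p xi * th xi) = cint leb v].
Proof.
move=> rth v; have im := rapid_cintegrable (rapid_monomial p.2 rth).
pose F i x := cpartials p.1 phi x * B x k i * u n x i ord0.
have iF i : cintegrable leb (F i) := cintegrable_coefficient p.1 i n.
have E1 xi : product_term B (u n) k p xi * th xi =
    \sum_(i < r) fourier (F i) xi * (monomial p.2 xi * th xi).
  by rewrite /product_term mulrAC mulrC mulr_suml.
have i1 i : cintegrable leb (fun xi => fourier (F i) xi * (monomial p.2 xi * th xi)).
  apply: cintegrableMl im; first exact: cmeas_fourier.
  by move=> x; apply: normc_fourier_le.
have E2 x : v x = \sum_(i < r) F i x * fourier (fun xi => monomial p.2 xi * th xi) x.
  rewrite /v cpartials_fourier// mxE mulr_suml; apply: eq_bigr => i _.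
  by rewrite /F; ring.
have i2 i : cintegrable leb (fun x => F i x * fourier (fun xi => monomial p.2 xi * th xi) x).
  under eq_fun do rewrite mulrC; apply: cintegrableMl (iF i); first exact: cmeas_fourier.
  by move=> x; apply: normc_fourier_le.
rewrite (funext E1) (funext E2); split; try exact: cintegrable_sum.
rewrite !cint_sum//; apply: eq_bigr => i _; exact: cint_fourierM.
Qed.

End coefficient.

Variables (e : R) (B : mi_le d m -> E -> 'M[R[i]]_(q, r)) (f : 'I_q -> (E -> R[i]) -> R[i]).
Hypothesis cB : forall a : mi_le d m, (l <= mi_len a <= m)%N ->
  forall k i, ccontinuous Om (fun x => B a x k i).

Lemma sqrt_weight_ge1 (x : E) : 1 <= Num.sqrt (1 + enorm x ^+ 2).
Proof. by rewrite -[leLHS]sqrtr1 ler_wsqrtr// lerDl sqr_ge0. Qed.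

Lemma enorm_le_weight (x : E) t : (t <= m)%N ->
  enorm x ^+ t <= Num.sqrt (1 + enorm x ^+ 2) ^+ m.
Proof.
move=> tm; have s1 := sqrt_weight_ge1 x.
rewrite (@le_trans _ _ (Num.sqrt (1 + enorm x ^+ 2) ^+ t))//; last by rewrite ler_weXn2l.
apply: lerXn2r; rewrite ?nnegrE ?enorm_ge0 ?sqrtr_ge0//.
by rewrite -[leLHS]ger0_norm ?enorm_ge0// -sqrtr_sqr ler_wsqrtr// lerDr.
Qed.

(** The integrability required by [Hneg_fourier]: all monomials have degree at most m and are
    absorbed by (1 + |x|^2)^(m/2), leaving transforms of L^2 functions. *)
Lemma product_transform_sqfin k n : sqfin (fun xi =>
  ((Num.sqrt (1 + enorm xi ^+ 2) ^+ m)^-1)%:C * product_transform e B (u n) k xi).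
Proof.
pose w (xi : E) := ((Num.sqrt (1 + enorm xi ^+ 2) ^+ m)^-1)%:C : R[i].
have mw : cmeas w.
  apply: cmeas_real; apply: measurable_invr => [x|]; first by rewrite exprn_ge0 ?sqrtr_ge0.
  apply: measurable_funX; apply: (measurableT_comp (f := @Num.sqrt R)).
    by apply: continuous_measurable_fun; exact: sqrt_continuous.
  by apply: measurable_funD => //; apply: measurable_funX; exact: measurable_enorm.
have -> : (fun xi => w xi * product_transform e B (u n) k xi) = (fun xi =>
    \sum_(a : mi_le d m | (l <= mi_len a <= m)%N) \sum_(p <- splits (mi_seq (mi_val a)) | (size p.2 <= m)%N)
    ((e ^+ (mi_len a - l))%:C * (-1) ^+ mi_len a * (w xi * monomial p.2 xi)) *
    \sum_(i < r) fourier (fun x => cpartials p.1 phi x * B a x k i * u n x i ord0) xi).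
  apply/funext => xi; rewrite mulr_sumr; apply: eq_bigr => a /andP[_ am].
  rewrite !mulr_sumr big_seq [RHS]big_mkcond [RHS]big_seq; apply: eq_bigr => p ps.
  rewrite (leq_trans (splits_size ps)) ?size_mi_seq//.
  by rewrite /product_term; ring.
apply: sqfin_sum => a la; apply: sqfin_sum => p pm.
apply: (@sqfinM _ _ _ _ (normc ((e ^+ (mi_len a - l))%:C * (-1) ^+ mi_len a) * (2 * pi) ^+ size p.2)).
- apply: cmeasM; first exact: cmeas_cst.
  by apply: cmeasM => //; exact: cmeas_monomial.
- move=> x; rewrite normcM ler_wpM2l ?normc_ge0// normcM normcR.
  have s0 : 0 < Num.sqrt (1 + enorm x ^+ 2) ^+ m.
    by rewrite exprn_gt0// (lt_le_trans ltr01)// sqrt_weight_ge1.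
  rewrite (ger0_norm (ltW _)) ?invr_gt0// ler_pdivrMl//.
  rewrite (le_trans (normc_monomial_le _ _))// mulrC ler_wpM2r ?exprn_ge0 ?mulr_ge0 ?pi_ge0//.
  exact: enorm_le_weight.
- apply: sqfin_sum => i _; split.
    by apply: cmeas_fourier; apply: cintegrable_coefficient; exact: cB.
  by apply: sqint_fourier_coefficient; exact: cB.
Qed.

Lemma cmeas_product_transform k n : cmeas (product_transform e B (u n) k).
Proof.
apply: cmeas_sum => a la; apply: cmeasM; first exact: cmeas_cst.
by apply: cmeas_sum => p _; apply: cmeas_product_term; exact: cB.
Qed.

Lemma Hneg_product_transform k n : pde_solution Om l e B (u n) f ->
  Hneg_fourier m (distr_mul phi (f k)) (product_transform e B (u n) k).
Proof.
move=> pde; split.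
- exact: cmeas_product_transform.
- have [_] := product_transform_sqfin k n; rewrite /sqint.
  rewrite (_ : (fun x => _) = (fun xi : E => (normc (product_transform e B (u n) k xi) ^+ 2 / (1 + enorm xi ^+ 2) ^+ m)%:E))//.
  apply/funext => x; congr (_%:E).
  have h0 : 0 <= 1 + enorm x ^+ 2 by rewrite addr_ge0 ?sqr_ge0.
  rewrite normcM normcR ger0_norm ?invr_ge0 ?exprn_ge0 ?sqrtr_ge0// exprMn mulrC.
  by rewrite exprVn -exprM mulnC exprM sqr_sqrtr.
move=> th /schwartz_rapid rth; have sF := smooth_fourier rth.
(* The equation may be tested with this product because phi supplies the compact support that hat
   theta lacks. *)
have tf : test_fun Om (fun x => phi x * fourier th x).
  split; first exact: smoothM.
  by exists K => // x Kx; rewrite phi0// mul0r.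
rewrite /distr_mul -pde//.
have H a (la : (l <= mi_len a <= m)%N) p := cint_product_term (cB la k) p n rth.
have -> : cintegral (fun xi => product_transform e B (u n) k xi * th xi) =
  cint leb (fun xi => \sum_(a : mi_le d m | (l <= mi_len a <= m)%N)
    (e ^+ (mi_len a - l))%:C * (-1) ^+ mi_len a *
    \sum_(p <- splits (mi_seq (mi_val a))) (product_term (B a) (u n) k p xi * th xi)).
  apply: eq_cint => xi; rewrite mulr_suml; apply: eq_bigr => a _.
  by rewrite -mulrA mulr_suml.
have i1 a : (l <= mi_len a <= m)%N -> forall p,
    cintegrable leb (fun xi => product_term (B a) (u n) k p xi * th xi).
  by move=> la p; have [] := H a la p.
rewrite cint_sum; last first.
  by move=> a la; apply: cintegrableZ; apply: cintegrable_sum => p _; exact: i1.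
apply: eq_bigr => a la; rewrite cintZ; last first.
  by apply: cintegrable_sum => p _; exact: i1.
congr (_ * _); rewrite cint_sum; last by move=> p _; exact: i1.
under eq_bigr => p _ do have [_ _ ->] := H a la p.
rewrite -cint_sum; last by move=> p _; have [] := H a la p.
apply: eq_cint => x; rewrite /mi_partial cpartials_mul// mulr_sumr.
by [].
Qed.

End explicit_transform.

(** * The principal symbol *)

Section principal_part.
Variables (R : realType) (d m l q r : nat) (lm : (l <= m)%N).
Local Notation E := 'rV[R]_d.
Local Notation leb := (lebesgue_rV R d).
Variables (Om : set E) (oOm : open Om).
Variables (u : nat -> E -> 'cV[R[i]]_r) (wu : weakly_null Om u).
Variables (eps : nat -> R) (eps0 epsoo : R) (eps0_gt0 : 0 < eps0)
  (eps_bnd : forall n, eps0 <= eps n <= epsoo).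
Variables (A_ : nat -> mi_le d m -> E -> 'M[R[i]]_(q, r)) (A : mi_le d m -> E -> 'M[R[i]]_(q, r)).
Hypothesis A_cont : forall n (a : mi_le d m), (l <= mi_len a <= m)%N ->
  forall k i, ccontinuous Om (fun x => A_ n a x k i).
Hypothesis A_cvg : forall a : mi_le d m, (l <= mi_len a <= m)%N ->
  cvg_loc_unif Om (fun n => A_ n a) (A a).
Variables (f : nat -> 'I_q -> (E -> R[i]) -> R[i]).
Hypotheses (f_null : hweight_null Om l m eps f)
  (pde : forall n, pde_solution Om l (eps n) (A_ n) (u n) (f n)).

Lemma enormZ (c : R) (x : E) : enorm (c *: x) = `|c| * enorm x.
Proof.
rewrite /enorm -sqrtr_sqr -sqrtrM ?sqr_ge0//; congr Num.sqrt.
by rewrite /edot mulr_sumr; apply: eq_bigr => i _; rewrite !mxE; ring.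
Qed.

(** Equality fails at x = 0 only, where the inverse takes its default value 0. *)
Lemma enorm_direction_le1 (x : E) : enorm ((enorm x)^-1 *: x) <= 1.
Proof.
rewrite enormZ ger0_norm ?invr_ge0 ?enorm_ge0//.
by have [->|x0] := eqVneq (enorm x) 0; [rewrite mulr0|rewrite mulVf].
Qed.

Lemma limit_ccontinuous (a : mi_le d m) k i : (l <= mi_len a <= m)%N ->
  ccontinuous Om (fun x => A a x k i).
Proof.
move=> la; apply: (locally_uniform_ccontinuous oOm (f_ := fun n x => A_ n a x k i)) => [n|K cK KO e e0].
  exact: A_cont.
by apply: filterS (A_cvg la cK KO e0) => n H x Kx; exact: H.
Qed.

Variables (phi : E -> R[i]) (K : set E) (cK : compact K) (KO : K `<=` Om)
  (sphi : smooth phi) (phi0 : forall x, ~ K x -> phi x = 0) (k : 'I_q).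

Let tphi : test_fun Om phi. Proof. by split => //; exists K. Qed.

Let eps_gt0 n : 0 < eps n.
Proof. by have /andP[h _] := eps_bnd n; exact: lt_le_trans h. Qed.

Let hw n := @hweight R d l m (eps n).

Let hw_gt0 n x : 0 < hw n x.
Proof.
have /andP[h _] := eps_bnd n; apply: lt_le_trans ltr01 _.
exact: (hweight_ge1 l m eps0_gt0 h).
Qed.

Let cmeas_hwV n : cmeas (fun x => ((hw n x)^-1)%:C : R[i]).
Proof. by apply: cmeas_real; apply: measurable_invr => [x|]; [exact: ltW|exact: measurable_hweight]. Qed.

Let coef_cvg (a : mi_le d m) s i : (l <= mi_len a <= m)%N -> forall e : R, 0 < e ->
  \forall n \near \oo, forall x, K x ->
    normc (cpartials s phi x * A_ n a x k i - cpartials s phi x * A a x k i) <= e.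
Proof.
move=> la e e0.
have cs := smooth_ccont (smooth_cpartials s sphi).
have [B B0 HB] := cbounded_compact cK KO (ccontinuous_within Om cs).
have eB : 0 < e / (B + 1) by rewrite divr_gt0// ltr_wpDl.
apply: filterS (A_cvg la cK KO eB) => n H x Kx.
rewrite -mulrBr normcM (@le_trans _ _ (B * (e / (B + 1))))//.
  by rewrite ler_pM ?normc_ge0 ?HB// ltW// H.
by rewrite mulrCA ler_piMr ?ltW// ltr_pdivrMr ?mul1r ?ltrDl// ltr_wpDl.
Qed.

Let F n (a : mi_le d m) s i := fourier (fun x => cpartials s phi x * A_ n a x k i * u n x i ord0).

(** [f_null] is stated for any choice of Fourier transforms of the components; it is applied to the
    explicit one, and the k-th square is bounded by the sum over all components. *)
Lemma L2null_quotient : L2null (fun n x =>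
  ((hw n x)^-1)%:C * product_transform l phi (eps n) (A_ n) (u n) k x).
Proof.
pose g n k := product_transform l phi (eps n) (A_ n) (u n) k.
have mg n k' : cmeas (g n k') by apply: (cmeas_product_transform oOm wu cK KO sphi phi0); exact: A_cont.
have := f_null tphi (g := g); have Hn n k' : Hneg_fourier m (distr_mul phi (f n k')) (g n k').
  apply: (Hneg_product_transform oOm wu cK KO sphi phi0) (pde n); exact: A_cont.
move=> /(_ Hn) lim.
have mh n : cmeas (fun x => ((hw n x)^-1)%:C * g n k x) by exact: cmeasM.
split => //; apply: (squeeze0 _ _ lim) => [n|]; first exact: sqint_ge0.
apply: nearW => n; apply: ge0_le_integral => //.
- by move=> x _; rewrite lee_fin sqr_ge0.
- exact: measurable_sqint.
- apply/measurable_EFinP; apply: measurable_funM.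
    by apply: measurable_sum => j; exact: measurable_normc2.
  apply: measurable_invr => [x|]; first by rewrite sqr_ge0.
  by apply: measurable_funX; exact: measurable_hweight.
move=> x _; rewrite lee_fin normcM normcR ger0_norm ?invr_ge0 ?(ltW (hw_gt0 n x))// exprMn exprVn mulrC.
apply: ler_wpM2r; rewrite ?invr_ge0 ?sqr_ge0// (bigD1 k)//= lerDl sumr_ge0// => j _; exact: sqr_ge0.
Qed.

(** By [hweight_lower_order] the multiplier is O(1/(1 + |x|)) uniformly in n; the power of eps is
    bounded through [epsoo]. *)
Lemma L2null_lower_order (a : mi_le d m) p i : (l <= mi_len a <= m)%N -> (size p.2 < m)%N ->
  L2null (fun n x => ((hw n x)^-1)%:C *
    ((eps n ^+ (mi_len a - l))%:C * (-1) ^+ mi_len a * monomial p.2 x) * F n a p.1 i x).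
Proof.
move=> la pm.
pose M := epsoo ^+ (mi_len a - l) * (2 * pi) ^+ size p.2 * (2 * (1 + (eps0 ^+ (m - l))^-1)).
apply: (@L2null_multiplier_moving _ _ _ oOm _ _ wu K cK KO
  (fun n x => cpartials p.1 phi x * A_ n a x k i) _ _
  (fun x => cpartials p.1 phi x * A a x k i) _ _ _ i _ M).
- by move=> n; apply: (ccontinuous_coefficient oOm sphi) => j; exact: A_cont.
- by move=> n x; by move=> Kx; exact: (coefficient_outside cK phi0).
- by apply: (ccontinuous_coefficient oOm sphi) => j; exact: limit_ccontinuous.
- by move=> x; by move=> Kx; exact: (coefficient_outside cK phi0).
- exact: coef_cvg.
- move=> n; apply: cmeasM; first exact: cmeas_hwV.
  by apply: cmeasM; [exact: cmeas_cst|exact: cmeas_monomial].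
move=> n x; have /andP[e0 eoo] := eps_bnd n; have x0 := enorm_ge0 x.
have low := hweight_lower_order lm eps0_gt0 e0 x pm.
have x1 : 0 < 1 + enorm x by rewrite ltr_pwDl.
rewrite !normcM !normcR normcX normcN [normc 1](normcR 1) normr1 expr1n mulr1.
rewrite !ger0_norm ?invr_ge0 ?exprn_ge0 ?(ltW (hw_gt0 _ _)) ?(ltW (eps_gt0 n))//.
rewrite ler_pdivlMr// -mulrA ler_pdivrMl// -mulrA.
have e1 : eps n ^+ (mi_len a - l) <= epsoo ^+ (mi_len a - l).
  by apply: lerXn2r => //; rewrite nnegrE ltW// (lt_le_trans (eps_gt0 n)).
have h2 : normc (monomial p.2 x) * (1 + enorm x) <=
    (2 * pi) ^+ size p.2 * (2 * (1 + (eps0 ^+ (m - l))^-1) * hw n x).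
  rewrite (le_trans (ler_wpM2r (ltW x1) (normc_monomial_le p.2 x)))// -[leLHS]mulrA.
  by apply: ler_wpM2l => //; rewrite exprn_ge0// mulr_ge0// pi_ge0.
have h3 := ler_pM (exprn_ge0 _ (ltW (eps_gt0 n))) (mulr_ge0 (normc_ge0 _) (ltW x1)) e1 h2.
by apply: (le_trans h3); rewrite /M le_eqVlt; apply/orP; left; apply/eqP; ring.
Qed.

Definition direction_symbol (a : mi_le d m) (x : E) : R[i] :=
  (0 +i* (2 * pi)) ^+ m * (\prod_(i < d) ((enorm x)^-1 *: x) ord0 i ^+ mi_val a i)%:C.

(** The first sum keeps |a| = m with no derivative on phi. The second collects every other term:
    those with |a| < m, and those with |a| = m where phi is differentiated at least once. *)
Lemma product_transform_split n x :
  product_transform l phi (eps n) (A_ n) (u n) k x =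
  (\sum_(a : mi_le d m | mi_len a == m) \sum_(i < r)
     (eps n ^+ (m - l))%:C * ((0 +i* (2 * pi)) ^+ m *
     (\prod_(j < d) x ord0 j ^+ mi_val a j)%:C) * F n a [::] i x) +
  \sum_(a : mi_le d m | (l <= mi_len a <= m)%N)
     \sum_(p <- splits (mi_seq (mi_val a)) | (size p.2 < m)%N) \sum_(i < r)
     (eps n ^+ (mi_len a - l))%:C * (-1) ^+ mi_len a * monomial p.2 x * F n a p.1 i x.
Proof.
have T (a : mi_le d m) p : (eps n ^+ (mi_len a - l))%:C * (-1) ^+ mi_len a *
    product_term phi (A_ n a) (u n) k p x =
  \sum_(i < r) (eps n ^+ (mi_len a - l))%:C * (-1) ^+ mi_len a * monomial p.2 x * F n a p.1 i x.
  by rewrite /product_term !mulr_sumr; apply: eq_bigr => i _; rewrite !mulrA.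
rewrite /product_transform (bigID (fun a : mi_le d m => mi_len a == m))/=.
rewrite [X in _ = _ + X](bigID (fun a : mi_le d m => mi_len a == m))/= addrA.
congr (_ + _); last first.
  apply: eq_bigr => a /andP[/andP[_ am] an]; rewrite mulr_sumr big_seq [RHS]big_mkcond [RHS]big_seq.
  apply: eq_bigr => p ps; rewrite T ifT//.
  rewrite (leq_ltn_trans (splits_size ps))// size_mi_seq -/(mi_len a) ltn_neqAle an.
  exact: am.
have PE : (fun a : mi_le d m => (l <= mi_len a <= m)%N && (mi_len a == m)) =1 (fun a => mi_len a == m).
  by move=> a /=; case: eqP => [->|]; rewrite ?andbF// lm leqnn.
rewrite !(eq_bigl _ _ PE) -big_split/=; apply: eq_bigr => a /eqP am.
have sa : size (mi_seq (mi_val a)) = m by rewrite size_mi_seq; exact: am.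
rewrite sum_splits sa mulrDr; congr (_ + _).
  have mono := monomial_mi_seq (mi_val a) x; rewrite -/(mi_len a) am in mono.
  by rewrite T; apply: eq_bigr => i _; rewrite am/= -mono mulrA.
by rewrite mulr_sumr; apply: eq_bigr => p _; rewrite T.
Qed.

Lemma L2null_principal : L2null (fun n x => ((hw n x)^-1 * eps n ^+ (m - l))%:C *
  \sum_(a : mi_le d m | mi_len a == m) \sum_(i < r) (0 +i* (2 * pi)) ^+ m *
     (\prod_(j < d) x ord0 j ^+ mi_val a j)%:C * F n a [::] i x).
Proof.
have low : L2null (fun n x => \sum_(a : mi_le d m | (l <= mi_len a <= m)%N)
    \sum_(p <- splits (mi_seq (mi_val a)) | (size p.2 < m)%N) \sum_(i < r)
    ((hw n x)^-1)%:C * ((eps n ^+ (mi_len a - l))%:C * (-1) ^+ mi_len a * monomial p.2 x) * F n a p.1 i x).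
  apply: L2null_sum => a la; apply: L2null_sum => p pm; apply: L2null_sum => i _.
  exact: L2null_lower_order.
apply: eq_L2null (L2nullD L2null_quotient (L2nullN low)) => n x /=.
rewrite product_transform_split mulrDr.
rewrite [X in _ + X - _ = _](_ : _ = \sum_(a : mi_le d m | (l <= mi_len a <= m)%N)
    \sum_(p <- splits (mi_seq (mi_val a)) | (size p.2 < m)%N) \sum_(i < r)
    ((hw n x)^-1)%:C * ((eps n ^+ (mi_len a - l))%:C * (-1) ^+ mi_len a * monomial p.2 x) * F n a p.1 i x); last first.
  rewrite mulr_sumr; apply: eq_bigr => a _; rewrite mulr_sumr; apply: eq_bigr => p _.
  by rewrite mulr_sumr; apply: eq_bigr => i _; rewrite !mulrA.
rewrite addrK real_complexM -mulrA; congr (_ * _).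
rewrite mulr_sumr; apply: eq_bigr => a _; rewrite mulr_sumr; apply: eq_bigr => i _.
by rewrite !mulrA.
Qed.

Lemma cmeas_direction_symbol a : cmeas (direction_symbol a).
Proof.
apply: cmeasM; first exact: cmeas_cst.
under eq_fun do rewrite real_complex_prod; apply: cmeas_prod => j _.
apply: cmeas_real; apply: measurable_funX; under eq_fun do rewrite mxE.
apply: measurable_funM; last exact: measurable_rV_coord.
by apply: measurable_invr; [exact: enorm_ge0|exact: measurable_enorm].
Qed.

Lemma normc_direction_symbol (a : mi_le d m) x : mi_len a = m ->
  normc (direction_symbol a x) <= (2 * pi) ^+ m.
Proof.
move=> am; rewrite /direction_symbol normcM normcX normcR.
have -> : normc (0 +i* (2 * pi) : R[i]) = 2 * pi.
  have h : normc (0 +i* (2 * pi) : R[i]) ^+ 2 = (2 * pi) ^+ 2.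
    by rewrite normc_sqr/= expr0n add0r.
  by apply/eqP; rewrite -(@eqrXn2 _ 2) ?normc_ge0 ?mulr_ge0 ?pi_ge0//; apply/eqP.
rewrite ler_piMr ?exprn_ge0 ?mulr_ge0 ?pi_ge0//.
rewrite (le_trans (norm_prod_coord_le _ _))// exprn_ile1 ?enorm_ge0//.
exact: enorm_direction_le1.
Qed.

(** For |x| <= 1 the symbol is a bounded multiplier with bounded support, dominated by 2 (2 pi)^m/(1
    + |x|). For |x| > 1 it is the multiplier of [L2null_principal] times [b]. *)
Lemma L2null_symbol_moving : L2null (fun n x =>
  \sum_(a : mi_le d m | mi_len a == m) \sum_(i < r) direction_symbol a x * F n a [::] i x).
Proof.
have mI (b : R -> bool) : measurable_fun setT b -> cmeas (fun x : E => ((b (enorm x))%:R : R)%:C).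
  move=> mb; apply: cmeas_real; apply: (measurableT_comp (f := fun c : bool => c%:R : R)) => //.
  by apply: (measurableT_comp mb); exact: measurable_enorm.
have pim : 0 <= (2 * pi) ^+ m :> R by rewrite exprn_ge0 ?mulr_ge0 ?pi_ge0.
have low : L2null (fun n x => \sum_(a : mi_le d m | mi_len a == m) \sum_(i < r)
    (((enorm x <= 1)%R%:R)%:C * direction_symbol a x) * F n a [::] i x).
  apply: L2null_sum => a /eqP am; apply: L2null_sum => i _.
  have la : (l <= mi_len a <= m)%N by rewrite am lm leqnn.
  apply: (@L2null_multiplier_moving _ _ _ oOm _ _ wu K cK KO
    (fun n x => cpartials [::] phi x * A_ n a x k i) _ _
    (fun x => cpartials [::] phi x * A a x k i) _ _ _ i _ ((2 * pi) ^+ m * 2)).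
  - by move=> n; apply: (ccontinuous_coefficient oOm sphi) => j; exact: A_cont.
  - by move=> n x Kx; exact: (coefficient_outside cK phi0).
  - by apply: (ccontinuous_coefficient oOm sphi) => j; exact: limit_ccontinuous.
  - by move=> x Kx; exact: (coefficient_outside cK phi0).
  - exact: coef_cvg.
  - move=> n; apply: cmeasM; last exact: cmeas_direction_symbol.
    by apply: (mI (fun t => t <= 1)); apply: measurable_fun_ler.
  move=> n x; have x0 := enorm_ge0 x; rewrite normcM normcR.
  rewrite ler_pdivlMr ?ltr_pwDl//.
  have [x1|x1] := leP (enorm x) 1; last by rewrite normr0 !mul0r mulr_ge0.
  by rewrite normr1 mul1r ler_pM ?normc_ge0 ?addr_ge0 ?normc_direction_symbol//; lra.
pose C := 1 + \sum_(l <= s < m.+1) epsoo ^+ (s - l).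
(* Exchanges the weight for eps^(m-l) |x|^m at high frequencies; bounded by [hweight_le_top] and the
   lower bound on eps. *)
pose b n x := (((1 < enorm x)%R%:R * (hw n x * (eps n ^+ (m - l) * enorm x ^+ m)^-1))%:C : R[i]).
have mb n : cmeas (b n).
  rewrite /b; under eq_fun do rewrite real_complexM; apply: cmeasM.
    by apply: (mI (fun t => 1 < t)); apply: measurable_fun_ltr.
  apply: cmeas_real; apply: measurable_funM; first exact: measurable_hweight.
  apply: measurable_invr => [x|].
    by rewrite mulr_ge0 ?exprn_ge0 ?enorm_ge0// (ltW (eps_gt0 n)).
  by apply: measurable_funM => //; apply: measurable_funX; exact: measurable_enorm.
have bB n x : normc (b n x) <= C / eps0 ^+ (m - l).
  have /andP[e0 eoo] := eps_bnd n.
  have oo0 : 0 <= epsoo by rewrite ltW// (lt_le_trans (eps_gt0 n)).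
  have C0 : 0 <= C by rewrite addr_ge0// sumr_ge0// => s _; exact: exprn_ge0.
  have ee0 := exprn_gt0 (m - l) eps0_gt0.
  rewrite /b normcR; have [x1|x1] := ltP 1 (enorm x); last first.
    by rewrite mul0r normr0 divr_ge0 ?(ltW ee0).
  have xm : 0 < enorm x ^+ m by rewrite exprn_gt0// (lt_trans ltr01).
  have en := exprn_gt0 (m - l) (eps_gt0 n).
  rewrite mul1r ger0_norm; last by rewrite divr_ge0 ?mulr_ge0 ?(ltW en) ?(ltW xm) ?(ltW (hw_gt0 n x)).
  rewrite ler_pdivrMr ?mulr_gt0//.
  apply: (le_trans (hweight_le_top l m eps0_gt0 e0 eoo (ltW x1))).
  rewrite -/C mulrA ler_pM2r// -mulrA ler_peMr//.
  rewrite ler_pdivlMl// mulr1; apply: lerXn2r => //; rewrite nnegrE ltW//.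
apply: eq_L2null (L2nullD low (L2nullM mb bB L2null_principal)) => n x /=.
rewrite !mulr_sumr -big_split/=; apply: eq_bigr => a /eqP am.
rewrite !mulr_sumr -big_split/=; apply: eq_bigr => i _; rewrite /b.
have [x1|x1] := leP (enorm x) 1; first by rewrite !mul0r mul1r addr0.
have xm : enorm x ^+ m != 0 by rewrite gt_eqF// exprn_gt0// (lt_trans ltr01).
have en : eps n ^+ (m - l) != 0 by rewrite gt_eqF// exprn_gt0.
have hn : hw n x != 0 by rewrite gt_eqF.
rewrite mul0r mul0r add0r mul1r !mulrA; congr (_ * _).
rewrite /direction_symbol prod_coord_scale -/(mi_len a) am.
rewrite -real_complexM [X in X%:C * _](_ : _ = (enorm x)^-1 ^+ m); last first.
  by rewrite exprVn; field; rewrite xm en hn.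
by rewrite real_complexM mulrA [X in X * _]mulrC.
Qed.

Lemma L2null_symbol : L2null (fun n x =>
  \sum_(a : mi_le d m | mi_len a == m) \sum_(i < r)
    direction_symbol a x * fourier (fun x => phi x * A a x k i * u n x i ord0) x).
Proof.
have D : L2null (fun n x => \sum_(a : mi_le d m | mi_len a == m) \sum_(i < r)
    direction_symbol a x * (F n a [::] i x - fourier (fun x => phi x * A a x k i * u n x i ord0) x)).
  apply: L2null_sum => a /eqP am; apply: L2null_sum => i _.
  have la : (l <= mi_len a <= m)%N by rewrite am lm leqnn.
  apply: (@L2nullM _ _ (fun=> direction_symbol a) _ ((2 * pi) ^+ m)).
  - by move=> n; exact: cmeas_direction_symbol.
  - by move=> n x; exact: normc_direction_symbol.
  apply: (@L2null_fourier_moving _ _ _ oOm _ _ wu K cK KO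
    (fun n x => cpartials [::] phi x * A_ n a x k i) _ _
    (fun x => cpartials [::] phi x * A a x k i)).
  - by move=> n; apply: (ccontinuous_coefficient oOm sphi) => j; exact: A_cont.
  - by move=> n x Kx; exact: (coefficient_outside cK phi0).
  - by apply: (ccontinuous_coefficient oOm sphi) => j; exact: limit_ccontinuous.
  - by move=> x Kx; exact: (coefficient_outside cK phi0).
  - exact: coef_cvg.
apply: eq_L2null (L2nullD L2null_symbol_moving (L2nullN D)) => n x /=.
rewrite -sumrB; apply: eq_bigr => a _; rewrite -sumrB; apply: eq_bigr => i _.
by rewrite -mulrBr opprB addrCA subrr addr0.
Qed.

End principal_part.

(** * The compactification *)

Section within_continuity.
Variable R : realType.

Lemma within_comp (S T : topologicalType) (U : topologicalType) (A : set S) (B : set T)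
    (g : S -> T) (f : T -> U) :
  (forall x, A x -> B (g x)) -> {within A, continuous g} -> {within B, continuous f} ->
  {within A, continuous (f \o g)}.
Proof.
move=> AB /subspace_continuousP cg /subspace_continuousP cf; apply/subspace_continuousP => x Ax.
apply: cvg_comp (cf _ (AB x Ax)) => P; rewrite /within/= => BP.
have := cg x Ax _ BP; rewrite /within/= /nbhs/=; rewrite /within/=.
by apply: filterS => y H Ay; apply: H => //; exact: AB.
Qed.

Lemma ccontinuous_comp (S T : topologicalType) (A : set S) (B : set T)
    (g : S -> T) (f : T -> R[i]) :
  (forall x, A x -> B (g x)) -> {within A, continuous g} -> ccontinuous B f ->
  ccontinuous A (f \o g).
Proof.
move=> AB cg [f1 f2]; split.
  exact: (within_comp AB cg f1).
exact: (within_comp AB cg f2).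
Qed.

Lemma continuous_sum_sqr (T : topologicalType) (I : Type) (s : seq I) (F : I -> T -> R) :
  (forall i, continuous (F i)) -> continuous (fun y => \sum_(i <- s) F i y * F i y).
Proof.
move=> cF; elim: s => [|i s IH] y; rewrite /continuous_at.
  by rewrite big_nil; under eq_fun do rewrite big_nil; exact: cvg_cst.
rewrite big_cons; under eq_fun do rewrite big_cons.
by apply: cvgD; [apply: cvgM; exact: cF|exact: IH].
Qed.

(** Balls of extended reals are measured through [contract], and [contract] after [expand] clamps to
    [-1, 1], a map that is 1-Lipschitz. *)
Lemma continuous_expand : continuous (@expand R).
Proof.
have clamp (s : R) : contract (expand s) = Num.max (-1) (Num.min s 1).
  have [s1|s1] := leP 1 s.
    by rewrite expand1//= max_r// lerN1l.
  have [sN|sN] := leP s (-1).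
    by rewrite expandN1//= max_l.
  rewrite expandK ?inE ?ler_norml ?(ltW s1) ?(ltW sN)//.
move=> r; apply/cvg_ballP => e e0.
have near_r : \forall s \near r, `|r - s| < e.
  by apply/nbhs_ballP; exists e.
apply: filterS near_r => s rs; rewrite /ball/= /ereal_ball !clamp.
apply: le_lt_trans rs.
have lipmax (a b c : R) : `|Num.max a b - Num.max a c| <= `|b - c|.
  have [h1 h2] := (ler_norm (b - c), ler_norm (c - b)); rewrite distrC in h2.
  rewrite ler_norml; move: h1 h2; set t := `|b - c|.
  by case: (leP a b); case: (leP a c) => ? ? ? ?; apply/andP; split; lra.
have lipmin (a b c : R) : `|Num.min b a - Num.min c a| <= `|b - c|.
  have [h1 h2] := (ler_norm (b - c), ler_norm (c - b)); rewrite distrC in h2.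
  rewrite ler_norml; move: h1 h2; set t := `|b - c|.
  by case: (leP b a); case: (leP c a) => ? ? ? ?; apply/andP; split; lra.
exact: le_trans (lipmax _ _ _) (lipmin _ _ _).
Qed.

(* [expand] inverts the map that defines the uniform structure of the extended reals,
   so that the latter are a continuous image of [-1, 1]. *)
Lemma ereal_compact : compact [set: \bar R].
Proof.
rewrite (_ : setT = @expand R @` `[-1, 1]%classic).
  by apply: continuous_compact; [exact/continuous_subspaceT/continuous_expand|exact: segment_compact].
apply/seteqP; split => // x _; exists (contract x); last exact: contractK.
by rewrite /= in_itv/= -ler_norml contract_le1.
Qed.

Variable d : nat.
Local Notation E := 'rV[R]_d.

Lemma continuous_enorm : continuous (@enorm R d).
Proof.
move=> x; apply: continuous_comp; last exact: sqrt_continuous.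
by apply: (@continuous_sum_sqr E _ _ (fun i (y : E) => y ord0 i)) => i; exact: coord_continuous.
Qed.

Lemma norm_le_enorm (x : E) : `|x| <= enorm x.
Proof. by apply: rV_norm_le => [|i]; [exact: enorm_ge0|exact: coord_le_enorm]. Qed.

Lemma closed_sphere : closed [set x : E | enorm x = 1].
Proof.
have -> : [set x : E | enorm x = 1] = @enorm R d @^-1` [set 1] by [].
apply: closed_comp; last exact: closed_eq.
by move=> x _; exact: continuous_enorm.
Qed.

Lemma compact_K0oo : compact (@K0oo R d).
Proof.
have -> : @K0oo R d = [set x : E | enorm x = 1] `*` [set t : \bar R | (0 <= t)%E] by [].
apply: compact_setX.
  apply: bounded_closed_compact; last exact: closed_sphere.
  exists 1; split; first exact: num_real.
  by move=> M M1 x /= x1; rewrite (le_trans (norm_le_enorm x))// x1 ltW.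
by apply: (@subclosed_compact _ _ setT) => //; [exact: closed_ereal_le_ereal|exact: ereal_compact].
Qed.

Lemma enorm_eq0 (x : E) : enorm x = 0 -> x = 0.
Proof.
move=> x0; apply/eqP; rewrite -normr_eq0 eq_le normr_ge0 andbT -x0.
exact: norm_le_enorm.
Qed.

Lemma K0oo_embed_in (x : E) : x != 0 -> K0oo (K0oo_embed x).
Proof.
move=> x0; have e0 : enorm x != 0 by apply: contra x0 => /eqP/enorm_eq0 ->.
split => /=; last by rewrite lee_fin enorm_ge0.
by rewrite enormZ ger0_norm ?invr_ge0 ?enorm_ge0// mulVf.
Qed.

Lemma K0oo_embed_scale (w : R) (x : E) : 0 < w ->
  (K0oo_embed (w *: x)).1 = (enorm x)^-1 *: x.
Proof.
move=> w0; rewrite /= enormZ gtr0_norm// scalerA invfM mulrAC mulVf ?mul1r//.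
by rewrite gt_eqF.
Qed.

Lemma continuous_K0oo_embed (w : R) : 0 < w ->
  {within [set x : E | x != 0], continuous (fun x => K0oo_embed (w *: x))}.
Proof.
move=> w0; apply: continuous_in_subspaceT => x; rewrite inE/= => x0.
have cw : (fun y : E => w *: y) @ x --> w *: x by exact: scaler_continuous.
have ce : (fun y : E => enorm (w *: y)) @ x --> enorm (w *: x).
  by apply: (cvg_comp _ _ cw); exact: continuous_enorm.
have e0 : enorm (w *: x) != 0.
  by apply/eqP => /enorm_eq0/eqP; rewrite scaler_eq0 gt_eqF//= (negbTE x0).
have FF := nbhs_filter x.
have h1 : (fun y : E => (enorm (w *: y))^-1 *: (w *: y)) @ x --> (enorm (w *: x))^-1 *: (w *: x).
  by apply: (@cvgZ _ _ _ _ FF) => //; exact: (@cvgV _ _ _ FF).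
have h2 : (fun y : E => (enorm (w *: y))%:E) @ x --> (enorm (w *: x))%:E.
  by apply: (@cvg_EFin _ _ _ FF); [exact: nearW|exact: ce].
exact: (cvg_pair h1 h2).
Qed.

(** Continuity of psi says nothing at x = 0, which is embedded outside [K0oo]; a single point is
    measurable and is glued separately. *)
Lemma cmeas_K0oo (w : R) (psi : E * \bar R -> R[i]) : 0 < w -> ccontinuous (@K0oo R d) psi ->
  cmeas (fun x : E => psi (K0oo_embed (w *: x))).
Proof.
move=> w0 cpsi; have o0 : open [set x : E | x != 0].
  rewrite (_ : [set x : E | x != 0] = ~` [set 0]); last by apply/seteqP; split => x /= /eqP.
  have cl : closed [set (0 : E)] by apply: compact_closed => //; exact: compact_set1.
  exact: closed_openC.
have c : ccontinuous [set x : E | x != 0] (psi \o (fun x => K0oo_embed (w *: x))).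
  apply: ccontinuous_comp cpsi; last exact: continuous_K0oo_embed.
  by move=> x x0; apply: K0oo_embed_in; rewrite scaler_eq0 gt_eqF.
have [m1 m2] := ccontinuous_cmeasurable o0 c.
have mO := open_measurable_rV o0.
have UT : setT = [set x : E | x != 0] `|` [set 0].
  by apply/seteqP; split => // x _; have [->|x0] := eqVneq x 0; [right|left].
have m0 : measurable [set (0 : E)].
  by rewrite -[X in measurable X]setCK; apply: measurableC; move: mO; congr measurable;
    apply/seteqP; split => x /= /eqP.
by split; rewrite UT; apply/measurable_funU => //; split => //; exact: measurable_fun_set1.
Qed.

(** Compactness bounds psi on [K0oo]; the value at the embedding of 0 is added to the bound. *)
Lemma bounded_K0oo (psi : E * \bar R -> R[i]) : ccontinuous (@K0oo R d) psi ->
  exists B : R, forall x : E, normc (psi (K0oo_embed x)) <= B.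
Proof.
move=> cpsi; have [B B0 HB] := cbounded_compact compact_K0oo (@subset_refl _ _) cpsi.
exists (B + normc (psi (K0oo_embed 0))) => x; have [->|x0] := eqVneq x 0.
  by rewrite lerDr.
by rewrite (le_trans (HB _ (K0oo_embed_in x0)))// lerDl normc_ge0.
Qed.

End within_continuity.

(** * Tensor products and density *)

Section complex_limits.
Variable R : realType.
Implicit Types (z w : nat -> R[i]).

Lemma ccvgD z w a b : ccvg z a -> ccvg w b -> ccvg (fun n => z n + w n) (a + b).
Proof.
move=> [z1 z2] [w1 w2]; split.
  by rewrite ReD; under eq_fun do rewrite ReD; exact: cvgD.
by rewrite ImD; under eq_fun do rewrite ImD; exact: cvgD.
Qed.

Lemma ccvgZ c z a : ccvg z a -> ccvg (fun n => c * z n) (c * a).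
Proof.
move=> [z1 z2]; split.
  rewrite ReM; under eq_fun do rewrite ReM.
  by apply: cvgB; apply: cvgM => //; exact: cvg_cst.
rewrite ImM; under eq_fun do rewrite ImM.
by apply: cvgD; apply: cvgM => //; exact: cvg_cst.
Qed.

Lemma ccvg_sum (I : Type) (s : seq I) (P : pred I) (z : I -> nat -> R[i]) (l : I -> R[i]) :
  (forall i, P i -> ccvg (z i) (l i)) ->
  ccvg (fun n => \sum_(i <- s | P i) z i n) (\sum_(i <- s | P i) l i).
Proof.
move=> H; elim: s => [|i s IH].
  by rewrite big_nil; split; under eq_fun do rewrite big_nil; exact: cvg_cst.
rewrite big_cons; case: (boolP (P i)) => Pi.
  rewrite (_ : (fun n => _) = (fun n => z i n + \sum_(j <- s | P j) z j n)).
    by apply: ccvgD => //; exact: H.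
  by apply/funext => n; rewrite big_cons Pi.
rewrite (_ : (fun n => _) = (fun n => \sum_(j <- s | P j) z j n))//.
by apply/funext => n; rewrite big_cons (negbTE Pi).
Qed.

Lemma ccvg_normc0 z l : ccvg z l -> (fun n => normc (z n)) @ \oo --> (0 : R) -> l = 0.
Proof.
move=> [z1 z2] z0.
have H (f : nat -> R) (a : R) : (forall n, `|f n| <= normc (z n)) -> f @ \oo --> a -> a = 0.
  move=> fz fa; apply: (cvg_unique _ fa) => //; apply: norm_cvg0.
  by apply: (squeeze_cvgr _ (cvg_cst 0) z0); apply: nearW => n; rewrite normr_ge0 fz.
by apply: complexP; [apply: (H _ _ _ z1)|apply: (H _ _ _ z2)] => n;
  [exact: ler_Re_normc|exact: ler_Im_normc].
Qed.

End complex_limits.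

Section subsequences.
Variables (R : realType) (d : nat) (sigma : nat -> nat).
Hypothesis sigma_incr : forall n1 n2, (n1 < n2)%N -> (sigma n1 < sigma n2)%N.

Lemma cvg_subsequence : sigma @ \oo --> \oo.
Proof.
have le n : (n <= sigma n)%N.
  by elim: n => // n /leq_ltn_trans; apply; exact: sigma_incr.
by apply/cvgnyPge => N; exists N => // n /= /leq_trans; apply.
Qed.

Lemma L2null_subsequence (h : nat -> 'rV[R]_d -> R[i]) :
  L2null h -> L2null (fun n => h (sigma n)).
Proof.
move=> [mh lim]; split => //.
exact: (cvg_comp sigma (fun n => sqint (h n)) cvg_subsequence lim).
Qed.

End subsequences.

Section tensor_products.
Variables (R : realType) (d m l q r : nat) (lm : (l <= m)%N).
Local Notation E := 'rV[R]_d.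
Local Notation leb := (lebesgue_rV R d).
Variables (Om : set E) (oOm : open Om).
Variables (u : nat -> E -> 'cV[R[i]]_r) (wu : weakly_null Om u).
Variables (A : mi_le d m -> E -> 'M[R[i]]_(q, r)).
Hypothesis A_cont : forall (a : mi_le d m), (l <= mi_len a <= m)%N ->
  forall k i, ccontinuous Om (fun x => A a x k i).
Variables (omega : nat -> R) (omega_gt0 : forall n, 0 < omega n).
Variables (sigma : nat -> nat)
  (sigma_incr : forall n1 n2, (n1 < n2)%N -> (sigma n1 < sigma n2)%N).
Variable mu : 'I_r -> 'I_r -> (E * (E * \bar R) -> R[i]) -> R[i].
Hypothesis mu_H : one_scale_Hmeasure Om mu (fun n => u (sigma n)) (fun n => omega (sigma n)).
Local Notation X := (Om `*` @K0oo R d).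

(** As [K0oo] is compact, compact support in x is enough. *)
Lemma CcX_tensor (phi1 phi2 : E -> R[i]) (psi : E * \bar R -> R[i]) :
  Cc Om phi1 -> Cc Om phi2 -> ccontinuous (@K0oo R d) psi ->
  CcX Om (fun z => phi1 z.1 * conjc (phi2 z.1) * psi z.2).
Proof.
move=> [/ccontP c1 [K [cK KO] K0]] [/ccontP c2 _] cpsi.
have fstc (phi : E -> R[i]) : ccont phi -> ccontinuous X (fun z => phi z.1).
  move=> /ccontP cphi; apply: (ccontinuous_comp (g := fst) (B := setT)) cphi => //.
  by apply: continuous_subspaceT => z; exact: cvg_fst.
split.
  apply: (ccontM (T := subspace X)); last first.
    apply: (ccontinuous_comp (g := snd)) cpsi; first by move=> z [].
    by apply: continuous_subspaceT => z; exact: cvg_snd.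
  by apply: (ccontM (T := subspace X)); [exact: fstc|apply: (ccontJ (T := subspace X)); exact: fstc].
exists (K `*` @K0oo R d).
  split; first exact: compact_setX cK (@compact_K0oo R d).
  by move=> z [Kz Xz]; split => //; exact: KO.
by move=> z [_ Xz] Lz; rewrite K0 ?mul0r// => Kz; apply: Lz.
Qed.

(** The monomial in xi/|xi| is continuous on the compactification, so it can be moved from the
    symbol into the test function psi. *)
Definition weighted_direction (a : mi_le d m) (psi : E * \bar R -> R[i]) (w : E * \bar R) : R[i] :=
  (\prod_(s < d) w.1 ord0 s ^+ mi_val a s)%:C * psi w.

Lemma ccontinuous_direction (a : mi_le d m) (B : set (E * \bar R)) :
  ccontinuous B (fun w => (\prod_(s < d) w.1 ord0 s ^+ mi_val a s)%:C).
Proof.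
under eq_fun do rewrite real_complex_prod.
apply: (ccont_prod (T := subspace B)) => s.
have c : ccont (T := subspace B) (fun w : E * \bar R => (w.1 ord0 s)%:C : R[i]).
  split => /=; last by move=> w; exact: cvg_cst.
  apply: continuous_subspaceT => w; apply: (cvg_comp fst (fun x : E => x ord0 s)).
    exact: cvg_fst.
  exact: coord_continuous.
elim: (mi_val a s) => [|n IH].
  by under eq_fun do rewrite expr0; exact: (@ccont_cst R (subspace B) (1%:C)).
under eq_fun do rewrite exprS real_complexM.
exact: (ccontM (T := subspace B)).
Qed.

Lemma ccontinuous_weighted_direction a psi : ccontinuous (@K0oo R d) psi ->
  ccontinuous (@K0oo R d) (weighted_direction a psi).
Proof.
move=> cpsi; apply: (ccontM (T := subspace (@K0oo R d))) => //.
exact: ccontinuous_direction.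
Qed.

Variables (phi : E -> R[i]) (tphi : test_fun Om phi) (k : 'I_q).
Hypothesis symbol_null : L2null (fun n x =>
  \sum_(a : mi_le d m | mi_len a == m) \sum_(i < r)
    direction_symbol a x * fourier (fun x => phi x * A a x k i * u n x i ord0) x).

Lemma Cc_coefficient (a : mi_le d m) i : mi_len a = m -> Cc Om (fun x => phi x * A a x k i).
Proof.
move=> am; have [sphi [K [cK KO] K0]] := tphi.
have la : (l <= mi_len a <= m)%N by rewrite am lm leqnn.
split; last by exists K => // x Kx; rewrite K0// mul0r.
apply/ccontP; apply: (glue_ccont oOm cK KO) => [|x Kx]; last by rewrite K0// mul0r.
by apply: ccontinuousM_within => //; [exact: smooth_ccont|exact: A_cont].
Qed.

(** The limit of one pairing is computed twice: termwise through the defining property of [mu], and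
    as 0 because an L^2-null sequence is paired with a bounded one. *)
Lemma tensor_null (phi2 : E -> R[i]) (psi : E * \bar R -> R[i]) (j : 'I_r) :
  Cc Om phi2 -> ccontinuous (@K0oo R d) psi ->
  \sum_(a : mi_le d m | mi_len a == m) \sum_(i < r) (0 +i* (2 * pi)) ^+ m *
    mu j i (fun z => phi z.1 * A a z.1 k i * conjc (phi2 z.1) * weighted_direction a psi z.2) = 0.
Proof.
move=> C2 cpsi; have [rad herm _ lim] := mu_H.
pose F a i n := fourier (fun x => phi x * A a x k i * u (sigma n) x i ord0).
pose G n := fourier (fun x => phi2 x * u (sigma n) x j ord0).
pose b (p : E * \bar R -> R[i]) n (x : E) := p (K0oo_embed (omega (sigma n) *: x)).
have fin phi1 i n : Cc Om phi1 -> sqfin (fourier (fun x => phi1 x * u n x i ord0)).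
  move=> C1; have [mv [C HC]] := L2bdd_fourier (fun n => cintegrable_mul_Cc oOm wu C1 i n) (L2bdd_mul_Cc oOm wu C1 i).
  by split => //; rewrite (le_lt_trans (HC n))// ltry.
have finG p n : ccontinuous (@K0oo R d) p -> sqfin (fun x => b p n x * conjc (G n x)).
  move=> cp; have [B HB] := bounded_K0oo cp.
  apply: (@sqfinM _ _ _ _ B).
  - exact: cmeas_K0oo.
  - by move=> x; exact: HB.
  have [mG fG] := fin phi2 j (sigma n) C2; split; first exact: cmeasJ.
  by rewrite /sqint; under eq_integral do rewrite normcJ.
have H (a : mi_le d m) (i : 'I_r) : mi_len a == m ->
    ccvg (fun n => (0 +i* (2 * pi)) ^+ m * cint leb (fun x => F a i n x * (b (weighted_direction a psi) n x * conjc (G n x))))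
      ((0 +i* (2 * pi)) ^+ m * mu j i (fun z => phi z.1 * A a z.1 k i * conjc (phi2 z.1) * weighted_direction a psi z.2)).
  move=> /eqP am; apply: ccvgZ; have C1 := Cc_coefficient i am.
  have cw := ccontinuous_weighted_direction a cpsi.
  (* The defining limit yields the conjugate of mu_ij; hermitian symmetry reads it as mu_ji. *)
  rewrite herm; last exact: (CcX_tensor C1 C2 cw).
  have := lim _ _ _ C1 C2 cw i j; congr (ccvg _ _); apply/funext => n.
  by apply: eq_cint => x; rewrite -mulrA [X in _ * X]mulrC.
have L := ccvg_sum (index_enum (mi_le d m)) (fun a am =>
  ccvg_sum (index_enum 'I_r) (P := xpredT) (fun i _ => H a i am)).
apply: (ccvg_normc0 L) => {L H}.
have bdd : L2bdd (fun n x => b psi n x * conjc (G n x)).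
  split; first by move=> n; exact: (finG psi n cpsi).1.
  have [B HB] := bounded_K0oo cpsi.
  have [mv [C HC]] := L2bdd_fourier (fun n => cintegrable_mul_Cc oOm wu C2 j n) (L2bdd_mul_Cc oOm wu C2 j).
  exists (B ^+ 2 * C) => n.
  apply: (le_trans (sqint_le (M := B) (g := G n) _ _ _)).
  - exact: (finG psi n cpsi).1.
  - exact: mv.
  - by move=> x; rewrite normcM normcJ ler_wpM2r ?normc_ge0//; exact: HB.
  rewrite [leRHS]EFinM lee_wpmul2l ?lee_fin ?sqr_ge0//.
  exact: (HC (sigma n)).
have := L2null_pairing (L2null_subsequence sigma_incr symbol_null) bdd.
rewrite (_ : (fun n => normc _) = (fun n => normc (\sum_(a : mi_le d m | mi_len a == m) \sum_(i < r)
  (0 +i* (2 * pi)) ^+ m * cint leb (fun x => F a i n x * (b (weighted_direction a psi) n x * conjc (G n x))))))//.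
apply/funext => n; congr normc.
have I (a : mi_le d m) i : mi_len a = m ->
    cintegrable leb (fun x => F a i n x * (b (weighted_direction a psi) n x * conjc (G n x))).
  move=> am; have [mF fF] := fin _ i (sigma n) (Cc_coefficient i am).
  have [mg fg] := finG _ n (ccontinuous_weighted_direction a cpsi).
  exact: mul_sqint_integrable.
rewrite [RHS](eq_bigr (fun a => cint leb (fun x => \sum_(i < r) (0 +i* (2 * pi)) ^+ m *
    (F a i n x * (b (weighted_direction a psi) n x * conjc (G n x)))))); last first.
  move=> a /eqP am; rewrite cint_sum; last by move=> i _; apply: cintegrableZ; exact: I.
  by apply: eq_bigr => i _; rewrite cintZ//; exact: I.
rewrite -cint_sum; last first.
  by move=> a /eqP am; apply: cintegrable_sum => i _; apply: cintegrableZ; exact: I.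
apply: eq_cint => x; rewrite mulr_suml; apply: eq_bigr => a _.
rewrite mulr_suml; apply: eq_bigr => i _.
(* The direction of omega x is that of x, so omega survives in psi only. *)
rewrite /b /weighted_direction K0oo_embed_scale// /direction_symbol /F.
by rewrite !mulrA; congr (_ * _ * _); rewrite -!mulrA; congr (_ * _); rewrite mulrC.
Qed.

End tensor_products.

(** * Radon functionals and the density of tensor products *)

Section radon_functionals.
Variables (R : realType) (d : nat).
Local Notation E := 'rV[R]_d.
Variables (Om : set E) (oOm : open Om).
Local Notation X := (Om `*` @K0oo R d).
Local Notation T := (E * (E * \bar R))%type.
Implicit Types F G : T -> R[i].

Lemma CcX0 : CcX Om (fun=> 0).
Proof.
split; first by split; apply: continuous_subspaceT => z; exact: cvg_cst.
by exists set0 => //; split => //; exact: compact0.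
Qed.

Lemma CcX_mul p F : ccontinuous X p -> CcX Om F -> CcX Om (fun z => p z * F z).
Proof.
move=> cp [cF [L cL L0]]; split; first exact: (ccontM (T := subspace X)).
by exists L => // z Xz Lz; rewrite L0 ?mulr0.
Qed.

Lemma CcXZ (c : R[i]) F : CcX Om F -> CcX Om (fun z => c * F z).
Proof. by move=> CF; apply: CcX_mul => //; exact: (@ccont_cst R (subspace X)). Qed.

Lemma CcXD F G : CcX Om F -> CcX Om G -> CcX Om (fun z => F z + G z).
Proof.
move=> [cF [L [cL LX] L0]] [cG [M [cM MX] M0]]; split.
  exact: (ccontD (T := subspace X)).
exists (L `|` M).
  by split; [exact: compactU|move=> z [/LX|/MX]].
by move=> z Xz LM; rewrite L0// ?M0 ?addr0// => h; apply: LM; [right|left].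
Qed.

Lemma CcX_sum (I : Type) (s : seq I) (P : pred I) (F : I -> T -> R[i]) :
  (forall i, P i -> CcX Om (F i)) -> CcX Om (fun z => \sum_(i <- s | P i) F i z).
Proof.
move=> CF; elim: s => [|i s IH]; first by under eq_fun do rewrite big_nil; exact: CcX0.
case: (boolP (P i)) => Pi; last by under eq_fun do rewrite big_cons (negbTE Pi).
by under eq_fun do rewrite big_cons Pi; apply: CcXD => //; exact: CF.
Qed.

Section linearity.
Variables (nu : (T -> R[i]) -> R[i]) (rnu : radon Om nu).

Lemma radon0 : nu (fun=> 0) = 0.
Proof.
have [lin _] := rnu; have := lin 1 _ _ CcX0 CcX0.
under eq_fun do rewrite mulr0 addr0; rewrite mul1r => /eqP.
by rewrite -subr_eq0 opprD addNKr oppr_eq0 => /eqP.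
Qed.

Lemma radonZ (c : R[i]) F : CcX Om F -> nu (fun z => c * F z) = c * nu F.
Proof.
move=> CF; have [lin _] := rnu; have := lin c _ _ CF CcX0.
by under eq_fun do rewrite addr0; rewrite radon0 addr0.
Qed.

Lemma radonD F G : CcX Om F -> CcX Om G -> nu (fun z => F z + G z) = nu F + nu G.
Proof.
move=> CF CG; have [lin _] := rnu; have := lin 1 _ _ CF CG.
by under eq_fun do rewrite mul1r; rewrite mul1r.
Qed.

Lemma radon_sum (I : Type) (s : seq I) (P : pred I) (F : I -> T -> R[i]) :
  (forall i, P i -> CcX Om (F i)) ->
  nu (fun z => \sum_(i <- s | P i) F i z) = \sum_(i <- s | P i) nu (F i).
Proof.
move=> CF; elim: s => [|i s IH].
  by rewrite big_nil; under eq_fun do rewrite big_nil; exact: radon0.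
rewrite big_cons; case: (boolP (P i)) => Pi; last first.
  by under eq_fun do rewrite big_cons (negbTE Pi).
under eq_fun do rewrite big_cons Pi.
by rewrite radonD ?IH//; [exact: CF|exact: CcX_sum].
Qed.

End linearity.

(** Each point offers a radius, valid on a neighbourhood together with all smaller ones; compactness
    makes one radius valid everywhere. *)
Lemma compact_uniform_radius (S : topologicalType) (K : set S) (P : R -> S -> Prop) :
  compact K ->
  (forall x, K x -> exists2 r : R, 0 < r &
    \forall x' \near x, K x' -> forall e, 0 < e -> e < r -> P e x') ->
  exists2 r, 0 < r & forall x, K x -> P r x.
Proof.
move=> cK HP.
have : \forall e \near 0^'+, K `<=` [set x | K x -> P e x].
  apply: (iffLR (compact_near_coveringP K) cK R (0^'+ : set_system R) (fun e x => K x -> P e x)) => x Kx.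
  have [r r0 Hr] := HP x Kx.
  exists ([set x' | K x' -> forall e, 0 < e -> e < r -> P e x'], [set e : R | 0 < e < r]).
    split => //=; near=> e; apply/andP; split => //.
  by move=> [x' e] [/= h /andP[e0 er]] Kx'; exact: h.
move=> /(filterI (nbhs_right_gt 0))/filter_ex[r [r0 Hr]].
by exists r => // x Kx; exact: Hr.
Unshelve. all: by end_near. Qed.

Lemma ccontinuous_near (S : topologicalType) (A : set S) (f : S -> R[i]) x (e : R) :
  ccontinuous A f -> A x -> 0 < e ->
  \forall y \near x, A y -> normc (f x - f y) <= e.
Proof.
move=> [/subspace_continuousP f1 /subspace_continuousP f2] Ax e0.
have e2 : 0 < e / 2 by rewrite divr_gt0.
have n1 := (@cvgrPdist_le _ _ _ _ (within_filter A (nbhs_filter x)) _ _).1 (f1 x Ax) _ e2.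
have n2 := (@cvgrPdist_le _ _ _ _ (within_filter A (nbhs_filter x)) _ _).1 (f2 x Ax) _ e2.
move: n1 n2; rewrite !near_withinE; apply: filterS2 => y h1 h2 Ay.
rewrite (le_trans (ler_normc_ReIm _))// ReD ImD ReN ImN.
by rewrite [leRHS](splitr e) lerD ?h1 ?h2.
Qed.

(* Divides a sum of bumps by itself where it is at least [s], and cuts it off where it
   vanishes, without leaving the compactly supported functions. *)
Definition cutoff_inverse (s t : R) : R := Num.min (t / s) 1 / Num.max t s.

Lemma continuous_cutoff_inverse s : 0 < s -> continuous (cutoff_inverse s).
Proof.
move=> s0 t; rewrite /cutoff_inverse /continuous_at.
have m0 : Num.max t s != 0 by rewrite gt_eqF// lt_max s0 orbT.
apply: cvgM; last apply: cvgV => //.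
  have c1 : {for t, continuous (fun t : R => t / s : R^o)}.
    by apply: cvgM; [exact: cvg_id|exact: cvg_cst].
  exact: (continuous_min c1 (@cst_continuous _ _ (1 : R^o) t)).
exact: (continuous_max (@cvg_id _ _ : {for t, continuous (fun t : R => t : R^o)}) (@cst_continuous _ _ (s : R^o) t)).
Qed.

Lemma cutoff_inverse0 s : 0 < s -> cutoff_inverse s 0 = 0.
Proof. by move=> s0; rewrite /cutoff_inverse mul0r min_l// mul0r. Qed.

Lemma cutoff_inverse_ge0 s t : 0 < s -> 0 <= t -> 0 <= cutoff_inverse s t.
Proof.
move=> s0 t0; rewrite divr_ge0// ?le_min ?le_max ?t0//.
by rewrite divr_ge0 ?(ltW s0)// ler01.
Qed.

Lemma mul_cutoff_inverse_eq1 s t : 0 < s -> s <= t -> t * cutoff_inverse s t = 1.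
Proof.
move=> s0 st; have t0 := lt_le_trans s0 st.
by rewrite /cutoff_inverse min_r ?ler_pdivlMr ?mul1r// max_l// mulfV// gt_eqF.
Qed.

Lemma mul_cutoff_inverse_le1 s t : 0 < s -> 0 <= t -> t * cutoff_inverse s t <= 1.
Proof.
move=> s0 t0; have [st|ts] := leP s t; first by rewrite mul_cutoff_inverse_eq1.
rewrite /cutoff_inverse mulrA ler_pdivrMr ?lt_max ?s0 ?orbT// mul1r.
rewrite (max_r (ltW ts)) (le_trans (ltW _) (lexx s))//.
by rewrite (le_lt_trans _ ts)// ler_piMr// ge_min lexx orbT.
Qed.

(* [F] is uniformly approximated by [sum_x bump_x(y) g(y) F(x, w)], where the bumps of
   small radius cover the projection of its support. *)
Lemma radon_density (nu : (T -> R[i]) -> R[i]) : radon Om nu ->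
  (forall phi phi2 psi, test_fun Om phi -> Cc Om phi2 -> ccontinuous (@K0oo R d) psi ->
    nu (fun z => phi z.1 * conjc (phi2 z.1) * psi z.2) = 0) ->
  forall F, CcX Om F -> nu F = 0.
Proof.
move=> rnu tens F CF; have [cF [L [cL LX] L0]] := CF.
have nb (x : E) (s : R) : 0 < s -> nbhs x [set y : E | `|x - y| < s].
  by move=> s0; apply/nbhs_ballP; exists s => // y; rewrite -ball_normE.
pose L1 := fst @` L.
have cL1 : compact L1.
  by apply: continuous_compact cL; apply: continuous_subspaceT => z; exact: cvg_fst.
have L1O : L1 `<=` Om by move=> _ [z /LX[Oz _] <-].
have [delta d0 Hd] : exists2 r : R, 0 < r & forall x, L1 x -> forall y : E, `|y - x| <= r -> Om y.
  apply: compact_uniform_radius cL1 _ => x /L1O Ox.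
  have [r r0 rO] := compact_neighborhood oOm Ox.
  exists (r / 2); first by rewrite divr_gt0.
  have : nbhs x [set x' : E | `|x - x'| < r / 2] by apply: nb; rewrite divr_gt0.
  apply: filterS => x' xx' _ e e0 er y yx'; apply: rO => /=.
  rewrite (_ : y - x = (y - x') - (x - x')); last by rewrite opprB addrA subrK.
  by rewrite (le_trans (ler_normB _ _))// [leRHS](splitr r) lerD// ltW// (le_lt_trans yx').
(* A compact neighbourhood of [L1] inside [Om], which will contain the supports of all the bumps. *)
pose L2 := (fun p : E * E => p.1 + p.2) @` (L1 `*` [set y : E | `|y - 0| <= delta]).
have cL2 : compact L2.
  apply: continuous_compact; last by apply: compact_setX => //; exact: closed_norm_ball_compact.
  apply: continuous_subspaceT => p; have FF := nbhs_filter p.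
  by apply: (@cvgD _ _ _ _ FF); [exact: cvg_fst|exact: cvg_snd].
have L2E x y : L1 x -> `|y - x| <= delta -> L2 y.
  move=> Lx yx; exists (x, y - x) => /=; last by rewrite addrC subrK.
  by split => //=; rewrite subr0.
have L2O : L2 `<=` Om.
  move=> y' [[x y] [/= Lx]]; rewrite subr0 => yd <-; apply: (Hd x Lx).
  by rewrite /= addrC addKr.
have cK := @compact_K0oo R d.
(* One constant serves all approximants, since their supports stay in this fixed compact set; it is
   obtained before eps is chosen. *)
have [c Hc] := rnu.2 (L2 `*` @K0oo R d) (compact_setX cL2 cK) (fun z h => conj (L2O _ h.1) h.2).
suff bound eps : 0 < eps -> normc (nu F) <= c * eps.
  apply: normc_eq0; apply/eqP; rewrite eq_le normc_ge0 andbT; apply/ler_addgt0Pr => e e0.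
  have h : 0 < `|c| + 1 by rewrite ltr_wpDl.
  rewrite add0r (le_trans (bound (e / (`|c| + 1)) _)) ?divr_gt0//.
  rewrite mulrCA ler_piMr ?(ltW e0)// ler_pdivrMr// mul1r.
  by rewrite (le_trans (ler_norm c))// lerDl.
move=> eps0.
have [rho1 rho10 Hrho1] : exists2 r : R, 0 < r & forall w : T, (L1 `*` @K0oo R d) w ->
    forall y : E, `|y - w.1| < r -> normc (F (y, w.2) - F w) <= eps.
  apply: compact_uniform_radius (compact_setX cL1 cK) _ => -[x z] [/= Lx Kz].
  have Xw : X (x, z) by split => //=; exact: L1O.
  have e2 : 0 < eps / 2 by rewrite divr_gt0.
  have [[U1 U2] [/= /nbhs_ballP[e /= e0 eU] nU2] UU] := ccontinuous_near cF Xw e2.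
  (* The e/2 leaves room for moving both x' and y; delta keeps y in [Om], where F is continuous. *)
  have he : 0 < Num.min (e / 2) delta by rewrite lt_min d0 divr_gt0.
  exists (Num.min (e / 2) delta) => //.
  have n1 : nbhs x [set x' : E | `|x - x'| < e / 2].
    by apply: nb; rewrite divr_gt0.
  exists ([set x' : E | `|x - x'| < e / 2], U2) => //= -[x' z'] [/= xx' Uz'] [/= Lx' Kz'] s s0.
  rewrite lt_min => /andP[se sd] y yx'.
  have Oy : Om y by apply: (Hd x' Lx'); rewrite ltW// (lt_trans yx').
  have h1 : normc (F (x, z) - F (x', z')) <= eps / 2.
    apply: UU; last by split => //=; exact: L1O.
    split => //=; apply: eU; rewrite -ball_normE/= (lt_le_trans xx')//.
    by rewrite ler_pdivrMr// ler_peMr ?ler1n// ltW.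
  have h2 : normc (F (x, z) - F (y, z')) <= eps / 2.
    apply: UU; last by split.
    split => //=; apply: eU; rewrite -ball_normE/=.
    rewrite (_ : x - y = (x - x') - (y - x')); last by rewrite opprB addrA subrK.
    rewrite (le_lt_trans (ler_normB _ _))// [ltRHS](splitr e) ltrD// (lt_trans yx')//.
  rewrite (_ : _ - _ = (F (x, z) - F (x', z')) - (F (x, z) - F (y, z'))); last by ring.
  by rewrite (le_trans (ler_normcB _ _))// [leRHS](splitr eps) lerD.
pose rho := Num.min rho1 delta.
have rho0 : 0 < rho by rewrite lt_min rho10.
have [D DL Dcov] : finite_subset_cover L1 (fun x : E => [set y : E | `|y - x| < rho]) L1.
  move: (cL1); rewrite compact_cover; apply => [x Lx|x Lx].
    rewrite (_ : [set y | _] = ball x rho); first exact: ball_open.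
    by apply/seteqP; split => y; rewrite -ball_normE /= distrC.
  by exists x => //=; rewrite subrr normr0.
have {}DL x : x \in D -> L1 x by move=> /DL; rewrite inE.
pose S y := \sum_(x <- D) bump x rho y.
have S0 y : 0 <= S y by apply: sumr_ge0 => x _; exact: bump_ge0.
have cS : continuous S.
  have [+ _] : ccont (fun y => \sum_(x <- D) (bump x rho y)%:C : R[i]).
    by apply: ccont_sum => x; apply: smooth_ccont; exact: smooth_bump.
  by under eq_fun do rewrite Re_sum.
have SL y : L1 y -> 0 < S y.
  move=> /Dcov[x /= xD yx]; rewrite /S (big_rem x)//= ltr_pwDl//.
    by rewrite bump_gt0P.
  by apply: sumr_ge0 => x' _; exact: bump_ge0.
(* A positive lower bound on the sum of bumps over [L1]: the threshold of the cutoff, so that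
   [S * g] equals 1 there. *)
have [s0 s00 Hs0] : exists2 s0, 0 < s0 & forall y, L1 y -> s0 <= S y.
  have [L10|L10] := pselect (L1 !=set0); last first.
    by exists 1 => // y Ly; exfalso; apply: L10; exists y.
  have [y /set_mem Ly Hy] := EVT_min_rV L10 cL1 (continuous_subspaceT cS).
  by exists (S y); [exact: SL|move=> y' /mem_set; exact: Hy].
have bump0 x y : x \in D -> ~ L2 y -> bump x rho y = 0.
  move=> xD Ly; apply/eqP; rewrite eq_le bump_ge0 andbT leNgt bump_gt0P//; apply/negP => yx.
  apply: Ly; apply: (L2E x); first exact: DL.
  by rewrite ltW// (lt_le_trans yx)// ge_min lexx orbT.
pose g y := cutoff_inverse s0 (S y).
have g_ge0 y : 0 <= g y by exact: cutoff_inverse_ge0.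
have Cg : Cc Om (fun y => (g y)%:C).
  split; last first.
    exists L2 => // y Ly; rewrite /g (_ : S y = 0) ?cutoff_inverse0//.
    by rewrite /S big_seq big1// => x xD; exact: bump0.
  apply/ccontP; split => /= y; last exact: cst_continuous.
  by apply: (@continuous_comp _ _ _ S (cutoff_inverse s0)); [exact: cS|exact: continuous_cutoff_inverse].
have tb x : x \in D -> test_fun Om (fun y => (bump x rho y)%:C).
  move=> xD; split; first exact: smooth_bump.
  by exists L2 => // y Ly; rewrite bump0.
have cF_slice x : x \in D -> ccontinuous (@K0oo R d) (fun w => F (x, w)).
  move=> /DL/L1O Ox; apply: (ccontinuous_comp (g := fun w => (x, w))) cF; first by move=> w Kw.
  apply: continuous_subspaceT => w.
  have h1 : (fun _ : E * \bar R => x) @ w --> x by exact: cst_continuous.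
  exact: (cvg_pair h1 (@cvg_id _ (nbhs w))).
pose H x (z : T) := (bump x rho z.1)%:C * conjc (g z.1)%:C * F (x, z.2).
have CH x : x \in D -> CcX Om (H x).
  move=> xD; have [/smooth_ccont/ccontP sb kb] := tb x xD.
  exact: (CcX_tensor (conj sb kb) Cg (cF_slice x xD)).
pose G z := \sum_(x <- D | x \in D) H x z.
have CG : CcX Om G by exact: CcX_sum.
have G0 : nu G = 0.
  rewrite (radon_sum rnu) // big1 // => x xD.
  exact: (tens _ _ _ (tb x xD) Cg (cF_slice x xD)).
(* The approximant [G] is a sum of tensor products, so it can be subtracted freely. *)
have -> : nu F = nu (fun z => -1 * G z + F z) by rewrite rnu.1// G0 mulr0 add0r.
apply: Hc.
- by apply: CcXD => //; exact: CcXZ.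
- move=> [y w] [Oy Kw] Lz /=; have Ly : ~ L2 y by move=> Ly; apply: Lz.
  rewrite L0 //; last first.
    by move=> Lyw; apply: Ly; apply: (L2E y); [exists (y, w)|rewrite subrr normr0 ltW].
  by rewrite addr0 /G big1 ?mulr0// => x xD; rewrite /H/= bump0// !mul0r.
move=> [y w] Xz; have [/= Oy Kw] := Xz.
(* Either y is in [L1], where the weights sum to 1, or F vanishes. Thus F may be spread over the
   bumps, and the error becomes a weighted sum of increments F(y, w) - F(x, w). *)
have W0 : (1 - S y * g y)%:C * F (y, w) = 0.
  have [Ly|Ly] := pselect (L1 y).
    by rewrite mul_cutoff_inverse_eq1 ?subrr ?mul0r//; exact: Hs0.
  by rewrite L0 ?mulr0// => Lyw; apply: Ly; exists (y, w).
have -> : -1 * G (y, w) + F (y, w) =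
    \sum_(x <- D | x \in D) (bump x rho y * g y)%:C * (F (y, w) - F (x, w)).
  rewrite mulN1r -[F (y, w) in LHS]mul1r (_ : 1 = (1 - S y * g y)%:C + (S y * g y)%:C :> R[i]); last first.
    by rewrite -rmorphD/= subrK.
  rewrite mulrDl W0 add0r.
  have -> : S y * g y = \sum_(x <- D | x \in D) bump x rho y * g y by rewrite /S big_seq mulr_suml.
  rewrite rmorph_sum/= mulr_suml /G -sumrN -big_split/=.
  apply: eq_bigr => x xD; rewrite /H conjcR (real_complexM (bump x rho y) (g y))/=; ring.
rewrite (le_trans (ler_normc_sum _ _ _))//.
(* A bump is nonzero only within [rho] of its centre, where the increment is at most eps, and the
   weights sum to at most 1. *)
rewrite (@le_trans _ _ (\sum_(x <- D | x \in D) bump x rho y * g y * eps))//; last first.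
  rewrite -big_seq -mulr_suml -mulr_suml -[leRHS]mul1r ler_wpM2r ?(ltW eps0)//.
  exact: (mul_cutoff_inverse_le1 s00 (S0 y)).
apply: ler_sum => x xD; have bg := mulr_ge0 (bump_ge0 x rho y) (g_ge0 y).
rewrite normcM normcR (ger0_norm bg).
have [yx|yx] := ltP `|y - x| rho.
  rewrite (ler_wpM2l bg)//.
  by apply: (Hrho1 (x, w) (conj (DL x xD) Kw)); rewrite (lt_le_trans yx)// ge_min lexx.
rewrite (_ : bump x rho y = 0) ?mul0r//.
by apply/eqP; rewrite eq_le bump_ge0 andbT leNgt bump_gt0P// -leNgt.
Qed.

End radon_functionals.

Section principal_functional.
Variables (R : realType) (d m q r : nat).
Local Notation E := 'rV[R]_d.
Local Notation T := (E * (E * \bar R))%type.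
Variables (Om : set E).
Local Notation X := (Om `*` @K0oo R d).
Variables (A : mi_le d m -> E -> 'M[R[i]]_(q, r)).
Hypothesis A_cont : forall a : mi_le d m, mi_len a = m ->
  forall k i, ccontinuous Om (fun x => A a x k i).
Variable mu : 'I_r -> 'I_r -> (T -> R[i]) -> R[i].
Hypothesis rmu : forall i j, radon Om (mu i j).

Lemma principal_symbolE x w k i : principal_symbol A x w k i =
  \sum_(a : mi_le d m | mi_len a == m)
    (0 +i* (2 * pi)) ^+ m * (\prod_(s < d) w.1 ord0 s ^+ mi_val a s)%:C * A a x k i.
Proof. by rewrite /principal_symbol summxE; apply: eq_bigr => a _; rewrite mxE. Qed.

Lemma ccontinuous_principal_symbol k i :
  ccontinuous X (fun z => principal_symbol A z.1 z.2 k i).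
Proof.
under eq_fun do rewrite principal_symbolE big_mkcond.
apply: (ccont_sum (T := subspace X)) => a.
have [am|_] := eqVneq (mi_len a) m; last exact: (@ccont_cst R (subspace X)).
apply: (ccontM (T := subspace X)); last first.
  apply: (ccontinuous_comp (g := fst)) (A_cont am k i); first by move=> z [].
  by apply: continuous_subspaceT => z; exact: cvg_fst.
apply: (ccontM (T := subspace X)); first exact: (@ccont_cst R (subspace X)).
apply: (ccontinuous_comp (g := snd)) (ccontinuous_direction a (@K0oo R d)); first by move=> z [].
by apply: continuous_subspaceT => z; exact: cvg_snd.
Qed.

(** Lets the density argument run on the whole sum over i: only the sum, not each [mu j i], vanishes
    on tensor products. *)
Lemma radon_principal_functional k j :
  radon Om (fun F => \sum_(i < r) mu j i (fun z => principal_symbol A z.1 z.2 k i * F z)).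
Proof.
pose p i (z : T) := principal_symbol A z.1 z.2 k i.
have cp i : ccontinuous X (p i) := ccontinuous_principal_symbol k i.
split => [a F G CF CG|L cL LX].
  rewrite mulr_sumr -big_split/=; apply: eq_bigr => i _.
  rewrite -(rmu j i).1; [|exact: (CcX_mul (cp i))|exact: (CcX_mul (cp i))].
  by congr (mu j i _); apply/funext => z; rewrite mulrDr mulrCA.
have /boolp.choice[c Hc] : forall i, exists c, forall F, CcX Om F ->
    (forall z, X z -> ~ L z -> F z = 0) -> forall M : R, (forall z, X z -> normc (F z) <= M) ->
    normc (mu j i F) <= c * M by move=> i; exact: (rmu j i).2.
have /boolp.choice[B HB] : forall i, exists B : R, 0 <= B /\ forall z, L z -> normc (p i z) <= B.
  by move=> i; have [B B0 HB] := cbounded_compact cL LX (cp i); exists B.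
exists (\sum_(i < r) c i * B i) => F CF F0 M HM.
rewrite (le_trans (ler_normc_sum _ _ _))// mulr_suml; apply: ler_sum => i _.
rewrite -mulrA; apply: Hc; first exact: (CcX_mul (cp i)).
  by move=> z Xz Lz; rewrite F0// mulr0.
move=> z Xz; have M0 := le_trans (normc_ge0 _) (HM z Xz); have [B0 HBi] := HB i.
have [Lz|Lz] := pselect (L z); last by rewrite F0// mulr0 normc0 mulr_ge0.
by rewrite normcM ler_pM ?normc_ge0 ?HBi ?HM.
Qed.

End principal_functional.

Theorem theorem11 (R : realType) (d m l q r : nat) (lm : (l <= m)%N)
  (Om : set 'rV[R]_d) (oOm : open Om)
  (u : nat -> 'rV[R]_d -> 'cV[R[i]]_r) (u_weak : weakly_null Om u)
  (eps : nat -> R) (eps0 epsoo : R) (eps0_gt0 : 0 < eps0)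
  (eps_bnd : forall n, eps0 <= eps n <= epsoo)
  (A_ : nat -> mi_le d m -> 'rV[R]_d -> 'M[R[i]]_(q, r))
  (A : mi_le d m -> 'rV[R]_d -> 'M[R[i]]_(q, r))
  (A_cont : forall n (a : mi_le d m), (l <= mi_len a <= m)%N ->
     forall k i, ccontinuous Om (fun x => A_ n a x k i))
  (A_cvg : forall a : mi_le d m, (l <= mi_len a <= m)%N ->
     cvg_loc_unif Om (fun n => A_ n a) (A a))
  (f : nat -> 'I_q -> ('rV[R]_d -> R[i]) -> R[i])
  (f_Hneg : forall n k, Hneg_loc Om m (f n k))
  (f_null : hweight_null Om l m eps f)
  (pde : forall n, pde_solution Om l (eps n) (A_ n) (u n) (f n))
  (omega : nat -> R) (omega_gt0 : forall n, 0 < omega n)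
  (omega_cvg0 : omega @ \oo --> (0 : R))
  (sigma : nat -> nat)
  (sigma_incr : forall n1 n2, (n1 < n2)%N -> (sigma n1 < sigma n2)%N)
  (mu : 'I_r -> 'I_r -> ('rV[R]_d * ('rV[R]_d * \bar R) -> R[i]) -> R[i])
  (mu_H : one_scale_Hmeasure Om mu (fun n => u (sigma n))
            (fun n => omega (sigma n))) :
  mul_trmx_null Om mu (principal_symbol A).
Proof.
have A_lim (a : mi_le d m) : (l <= mi_len a <= m)%N -> forall k i, ccontinuous Om (fun x => A a x k i).
  by move=> la k i; apply: (limit_ccontinuous oOm A_cont A_cvg).
have A_top (a : mi_le d m) : mi_len a = m -> forall k i, ccontinuous Om (fun x => A a x k i).
  by move=> am; apply: A_lim; rewrite am lm leqnn.
have [rmu _ _ _] := mu_H.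
move=> k j; apply: (radon_density oOm (radon_principal_functional A_top rmu k j)).
move=> phi phi2 psi tphi C2 cpsi; have [sphi [K [cK KO] phi0]] := tphi.
have null := L2null_symbol lm oOm u_weak eps0_gt0 eps_bnd A_cont A_cvg f_null pde cK KO sphi phi0 k.
have := tensor_null lm oOm u_weak A_lim omega_gt0 sigma_incr mu_H tphi null j C2 cpsi.
rewrite exchange_big/=; apply: etrans; apply: eq_bigr => i _.
pose H a z := phi z.1 * A a z.1 k i * conjc (phi2 z.1) * weighted_direction a psi z.2.
have CH (a : mi_le d m) : mi_len a == m -> CcX Om (H a).
  move=> /eqP am; have C1 := Cc_coefficient lm oOm A_lim tphi k i am.
  exact: (CcX_tensor C1 C2 (ccontinuous_weighted_direction a cpsi)).
(* Linearity gathers the sum over multi-indices inside [mu j i], which reconstitutes the entry of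
   the principal symbol. *)
transitivity (mu j i (fun z => \sum_(a : mi_le d m | mi_len a == m) (0 +i* (2 * pi)) ^+ m * H a z)).
  congr (mu j i _); apply/funext => z; rewrite principal_symbolE mulr_suml.
  by apply: eq_bigr => a _; rewrite /H /weighted_direction; ring.
rewrite (radon_sum (rmu j i)); last by move=> a am; apply: CcXZ; exact: CH.
by apply: eq_bigr => a am; rewrite (radonZ (rmu j i))//; exact: CH.
Qed.
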